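(* Let $g\geq 1$ and let $\operatorname{Aut}(H_1(N_g;\mathbb Z_2),\cdot)$ be the group of automorphisms of $H_1(N_g;\mathbb Z_2)$ preserving the mod $2$ intersection form. Let $a_1,\dots,a_{g-1}$ (for $g\ge 2$) and $b$ (for $g\geq 4$) be the elements of this group defined in the context. If $g=1,2,3$, then $\operatorname{Aut}(H_1(N_g;\mathbb Z_2),\cdot)$ is the following group: - $\operatorname{Aut}(H_1(N_1;\mathbb Z_2),\cdot)=1$, - $\operatorname{Aut}(H_1(N_2;\mathbb Z_2),\cdot)=\langle a_1 \mid a_1^2=1\rangle\cong\mathbb Z_2$, - $\operatorname{Aut}(H_1(N_3;\mathbb Z_2),\cdot)=\langle a_1,a_2 \mid a_1^2=a_2^2=(a_1a_2)^3=1\rangle$. If $g\geq 4$ is odd, or $g=4$, or $g=6$, then $\operatorname{Aut}(H_1(N_g;\mathbb Z_2),\cdot)$ admits a presentation with generators $a_1,\dots,a_{g-1},b$ and relations: 1. $a_i^2=b^2=1$ for $i=1,\dots,g-1$, 2. $(a_ia_j)^2=1$ for $g\geq 4$, $|i-j|>1$, 3. $(a_ia_{i+1})^3=1$ for $g\geq 3$, $i=1,\dots,g-2$, 4. $(a_ib)^2=1$ for $g\geq 4$, $i\neq 4$, 5. $(a_4b)^3=1$ for $g\geq 5$, 6. $(a_2a_3a_4a_5a_6b)^{12}=(a_1a_2a_3a_4a_5a_6b)^9$ for $g\geq 7$. If $g\geq 8$ is even, then $\operatorname{Aut}(H_1(N_g;\mathbb Z_2),\cdot)$ admits a presentation with generators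 $a_1,\dots,a_{g-1},b,b_0,\dots,b_{\frac{g-2}{2}}$ and relations (1)--(6) listed above together with the following relations: 7. $b_0=a_1$, $b_1=b$, $b_2=(a_1a_2a_3a_4a_5b)^5$, 8. $b_{i+1}=(b_{i-1}a_{2i}a_{2i+1}a_{2i+2}a_{2i+3}b_i)^5(b_{i-1}a_{2i}a_{2i+1}a_{2i+2}a_{2i+3})^{-6}$ for $2\leq i\leq\frac{g-4}{2}$, 9. $[a_{g-5},b_{\frac{g-2}{2}}]=1$.
   Context: $N_g$ is the closed connected non-orientable surface of genus $g$ (a sphere with $g$ crosscaps). $\cdot: H_1(N_g;\mathbb Z_2)\times H_1(N_g;\mathbb Z_2)\to\mathbb Z_2$ is the mod $2$ intersection form. $H_1(N_g;\mathbb Z_2)$ has a basis $x_1,\dots,x_g$, where $x_i$ is the class of the core of the $i$-th crosscap, and $x_i\cdot x_j=\delta_{ij}$. $\operatorname{Aut}(H_1(N_g;\mathbb Z_2),\cdot)$ is the subgroup of automorphisms of $H_1(N_g;\mathbb Z_2)$ preserving $\cdot$; using the basis $\{x_1,\dots,x_g\}$ it is identified with $O(g,\mathbb Z_2)=\{M\in GL(g,\mathbb Z_2)\mid {}^tMM=E\}$, where $E$ is the identity matrix. The elements $a_i$ ($i=1,\dots,g-1$, for $g\ge2$) and $b$ (for $g\geq4$) of $\operatorname{Aut}(H_1(N_g;\mathbb Z_2),\cdot)$ are defined as follows. $a_i$ sends $x_i\mapsto x_{i+1}$, $x_{i+1}\mapsto x_i$ and $x_k\mapsto x_k$ for $k\neq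 i,i+1$. $b$ sends $x_1\mapsto x_2+x_3+x_4$, $x_2\mapsto x_1+x_3+x_4$, $x_3\mapsto x_1+x_2+x_4$, $x_4\mapsto x_1+x_2+x_3$ and $x_k\mapsto x_k$ for $k\neq1,2,3,4$. Words are read from right to left (as compositions of maps), and $[X,Y]=XYX^{-1}Y^{-1}$. In the relations, indices of the $a_i$ range over $1,\dots,g-1$. In the presentations the generators $a_i,b$ correspond to the elements just defined. *)

(* Defs.v *)
From HB Require Import structures.
From mathcomp Require Import all_boot all_order all_algebra.
From mathcomp Require Import boolp.

Set Implicit Arguments.
Unset Strict Implicit.
Unset Printing Implicit Defensive.

Import GRing.Theory.

(* Words over T: the letter (x, false) stands for x and (x, true) for x^-1.
   The free group on T is [word T] modulo [free_eq]. *)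
Definition word (T : Type) := seq (T * bool).

Declare Scope word_scope.
Delimit Scope word_scope with W.
Bind Scope word_scope with word.

Section Words.
Variable T : Type.

Definition letter (x : T) : word T := [:: (x, false)].
Definition wone : word T := [::].
Definition wmul (u v : word T) : word T := u ++ v.
Definition winv (u : word T) : word T := rev [seq (l.1, ~~ l.2) | l <- u].
Definition wexp (u : word T) (n : nat) : word T := iter n (wmul u) wone.

Inductive free_eq : word T -> word T -> Prop :=
| free_eq_refl u : free_eq u u
| free_eq_sym u v : free_eq u v -> free_eq v u
| free_eq_trans u v w : free_eq u v -> free_eq v w -> free_eq u w
| free_eq_cancel u v x e :
    free_eq (u ++ (x, e) :: (x, ~~ e) :: v) (u ++ v).

End Words.

Notation "1" := (@wone _) : word_scope.
Notation "u * v" := (wmul u v) : word_scope.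
Notation "u ^-1" := (winv u) : word_scope.
Notation "u ^+ n" := (wexp u n) : word_scope.
Notation "u ^- n" := (winv (wexp u n)) : word_scope.

Section Presentations.
Variable T : Type.
Local Open Scope word_scope.

(* The normal closure, in the free group on T, of the elements u v^-1 for which
   the relation u = v is in R. *)
Inductive normal_closure (R : word T -> word T -> Prop) : word T -> Prop :=
| nclosure_rel u v : R u v -> normal_closure R (u * v^-1)
| nclosure1 : normal_closure R 1
| nclosureM u v :
    normal_closure R u -> normal_closure R v -> normal_closure R (u * v)
| nclosureV u : normal_closure R u -> normal_closure R u^-1
| nclosureJ u w : normal_closure R u -> normal_closure R (w * u * w^-1)
| nclosure_free u v : free_eq u v -> normal_closure R u -> normal_closure R v.

Variables (G : groupType) (gen : T -> G).

Definition eval_letter (l : T * bool) : G :=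
  if l.2 then (gen l.1)^-1%g else gen l.1.

Definition eval_word (w : word T) : G := (\prod_(l <- w) eval_letter l)%g.

(* G = < T | R >, each x in T corresponding to gen x: evaluation maps the free
   group on T onto G, with kernel the normal closure of the relators. *)
Definition is_presentation (R : word T -> word T -> Prop) : Prop :=
  (forall y : G, exists w, eval_word w = y) /\
  (forall w, eval_word w = 1%g <-> normal_closure R w).

End Presentations.

Section FormAut.
Local Open Scope ring_scope.
Variables (V : vectType 'F_2) (dot : {biscalar V}).

Definition preserves_form (f : 'End(V)) : Prop :=
  forall u v, dot (f u) (f v) = dot u v.

Definition is_form_aut (f : 'End(V)) : bool :=
  `[< bijective f /\ preserves_form f >].

Record form_aut := FormAut {
  form_aut_lfun :> 'End(V);
  _ : is_form_aut form_aut_lfun }.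

HB.instance Definition _ := [isSub for form_aut_lfun].
HB.instance Definition _ := [Choice of form_aut by <:].

Lemma bij_lker0 (f : 'End(V)) : bijective f -> lker f == 0%VS.
Proof. by move=> /bij_inj/lker0P. Qed.

Lemma form_aut_lker0 (f : form_aut) : lker f == 0%VS.
Proof. by case: f => f /= /asboolP[/bij_lker0]. Qed.

Lemma is_form_aut1 : is_form_aut \1%VF.
Proof.
apply/asboolP; split; first by exists id => u; rewrite lfunE.
by move=> u v; rewrite !lfunE.
Qed.

Lemma is_form_autM (f h : form_aut) : is_form_aut (f \o h)%VF.
Proof.
case: f h => [f /asboolP[fb fd]] [h /asboolP[hb hd]] /=.
apply/asboolP; split; last by move=> u v; rewrite !lfunE /= fd hd.
by apply: (eq_bij (bij_comp fb hb)) => u; rewrite lfunE.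
Qed.

Lemma is_form_autV (f : form_aut) : is_form_aut (f^-1)%VF.
Proof.
have kf := form_aut_lker0 f; case: f kf => [f /asboolP[fb fd]] /= kf.
apply/asboolP; split; first by exists f; [apply: lker0_lfunVK|apply: lker0_lfunK].
by move=> u v; rewrite -fd !lker0_lfunVK.
Qed.

Definition form_aut_one := FormAut is_form_aut1.
Definition form_aut_mul f h := FormAut (is_form_autM f h).
Definition form_aut_inv f := FormAut (is_form_autV f).

Lemma form_aut_mulA : associative form_aut_mul.
Proof. by move=> f h k; apply/val_inj; rewrite /= comp_lfunA. Qed.
Lemma form_aut_mul1 : left_id form_aut_one form_aut_mul.
Proof. by move=> f; apply/val_inj; rewrite /= comp_lfun1l. Qed.
Lemma form_aut_mulr1 : right_id form_aut_one form_aut_mul.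
Proof. by move=> f; apply/val_inj; rewrite /= comp_lfun1r. Qed.
Lemma form_aut_mulV : left_inverse form_aut_one form_aut_inv form_aut_mul.
Proof.
by move=> f; apply/val_inj; rewrite /= lker0_compVf ?form_aut_lker0.
Qed.
Lemma form_aut_mulrV : right_inverse form_aut_one form_aut_inv form_aut_mul.
Proof.
by move=> f; apply/val_inj; rewrite /= lker0_compfV ?form_aut_lker0.
Qed.

(* The product f * h is f \o h: words are read from right to left. *)
HB.instance Definition _ := isGroup.Build form_aut
  form_aut_mulA form_aut_mul1 form_aut_mulr1 form_aut_mulV form_aut_mulrV.

(* x 1, ..., x g are the classes of the cores of the crosscaps of N_g. The triple
   (V, dot, x) is (H_1(N_g; Z_2), intersection form, crosscap classes), and is
   determined up to isomorphism by this condition. *)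
Definition is_crosscap_basis (g : nat) (x : nat -> V) : Prop :=
  basis_of fullv [seq x i | i <- iota 1 g] /\
  (forall i j, (1 <= i <= g)%N -> (1 <= j <= g)%N ->
     dot (x i) (x j) = (i == j)%:R).

Definition is_a (g : nat) (x : nat -> V) (i : nat) (f : form_aut) : Prop :=
  [/\ f (x i) = x i.+1, f (x i.+1) = x i &
      forall k, (1 <= k <= g)%N -> k != i -> k != i.+1 -> f (x k) = x k].

Definition is_b (g : nat) (x : nat -> V) (f : form_aut) : Prop :=
  [/\ f (x 1%N) = x 2%N + x 3%N + x 4%N,
      f (x 2%N) = x 1%N + x 3%N + x 4%N,
      f (x 3%N) = x 1%N + x 2%N + x 4%N,
      f (x 4%N) = x 1%N + x 2%N + x 3%N &
      forall k, (5 <= k <= g)%N -> f (x k) = x k].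

End FormAut.

(* Names of generators: a_i, b and b_i. The relations below are between words
   in all names; [present] restricts them to the names of actual generators. *)
Inductive name := Na of nat | Nb | Nbi of nat.

Definition a_ (i : nat) : word name := letter (Na i).
Definition b_ : word name := letter Nb.
Definition bi_ (i : nat) : word name := letter (Nbi i).

Definition gens_a (g : nat) (s : name) : bool :=
  if s is Na i then 1 <= i <= g.-1 else false.

Definition gens_ab (g : nat) (s : name) : bool :=
  match s with Na i => 1 <= i <= g.-1 | Nb => true | Nbi _ => false end.

Definition gens_even (g : nat) (s : name) : bool :=
  match s with
  | Na i => 1 <= i <= g.-1
  | Nb => true
  | Nbi i => i <= (g - 2) %/ 2
  end.

Section Relations.
Local Open Scope word_scope.
Implicit Types g i j : nat.

Inductive rel_N2 : word name -> word name -> Prop :=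
| rel_N2_1 : rel_N2 (a_ 1 ^+ 2) 1.

Inductive rel_N3 : word name -> word name -> Prop :=
| rel_N3_1 : rel_N3 (a_ 1 ^+ 2) 1
| rel_N3_2 : rel_N3 (a_ 2 ^+ 2) 1
| rel_N3_3 : rel_N3 ((a_ 1 * a_ 2) ^+ 3) 1.

Inductive rel_ab g : word name -> word name -> Prop :=
| rel_aa i : (1 <= i <= g - 1)%N -> rel_ab g (a_ i ^+ 2) 1
| rel_bb : rel_ab g (b_ ^+ 2) 1
| rel_aa_comm i j : (4 <= g)%N -> (1 <= i <= g - 1)%N -> (1 <= j <= g - 1)%N ->
    (i + 1 < j)%N || (j + 1 < i)%N ->
    rel_ab g ((a_ i * a_ j) ^+ 2) 1
| rel_aa_braid i : (3 <= g)%N -> (1 <= i <= g - 2)%N ->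
    rel_ab g ((a_ i * a_ i.+1) ^+ 3) 1
| rel_ab_comm i : (4 <= g)%N -> (1 <= i <= g - 1)%N -> i != 4 ->
    rel_ab g ((a_ i * b_) ^+ 2) 1
| rel_ab_braid : (5 <= g)%N -> rel_ab g ((a_ 4 * b_) ^+ 3) 1
| rel_E6_E7 : (7 <= g)%N ->
    rel_ab g ((a_ 2 * a_ 3 * a_ 4 * a_ 5 * a_ 6 * b_) ^+ 12)
             ((a_ 1 * a_ 2 * a_ 3 * a_ 4 * a_ 5 * a_ 6 * b_) ^+ 9).

Inductive rel_even g : word name -> word name -> Prop :=
| rel_even_ab u v : rel_ab g u v -> rel_even g u v
| rel_b0 : rel_even g (bi_ 0) (a_ 1)
| rel_b1 : rel_even g (bi_ 1) b_
| rel_b2 : rel_even g (bi_ 2) ((a_ 1 * a_ 2 * a_ 3 * a_ 4 * a_ 5 * b_) ^+ 5)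
| rel_bS i : (2 <= i <= (g - 4) %/ 2)%N ->
    let w := bi_ i.-1 * a_ (2 * i) * a_ (2 * i + 1) * a_ (2 * i + 2)
               * a_ (2 * i + 3) in
    rel_even g (bi_ i.+1) ((w * bi_ i) ^+ 5 * w ^- 6)
| rel_ab_last :
    let x := a_ (g - 5) in
    let y := bi_ ((g - 2) %/ 2) in
    rel_even g (x * y * x^-1 * y^-1) 1.

End Relations.

Definition forget_word (P : pred name) (w : word {s | P s}) : word name :=
  [seq (sval l.1, l.2) | l <- w].

Definition gen_of (G : Type) (a : nat -> G) (b : G) (bi : nat -> G) (s : name) :=
  match s with Na i => a i | Nb => b | Nbi i => bi i end.

(* The names satisfying P, interpreted by a, b and bi, subject to the relations
   R, present G. *)
Definition present (G : groupType) (P : pred name)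
    (R : word name -> word name -> Prop) (a : nat -> G) (b : G) (bi : nat -> G)
    : Prop :=
  is_presentation (fun s : {s | P s} => gen_of a b bi (sval s))
    (fun u v => R (forget_word u) (forget_word v)).

(* Main.v *)
From HB Require Import structures.
Require Import Defs.
From mathcomp Require Import all_boot all_order all_algebra.
From mathcomp Require Import boolp generic_quotient.
From mathcomp Require Import zify.

Set Implicit Arguments.
Unset Strict Implicit.
Unset Printing Implicit Defensive.

Import GRing.Theory.

(** Let G be the presented group. It acts on the homology by evaluation, a_i
    acting as the transvection along x_i + x_(i+1) and b as the transvection
    along x_1 + x_2 + x_3 + x_4, and the theorem says that G acts faithfully and
    that the image contains every isometry.

    The second point is classical. The transvections along all nonzero even
    vectors v (those with v.v = 0) are products of the generators ([realize]): if
    v misses a crosscap, a permutation makes this crosscap the last one and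
    induction applies; the sum w of all crosscaps is left, and its transvection is
    the product of the transvections along the six other nonzero vectors of a
    totally isotropic three-dimensional space. At most two transvections send the
    last crosscap to its image under a given isometry ([transport]), and one
    descends.

    Faithfulness is proved by induction for the subgroup on the first n crosscaps
    ([faithful]), which is generated by a_1, ..., a_(n-1) and b. Suppose that the
    subgroup on m = n - 1 crosscaps acts faithfully. If an even vector v misses
    the crosscap i, then the conjugate of the smaller subgroup that leaves out i
    has exactly one element acting as the transvection along v. This element does
    not depend on i ([loc_uniq]); it is called the lift of v. Suppose further that
    the group permutes the lifts by conjugation as it permutes the vectors. Then
    an element fixing x_n lies in the smaller subgroup ([stabilizer]), because
    the elements of the form h, t_v h and t_u t_v h, with h in the smaller subgroup
    and t_u, t_v lifts, are stable under left multiplication. This needs the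
    products of lifts over totally isotropic three-dimensional spaces. Such a
    product is central, since -1 belongs to the Weyl group of type D_4
    ([t_frame]); hence it does not change when the space is moved, and it is
    trivial when the space misses a crosscap.

    The symmetric group permutes the lifts correctly by construction, and so does
    b as long as the vector misses a crosscap after the fourth. The other vectors
    are treated with the braid relation for even n, with (a_4 b)^3 = 1 for n = 5,
    and with an isotropic space for odd n >= 9. For n = 7 the statement is false
    without the long relation: the Coxeter relations present the Weyl group of
    type E_7, whose central element -1 acts trivially modulo 2. It is still true
    up to a central element Z, so that the kernel is contained in {1, Z}
    ([kernel7]). In the relation between (a_2 a_3 a_4 a_5 a_6 b)^12 and
    (a_1 a_2 a_3 a_4 a_5 a_6 b)^9, both sides act trivially, the left-hand word is
    even and the right-hand word is odd: they are 1 and -1 in the Weyl group, and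
    the relation kills the kernel ([trivker7]).

    For even g >= 8 the additional generators are redundant. The element b_i is
    the transvection along x_1 + ... + x_(2i+2), and the relations defining it
    take place in an orthonormal frame of six vectors ([tv_frame]). *)

(** * Transvections of a vector space over the field with two elements *)

(** A vector space over the field with two elements with an orthonormal basis
    x_1, ..., x_(rank). The pairing takes boolean values, so that identities
    between its values are settled by case analysis. *)
Structure cspace := CSpace {
  cvec :> zmodType;
  B : cvec -> cvec -> bool;
  rank : nat;
  core : nat -> cvec;
  BC : forall u v, B u v = B v u;
  BDl : forall u v z, B (u + v)%R z = B u z (+) B v z;
  Bx : forall i j, 1 <= i <= rank -> 1 <= j <= rank -> B (core i) (core j) = (i == j);
  B_ext : forall u v,
    (forall i, 1 <= i <= rank -> B u (core i) = B v (core i)) -> u = v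
}.
Arguments B {c}.
Arguments core {c}.

Ltac bcase :=
  repeat match goal with |- context [@B ?C ?u ?v] => case: (@B C u v) end.

(* Arithmetic on indices, kept apart from the values of the pairing. *)
Ltac blia :=
  repeat match goal with H : context [@B _ _ _] |- _ => clear H end; lia.

Section CrosscapSpace.
Local Open Scope ring_scope.
Variable C : cspace.
Local Notation g := (rank C).
Local Notation x := (@core C).
Implicit Types (u v z p q r : C) (i j n : nat).

Lemma BDr u v z : B z (u + v) = B z u (+) B z v.
Proof. by rewrite BC BDl !(BC z). Qed.

Lemma B0l z : B 0 z = false.
Proof. by have := BDl 0 0 z; rewrite addr0; bcase. Qed.

Lemma B0r z : B z 0 = false.
Proof. by rewrite BC B0l. Qed.

Lemma vec_ext u v : (forall z, B u z = B v z) -> u = v.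
Proof. by move=> uv; apply: B_ext. Qed.

Lemma addvv u : u + u = 0.
Proof. by apply: vec_ext => z; rewrite BDl B0l; bcase. Qed.

Lemma addvK u v : u + v + v = u.
Proof. by rewrite -addrA addvv addr0. Qed.

Lemma addKv u v : u + (u + v) = v.
Proof. by rewrite addrA addvv add0r. Qed.

Lemma addv_eq0 u v : (u + v == 0) = (u == v).
Proof.
apply/eqP/eqP => [uv|->]; last exact: addvv.
by rewrite -[u]addr0 -uv addKv.
Qed.

Definition tau v u : C := if B u v then u + v else u.

Lemma B_taul v u z : B (tau v u) z = B u z (+) (B u v && B v z).
Proof. by rewrite /tau; case: (B u v); rewrite ?BDl ?addbF. Qed.

Lemma B_taur v u z : B z (tau v u) = B z u (+) (B u v && B z v).
Proof. by rewrite BC B_taul !(BC z). Qed.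

Lemma tauD v u u' : tau v (u + u') = tau v u + tau v u'.
Proof.
apply: vec_ext => z; rewrite !(BDl, B_taul).
by bcase.
Qed.

Lemma tau_iso v : B v v = false ->
  forall u u', B (tau v u) (tau v u') = B u u'.
Proof.
move=> vv u u'; rewrite !(B_taul, B_taur) vv (BC v u').
by bcase.
Qed.

Lemma tauK v : B v v = false -> involutive (tau v).
Proof.
move=> vv u; apply: vec_ext => z; rewrite !B_taul vv.
by bcase.
Qed.

Lemma tau_fix v u : B u v = false -> tau v u = u.
Proof. by rewrite /tau => ->. Qed.

Lemma tau_move v u : B u v -> tau v u = u + v.
Proof. by rewrite /tau => ->. Qed.

Lemma tau_conj v u z : B v v = false ->
  tau v (tau u (tau v z)) = tau (tau v u) z.
Proof.
move=> vv; apply: vec_ext => y; rewrite !(B_taul, B_taur) vv !(BC z) !(BC v u).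
by bcase.
Qed.

(** [inV n] is the span of x_1, ..., x_n, cut out by orthogonality to the other
    basis vectors. *)
Definition inV n v := forall i, (n < i <= g)%N -> B v (x i) = false.

(** The vectors along which the group on n crosscaps contains a transvection. *)
Definition isE n v := [/\ inV n v, B v v = false & v != 0].

Definition w n : C := \sum_(1 <= i < n.+1) x i.
Definition quad : C := x 1%N + x 2%N + x 3%N + x 4%N.

Lemma w_def n : w n = \sum_(1 <= i < n.+1) x i.
Proof. by []. Qed.

Lemma quad_def : quad = x 1%N + x 2%N + x 3%N + x 4%N.
Proof. by []. Qed.

Lemma inVD n u v : inV n u -> inV n v -> inV n (u + v).
Proof. by move=> Vu Vv i ni; rewrite BDl Vu ?Vv. Qed.

Lemma inV0 n : inV n 0.
Proof. by move=> i _; rewrite B0l. Qed.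

Lemma inV_tau n u v : inV n u -> inV n v -> inV n (tau v u).
Proof. by rewrite /tau; case: (B u v) => // *; apply: inVD. Qed.

Lemma inVW m n u : (m <= n)%N -> inV m u -> inV n u.
Proof. by move=> mn Vu i ni; apply: Vu; lia. Qed.

Lemma inV_pred n v : inV n v -> B v (x n) = false -> inV n.-1 v.
Proof.
by move=> Vv vn i ni; have [->//|?] := eqVneq i n; apply: Vv; lia.
Qed.

Lemma inVx n i : (1 <= i <= n)%N -> (n <= g)%N -> inV n (x i).
Proof. by move=> ni ng j nj; rewrite Bx; lia. Qed.

Lemma inVS n v : (n < g)%N ->
  inV n v <-> inV n.+1 v /\ B v (x n.+1) = false.
Proof.
move=> ng; split=> [Vv|[Vv vn] i ni].
  by split; [apply: inVW Vv|apply: Vv; lia].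
by have [->//|?] := eqVneq i n.+1; apply: Vv; lia.
Qed.

Lemma B_xw n i : (1 <= i <= g)%N -> (n <= g)%N -> B (x i) (w n) = (i <= n)%N.
Proof.
move=> ig; elim: n => [|n IHn] ng.
  by rewrite /w big_geq // B0r; lia.
by rewrite /w big_nat_recr //= -/(w n) BDr IHn ?Bx //; lia.
Qed.

Lemma inVw n : (n <= g)%N -> inV n (w n).
Proof. by move=> ng i ni; rewrite BC B_xw; lia. Qed.

(** w n is the characteristic vector of the form on the first n crosscaps: both
    sides are linear in u and they agree on the basis. *)
Lemma B_w n u : (n <= g)%N -> inV n u -> B u (w n) = B u u.
Proof.
elim: n u => [|n IHn] u ng Vu.
  have -> : u = 0 by apply: B_ext => i ig; rewrite Vu ?B0l; lia.
  by rewrite !B0l.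
have nn : B (x n.+1) (x n.+1) by rewrite Bx; lia.
have ww : B (x n.+1) (w n) = false by rewrite B_xw; lia.
rewrite /w big_nat_recr //= -/(w n) BDr.
case un : (B u (x n.+1)); last first.
  by rewrite IHn ?addbF //; [lia|apply/inVS].
have := IHn (u + x n.+1); rewrite !(BDl, BDr) ww un (BC _ u) un nn addbF => ->.
- by case: (B u u).
- by lia.
apply/inVS => //; split; first by apply: inVD => //; apply: inVx; lia.
by rewrite BDl un nn.
Qed.

Lemma B_ww n : (n <= g)%N -> B (w n) (w n) = odd n.
Proof.
elim: n => [|n IHn] ng; first by rewrite /w big_geq // B0l.
rewrite /w big_nat_recr //= -/(w n) !(BDl, BDr) IHn ?(BC (w n)); last by lia.
by rewrite B_xw ?Bx ?eqxx; [case: (odd n); lia|lia..].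
Qed.

Lemma ex_zero n v : (n <= g)%N -> inV n v -> v != w n ->
  exists2 i, (1 <= i <= n)%N & B v (x i) = false.
Proof.
move=> ng Vv; apply: contra_neqP => none; apply: B_ext => i ig.
rewrite (BC (w n)) B_xw //; case: leqP => ni; last by apply: Vv; lia.
by apply/negP => /negP/negbTE vi; apply: none; exists i => //; lia.
Qed.

Lemma ex_one n v : inV n v -> v != 0 ->
  exists2 i, (1 <= i <= n)%N & B v (x i).
Proof.
move=> Vv; apply: contra_neqP => none; apply: B_ext => i ig; rewrite B0l.
case: (leqP i n) => ni; last by apply: Vv; lia.
by apply/negP => vi; apply: none; exists i => //; lia.
Qed.

Fixpoint in_span (s : seq C) (v : C) : bool :=
  if s is u :: s' then in_span s' v || in_span s' (v + u) else v == 0.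

(** Duality: outside the span of s there is a linear form that vanishes on s,
    and every linear form on the span of x_1, ..., x_n is a pairing. *)
Lemma separation n (s : seq C) v : (n <= g)%N -> inV n v -> all (fun u => `[< inV n u >]) s ->
  ~~ in_span s v ->
  exists m, [/\ inV n m, B v m & all (fun u => ~~ B u m) s].
Proof.
move=> ng; elim: s v => [|u s IHs] v Vv /=.
  by move=> _ /(ex_one Vv)[i ni vi]; exists (x i); split=> //; apply: inVx.
move=> /andP[/asboolP Vu Vs] /norP[vs vus].
have [m [Vm vm sm]] := IHs _ Vv Vs vs.
case um : (B u m); last by exists m; rewrite um.
have [m' [Vm' vm' sm']] := IHs _ (inVD Vv Vu) Vs vus.
rewrite BDl in vm'.
case um' : (B u m'); last by rewrite um' addbF in vm'; exists m'; rewrite um'.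
exists (m + m'); rewrite !BDr um um' vm; split=> //.
- exact: inVD.
- by move: vm'; rewrite um'; case: (B v m').
apply/allP => y ys; rewrite BDr (negbTE (allP sm y ys)).
exact: (allP sm' y ys).
Qed.

End CrosscapSpace.
Arguments w {C}.
Arguments quad {C}.

(** * Groups generated by involutions a_i and b acting through transvections *)

(** A group with elements a_i, b that satisfy the Coxeter relations, and a linear
    action in which they are the expected transvections. The action is carried
    along so that elements of the abstract group can be compared with isometries
    before the group is known to act faithfully. *)
Structure caction (C : cspace) := CAction {
  cgroup :> groupType;
  act : cgroup -> C -> C;
  al : nat -> cgroup;
  be : cgroup;
  actM : forall k h u, act (k * h)%g u = act k (act h u);
  act1 : forall u, act 1%g u = u;
  act_al : forall i u, 1 <= i < rank C ->
    act (al i) u = tau (core i + core i.+1)%R u;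
  act_be : forall u, 4 <= rank C -> act be u = tau quad u;
  al2 : forall i, 1 <= i < rank C -> (al i * al i)%g = 1%g;
  be2 : 4 <= rank C -> (be * be)%g = 1%g;
  al_comm : forall i j, 1 <= i -> i.+1 < j < rank C ->
    (al i * al j)%g = (al j * al i)%g;
  al_braid : forall i, 1 <= i -> i.+1 < rank C ->
    (al i * al i.+1 * al i)%g = (al i.+1 * al i * al i.+1)%g;
  al_be : forall i, 4 <= rank C -> 1 <= i < rank C -> i != 4 ->
    (al i * be)%g = (be * al i)%g;
  be_braid : 5 <= rank C -> (be * al 4 * be)%g = (al 4 * be * al 4)%g
}.
Arguments act {C c}.
Arguments al {C c}.
Arguments be {C c}.

(** [Gen b n] is the subgroup on the first n crosscaps: it is generated by
    a_1, ..., a_(n-1), together with b when the flag is set and n >= 4. With the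
    flag unset it is a symmetric group. *)
Inductive Gen (C : cspace) (G : caction C) (b : bool) (n : nat) : G -> Prop :=
| Gen1 : Gen b n 1%g
| Gen_alM i k : 1 <= i < n -> Gen b n k -> Gen b n (al i * k)%g
| Gen_beM k : b -> 4 <= n -> Gen b n k -> Gen b n (be * k)%g.
Arguments Gen {C G}.

Section Action.
Local Open Scope group_scope.
Variables (C : cspace) (G : caction C).
Local Notation g := (rank C).
Local Notation x := (@core C).
Local Notation quad := (@quad C).
Local Notation w := (@w C).
Local Notation al := (@al C G).
Local Notation be := (@be C G).
Implicit Types (k h s : G) (u v : C) (b : bool) (i j n : nat).

Lemma GenM b n k h : Gen b n k -> Gen b n h -> Gen b n (k * h).
Proof.
elim=> [|i k' ni _ IH|k' hb n4 _ IH] Hh; rewrite ?mul1g // -mulgA.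
  by apply: Gen_alM => //; apply: IH.
by apply: Gen_beM => //; apply: IH.
Qed.

Lemma GenW b b' n n' k : (b ==> b')%B -> n <= n' -> Gen b n k -> Gen b' n' k.
Proof.
move=> bb' nn'; elim=> [|i k' ni _ IH|k' hb n4 _ IH]; first exact: Gen1.
  by apply: Gen_alM => //; lia.
by apply: Gen_beM => //; [move: bb'; rewrite hb|lia].
Qed.

Lemma Gen_al b n i : 1 <= i < n -> Gen b n (al i).
Proof. by move=> ni; rewrite -[al i]mulg1; apply: Gen_alM => //; apply: Gen1. Qed.

Lemma Gen_be n : 4 <= n -> Gen true n be.
Proof. by move=> ni; rewrite -[be]mulg1; apply: Gen_beM => //; apply: Gen1. Qed.

Lemma al_inv i : 1 <= i < g -> (al i)^-1 = al i.
Proof. by move=> ig; apply: mulg1_eq; apply: al2. Qed.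

Lemma be_inv : 4 <= g -> be^-1 = be.
Proof. by move=> g4; apply: mulg1_eq; apply: be2. Qed.

Lemma al_commP i j : 1 <= i < g -> 1 <= j < g -> i != j.+1 -> j != i.+1 ->
  al i * al j = al j * al i.
Proof.
move=> ig jg ij ji; case: (ltngtP i j) => [lt|lt|-> //].
  by apply: al_comm; lia.
by symmetry; apply: al_comm; lia.
Qed.

Lemma GenV b n k : n <= g -> Gen b n k -> Gen b n k^-1.
Proof.
move=> ng; elim=> [|i k' ni _ IH|k' hb n4 _ IH]; first by rewrite invg1; apply: Gen1.
  by rewrite invgM al_inv; [apply: GenM IH _; apply: Gen_al|lia].
rewrite invgM be_inv; last by lia.
by apply: GenM IH _; apply: GenW (Gen_be n4); rewrite ?hb.
Qed.

Lemma actK k u : act k^-1 (act k u) = u.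
Proof. by rewrite -actM mulVg act1. Qed.

Lemma actKV k u : act k (act k^-1 u) = u.
Proof. by rewrite -actM mulgV act1. Qed.

Lemma quadE i : 4 <= g -> 1 <= i <= g -> B quad (x i) = (i <= 4).
Proof.
move=> g4 ig; rewrite quad_def !BDl !Bx; [|lia..].
by case: i ig => [|[|[|[|[|i]]]]].
Qed.

Lemma quad_even : 4 <= g -> B quad quad = false.
Proof. by move=> g4; rewrite {2}quad_def !BDr !quadE //; lia. Qed.

Lemma quad_neq0 : 4 <= g -> quad != 0%R.
Proof.
move=> g4; apply/eqP => q0; have := @quadE 1 g4; rewrite q0 B0l; lia.
Qed.

Lemma xxE i j l : 1 <= i <= g -> 1 <= j <= g -> 1 <= l <= g ->
  B (x i + x j)%R (x l) = (i == l) (+) (j == l).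
Proof. by move=> *; rewrite BDl !Bx. Qed.

Lemma xx_even i j : 1 <= i <= g -> 1 <= j <= g ->
  B (x i + x j)%R (x i + x j)%R = false.
Proof. by move=> ig jg; rewrite BDr !xxE //; lia. Qed.

Lemma xx_neq0 i j : 1 <= i <= g -> 1 <= j <= g -> i != j ->
  (x i + x j)%R != 0%R.
Proof.
move=> ig jg ij; apply/eqP => q0; have := xxE ig jg ig; rewrite q0 B0l; lia.
Qed.

Lemma isE_xx n i j : n <= g -> 1 <= i <= n -> 1 <= j <= n -> i != j ->
  isE n (x i + x j)%R.
Proof.
move=> ng ni nj ij; split; [|apply: xx_even; lia|apply: xx_neq0; lia].
by apply: inVD; apply: inVx.
Qed.

Lemma isE_quad n : n <= g -> 4 <= n -> isE n quad.
Proof.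
move=> ng n4; split; [|apply: quad_even; lia|apply: quad_neq0; lia].
by move=> i ni; rewrite quadE; lia.
Qed.

Section GenInd.
Variable (b : bool) (n : nat).
Hypothesis ng : n <= g.

(** The generators act as transvections along even vectors, so that invariants need
    only be checked on these. *)
Lemma act_ind (Q : C -> C -> Prop) :
  (forall u, Q u u) ->
  (forall v u u', isE n v -> Q u u' -> Q u (tau v u')) ->
  forall k u, Gen b n k -> Q u (act k u).
Proof.
move=> Q1 Qt k u; elim=> [|i k' ni _ IH|k' hb n4 _ IH]; first by rewrite act1.
  by rewrite actM act_al; [apply: Qt IH; apply: isE_xx; lia|lia].
by rewrite actM act_be; [apply: Qt IH; apply: isE_quad|lia].
Qed.

Lemma actD k u v : Gen b n k -> act k (u + v)%R = (act k u + act k v)%R.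
Proof.
elim=> [|i k' ni _ IH|k' hb n4 _ IH]; first by rewrite !act1.
  by rewrite !actM IH !act_al ?tauD //; lia.
by rewrite !actM IH !act_be ?tauD //; lia.
Qed.

Lemma act_iso k u v : Gen b n k -> B (act k u) (act k v) = B u v.
Proof.
elim=> [|i k' ni _ IH|k' hb n4 _ IH]; first by rewrite !act1.
  by rewrite !actM !act_al ?tau_iso //; [apply: xx_even|..]; lia.
by rewrite !actM !act_be ?tau_iso //; [apply: quad_even|..]; lia.
Qed.

Lemma act_inV k v : Gen b n k -> inV n v -> inV n (act k v).
Proof.
move=> Hk; apply: (@act_ind (fun u u' => inV n u -> inV n u') _ _ k v Hk) => //.
by move=> v' u u' [Vv _ _] IH /IH Vu'; apply: inV_tau.
Qed.

Lemma act_fix k i : Gen b n k -> n < i <= g -> act k (x i) = x i.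
Proof.
move=> Hk ni.
apply: (@act_ind (fun u u' => u = x i -> u' = x i) _ _ k (x i) Hk) => //.
by move=> v u u' [Vv _ _] IH /IH->; apply: tau_fix; rewrite BC Vv.
Qed.

Lemma act_w k : Gen b n k -> act k (w n) = w n.
Proof.
move=> Hk.
apply: (@act_ind (fun u u' => u = w n -> u' = w n) _ _ k (w n) Hk) => //.
by move=> v u u' [Vv ev _] IH /IH->; apply: tau_fix; rewrite BC B_w.
Qed.

Lemma act0 k : Gen b n k -> act k 0%R = 0%R.
Proof.
move=> Hk; apply: vec_ext => z; rewrite -[z](actKV k) (act_iso _ _ Hk).
by rewrite !B0l.
Qed.

Lemma act_isE k v : Gen b n k -> isE n v -> isE n (act k v).
Proof.
move=> Hk [Vv ev v0]; split; first exact: act_inV.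
  by rewrite (act_iso _ _ Hk).
by apply: contra_neq v0 => kv; rewrite -[v](actK k) kv act0 //; apply: GenV.
Qed.

Lemma act_tau k u v : Gen b n k -> act k (tau v u) = tau (act k v) (act k u).
Proof.
by move=> Hk; rewrite /tau (act_iso _ _ Hk) (fun_if (act k)) (actD _ _ Hk).
Qed.

Lemma act_conj k h v : Gen b n k -> (forall u, act h u = tau v u) ->
  forall u, act (k * h * k^-1) u = tau (act k v) u.
Proof. by move=> Hk hv u; rewrite !actM hv (act_tau _ _ Hk) actKV. Qed.

End GenInd.

(** ** The symmetric group *)

Lemma al_Gen_comm b m n k : m < n < g -> Gen b m k -> al n * k = k * al n.
Proof.
move=> mn; elim=> [|i k' ni _ IH|k' hb n4 _ IH]; first by rewrite mulg1 mul1g.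
  by rewrite -mulgA -IH !mulgA (@al_commP n i) //; lia.
by rewrite -mulgA -IH !mulgA al_be //; lia.
Qed.

(** The Coxeter relations alone give this decomposition, so that it is available
    before the symmetric group is known to act faithfully. *)
Lemma sym_double_coset n k : 1 <= n < g -> Gen false n.+1 k ->
  Gen false n k \/ exists s1 s2,
    [/\ Gen false n s1, Gen false n s2 & k = s1 * al n * s2].
Proof.
elim: n k => [//|n IHn] k ng; elim=> [|i k' ni _ IHk|//]; first by left; apply: Gen1.
have [eq_in|ne_in] := eqVneq i n.+1; last first.
  have ai : Gen false n.+1 (al i) by apply: Gen_al; lia.
  case: IHk => [Hk|[s1 [s2 [H1 H2 ->]]]]; first by left; apply: GenM.
  by right; exists (al i * s1), s2; split; rewrite ?mulgA //; apply: GenM.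
have an2 : al n.+1 * al n.+1 = 1 by apply: al2; lia.
subst i; case: IHk => [Hk|[s1 [s2 [H1 H2 ->]]]].
  by right; exists 1, k'; split; rewrite ?mul1g //; apply: Gen1.
have [n0|n_gt0] := posnP n.
  have -> : s1 = 1 by case: H1 => // i ? ?; lia.
  by left; rewrite mul1g mulgA an2 mul1g.
have up s : Gen false n s -> Gen false n.+1 s by apply: GenW.
case: (IHn s1) => [|//|Hs1|[r1 [r2 [Hr1 Hr2 ->]]]]; first by lia.
  have c1 : al n.+1 * s1 = s1 * al n.+1 by apply: (@al_Gen_comm false n) => //; lia.
  left; rewrite !mulgA c1.
  by rewrite -(mulgA s1) an2 mulg1; apply: GenM => //; apply: up.
have c1 : al n.+1 * r1 = r1 * al n.+1 by apply: (@al_Gen_comm false n) => //; lia.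
have c2 : al n.+1 * r2 = r2 * al n.+1 by apply: (@al_Gen_comm false n) => //; lia.
have an : Gen false n.+1 (al n) by apply: Gen_al; lia.
right; exists (r1 * al n), (al n * r2 * s2); split.
- by apply: GenM => //; apply: up.
- by apply: GenM => //; apply: GenM => //; apply: up.
have br : r1 * al n.+1 * al n * al n.+1 = r1 * al n * al n.+1 * al n.
  by rewrite -!(mulgA r1) al_braid //; lia.
by rewrite !mulgA c1 -(mulgA _ r2) -c2 !mulgA br.
Qed.

(** The other double coset moves x_(n+1). *)
Lemma sym_stab n s : 1 <= n < g -> Gen false n.+1 s -> act s (x n.+1) = x n.+1 ->
  Gen false n s.
Proof.
move=> ng /(sym_double_coset ng)[//|[s1 [s2 [H1 H2 ->]]]].
have n1 : n < n.+1 <= g by lia.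
have n_g : n <= g by lia.
rewrite !actM (act_fix n_g H2) // => e.
have := act_iso n_g (act (al n) (x n.+1)) (x n.+1) H1.
rewrite e (act_fix n_g H1) // act_al; last by lia.
suff -> : B (tau (x n + x n.+1)%R (x n.+1)) (x n.+1) = false.
  by rewrite Bx ?eqxx; lia.
by rewrite B_taul BDr BDl !Bx; lia.
Qed.

Lemma sym_perm n s i : n <= g -> Gen false n s -> 1 <= i <= n ->
  exists2 j, 1 <= j <= n & act s (x i) = x j.
Proof.
move=> ng; elim=> [|j k nj _ IH|//] ni; first by exists i; rewrite ?act1.
case: (IH ni) => l nl kl; rewrite actM kl act_al; last by lia.
have [->|lj] := eqVneq l j.
  exists j.+1; first by lia.
  by rewrite tau_move ?BDr ?Bx; [rewrite addrA addvv add0r|lia..].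
have [->|lj1] := eqVneq l j.+1.
  exists j; first by lia.
  by rewrite tau_move ?BDr ?Bx; [rewrite addrCA addvv addr0|lia..].
by exists l => //; apply: tau_fix; rewrite BDr !Bx; lia.
Qed.

Definition trivker n :=
  forall k, Gen true n k -> (forall u, act k u = u) -> k = 1.

Lemma sym_trivker n k : n <= g -> Gen false n k -> (forall u, act k u = u) -> k = 1.
Proof.
elim: n k => [|n IHn] k ng Hk kid; first by case: Hk => // i ? ?; lia.
have [n0|n_gt0] := posnP n; first by case: Hk => // i ? ?; lia.
by apply: IHn; [lia|apply: sym_stab; rewrite ?kid|]; first lia.
Qed.

(** On four crosscaps b commutes with the symmetric group, and unlike a
    permutation it does not send x_1 to a basis vector. *)
Lemma trivker4 n : n <= 4 -> n <= g -> trivker n.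
Proof.
move=> n4 ng k Hk kid; have [n4'|n4'] := ltnP n 4.
  apply: (@sym_trivker n) => //.
  elim: Hk => [|i k' ni _ IH|k' _]; [exact: Gen1| |by lia].
  by apply: Gen_alM => //; apply: IH.
have {n4 n4'} n_4 : n = 4 by lia.
subst n; have g4 := ng.
have: Gen false 4 k \/ Gen false 4 (be * k).
  elim: {kid} Hk => [|i k' ni _ IH|k' _ _ _ IH]; first by left; apply: Gen1.
    case: IH => H; first by left; apply: Gen_alM.
    by right; rewrite mulgA -al_be; [rewrite -mulgA; apply: Gen_alM|lia..].
  by rewrite mulgA (be2 G g4) mul1g; case: IH => H; [right|left].
case=> {}Hk; first exact: (@sym_trivker 4).
have [j j4] := @sym_perm 4 _ 1 g4 Hk isT.
rewrite actM kid act_be // => e.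
have: B (tau quad (x 1)) (x 2) && B (tau quad (x 1)) (x 3).
  by rewrite !B_taul !(BC (x 1)) !quadE ?Bx; lia.
by rewrite e !Bx; lia.
Qed.

Lemma trivker_inj n k h : n <= g -> trivker n -> Gen true n k -> Gen true n h ->
  (forall u, act k u = act h u) -> k = h.
Proof.
move=> ng Pn Hk Hh kh; apply: divg1_eq; apply: Pn.
  by apply: GenM => //; apply: GenV.
by move=> u; rewrite actM kh actKV.
Qed.

(** The cycle that carries the crosscap n + 1 to the position i. *)
Definition rot i n : G := \prod_(i <= j < n.+1) al j.

Lemma Gen_rot b i n : 1 <= i -> Gen b n.+1 (rot i n).
Proof.
move=> i1; rewrite /rot; elim: n => [|n IHn]; first by rewrite big_geq //; apply: Gen1.
have [le_in|lt_ni] := leqP i n.+1; last by rewrite big_geq //; apply: Gen1.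
rewrite big_nat_recr //=; apply: GenM; last by apply: Gen_al; lia.
by apply: GenW IHn; rewrite ?implybb.
Qed.

Lemma act_rot i n : 1 <= i <= n.+1 -> n < g -> act (rot i n) (x n.+1) = x i.
Proof.
rewrite /rot; elim: n => [|n IHn] ni ng.
  by rewrite big_geq ?act1; [congr x; lia|lia].
have [->|lt_in] := eqVneq i n.+2; first by rewrite big_geq // act1.
rewrite big_nat_recr; last by lia.
rewrite /= actM act_al; last by lia.
rewrite tau_move ?BDr ?Bx; [|lia..].
by rewrite addrCA addvv addr0 IHn //; lia.
Qed.

Lemma rot_be i n : 5 <= i -> n < g -> rot i n * be = be * rot i n.
Proof.
move=> i5 ng; rewrite /rot; elim: n ng => [|n IHn] ng.
  by rewrite big_geq ?mul1g ?mulg1 //; lia.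
have [le_in|lt_ni] := leqP i n.+1; last by rewrite big_geq // mul1g mulg1.
rewrite big_nat_recr //= -mulgA al_be; [|lia..].
by rewrite mulgA IHn ?mulgA //; lia.
Qed.

(** ** Transvections are realized *)

(** The seven nonzero vectors of a totally isotropic three-dimensional space
    give commuting transvections whose product is the identity. *)
Lemma tau_fano p r q u :
  B p p = false -> B r r = false -> B q q = false ->
  B p r = false -> B p q = false -> B r q = false ->
  tau p (tau r (tau q (tau (p + r) (tau (p + q) (tau (r + q) u))))) =
  tau (p + r + q)%R u.
Proof.
move=> pp rr qq pr pq rq; apply: vec_ext => z.
rewrite !(B_taul, B_taur, BDl, BDr) !(BC r p) !(BC q p) !(BC q r).
rewrite pp rr qq pr pq rq /=.
by bcase.
Qed.

Lemma isED n u v : isE n u -> isE n v -> u != v -> isE n (u + v)%R.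
Proof.
move=> [Vu uu _] [Vv vv _] uv; split; [exact: inVD| |by rewrite addv_eq0].
by rewrite !BDl !BDr uu vv (BC v u); bcase.
Qed.

Lemma isED_B n u v : isE n u -> isE n v -> B u v -> isE n (u + v)%R.
Proof.
move=> Eu Ev uv; apply: isED => //; apply/eqP => e; move: uv; rewrite e.
by case: Ev => _ ->.
Qed.

Lemma isE_w n : n <= g -> 0 < n -> ~~ odd n -> isE n (w n).
Proof.
move=> ng n0 en; split; [exact: inVw|by rewrite B_ww // (negbTE en)|].
apply/eqP => w0; have: B (x 1%N) (w n) = false by rewrite w0 B0r.
by rewrite B_xw //; lia.
Qed.

(** The vectors x_1 + x_2, x_3 + x_4 and w + x_1 + x_2 + x_3 + x_4 span a totally
    isotropic space that contains w, and every other vector of this space misses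
    a crosscap. *)
Lemma fano_w n p r q :
  p = (x 1 + x 2)%R -> r = (x 3 + x 4)%R -> q = (w n + quad)%R ->
  6 <= n <= g -> ~~ odd n ->
  [/\ B p r = false, B p q = false, B r q = false & (p + r + q)%R = w n] /\
  (forall v, v \in [:: p; r; q; (p + r)%R; (p + q)%R; (r + q)%R] ->
     isE n v /\ v != w n).
Proof.
move=> pE rE qE ng en; have n_g : n <= g by lia.
have g4 : 4 <= g by lia.
have E12 : isE n p by rewrite pE; apply: isE_xx; lia.
have E34 : isE n r by rewrite rE; apply: isE_xx; lia.
have EQ : isE n quad by apply: isE_quad; lia.
have pr : (p + r)%R = quad by rewrite pE rE quad_def !addrA.
have coord v i : 1 <= i <= n -> B v (x i) = false -> v != w n.
  move=> ni; apply: contraFN => /eqP->; rewrite BC B_xw; lia.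
have wQ : w n != quad by rewrite eq_sym; apply: (@coord _ 5); rewrite ?quadE; lia.
have Eq : isE n q by rewrite qE; apply: isED => //; apply: isE_w => //; lia.
have Bq i : 1 <= i <= n -> B q (x i) = (4 < i).
  move=> ni; rewrite qE BDl quadE ?(BC (w n)) ?B_xw; [|lia..].
  by case: (ltnP 4 i); lia.
have Bp i : 1 <= i <= n -> B p (x i) = (i <= 2).
  by move=> ni; rewrite pE xxE; [case: i ni => [|[|[]]]|lia..].
have Br i : 1 <= i <= n -> B r (x i) = (2 < i <= 4).
  by move=> ni; rewrite rE xxE; [case: i ni => [|[|[|[|[]]]]]|lia..].
have pq : B p q = false by rewrite BC pE BDr !Bq //; lia.
have rq : B r q = false by rewrite BC rE BDr !Bq //; lia.
split.
  split=> //; last by rewrite pr qE addrC addvK.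
  by rewrite rE BDr !Bp //; lia.
have neq u v i : B u (x i) -> B v (x i) = false -> u != v.
  by move=> ui; apply: contraFN => /eqP<-.
move=> v; rewrite !inE => /or4P[| | |/or3P[]] /eqP->; split=> //.
- by apply: (@coord _ 5); rewrite ?Bp //; lia.
- by apply: (@coord _ 5); rewrite ?Br //; lia.
- by apply: (@coord _ 1%N); rewrite ?Bq //; lia.
- by rewrite pr.
- by rewrite pr eq_sym.
- by apply: isED => //; apply: (@neq _ _ 1%N); rewrite ?Bp ?Bq //; lia.
- by apply: (@coord _ 3); rewrite ?BDl ?Bp ?Bq //; lia.
- by apply: isED => //; apply: (@neq _ _ 3); rewrite ?Br ?Bq //; lia.
- by apply: (@coord _ 1%N); rewrite ?BDl ?Br ?Bq //; lia.
Qed.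

Definition acts_as (k : G) (v : C) := forall u, act k u = tau v u.

(** By induction on n after a permutation if v misses a crosscap. The vector w n is
    handled by [tau_fano] when n >= 6, and it is realized by a_1 when n = 2 and by b
    when n = 4. *)
Lemma realize n v : n <= g -> isE n v -> exists2 k, Gen true n k & acts_as k v.
Proof.
elim: n v => [|n IHn] v ng Ev.
  case: Ev => Vv _ /eqP[]; apply: B_ext => i ig; rewrite B0l Vv //; lia.
have small v' : isE n.+1 v' -> v' != w n.+1 ->
    exists2 k, Gen true n.+1 k & acts_as k v'.
  move=> Ev' v'w; have [i ni vi] := ex_zero ng (let: And3 H _ _ := Ev' in H) v'w.
  have Hs : Gen true n.+1 (rot i n) by apply: Gen_rot; lia.
  have Hs' := GenV ng Hs.
  have [V0 ev nz] : isE n.+1 (act (rot i n)^-1 v') by apply: act_isE Hs' Ev'.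
  have E0 : isE n (act (rot i n)^-1 v').
    split=> //; apply/inVS; [by lia|split=> //].
    by rewrite -(act_iso ng _ _ Hs) actKV act_rot //; lia.
  have [|k Hk kv] := IHn _ _ E0; first by lia.
  exists (rot i n * k * (rot i n)^-1).
    by apply: GenM => //; apply: GenM => //; apply: GenW Hk.
  by move=> u; rewrite (act_conj ng Hs kv) actKV.
have [vw|] := eqVneq v (w n.+1); last exact: small.
have en : ~~ odd n.+1.
  by case: Ev => _; rewrite vw B_ww // => ->.
have [n6|n6] := ltnP n.+1 6; last first.
  have [|[pr pq rq sumw] small_fano] := @fano_w n.+1 _ _ _ erefl erefl erefl _ en.
    by lia.
  move: pr pq rq sumw small_fano.
  set p := (x 1 + x 2)%R; set r := (x 3 + x 4)%R; set q := (w n.+1 + quad)%R.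
  move=> pr pq rq sumw sf.
  have [Ep pw] := sf p (mem_head _ _).
  have [Er rw] : isE n.+1 r /\ r != w n.+1 by apply: sf; rewrite !inE eqxx ?orbT.
  have [Eq qw] : isE n.+1 q /\ q != w n.+1 by apply: sf; rewrite !inE eqxx ?orbT.
  have [Epr prw] : isE n.+1 (p + r)%R /\ (p + r)%R != w n.+1.
    by apply: sf; rewrite !inE eqxx ?orbT.
  have [Epq pqw] : isE n.+1 (p + q)%R /\ (p + q)%R != w n.+1.
    by apply: sf; rewrite !inE eqxx ?orbT.
  have [Erq rqw] : isE n.+1 (r + q)%R /\ (r + q)%R != w n.+1.
    by apply: sf; rewrite !inE eqxx ?orbT.
  have [k1 H1 a1] := small _ Ep pw; have [k2 H2 a2] := small _ Er rw.
  have [k3 H3 a3] := small _ Eq qw; have [k4 H4 a4] := small _ Epr prw.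
  have [k5 H5 a5] := small _ Epq pqw; have [k6 H6 a6] := small _ Erq rqw.
  exists (k1 * (k2 * (k3 * (k4 * (k5 * k6))))); first by do 5![apply: GenM => //].
  move=> u; rewrite !actM a1 a2 a3 a4 a5 a6 vw -sumw.
  by case: Ep Er Eq => [_ ? _] [_ ? _] [_ ? _]; apply: tau_fano.
have [n2|n4] : n = 1%N \/ n = 3%N by lia.
  exists (al 1); first by apply: Gen_al; lia.
  by move=> u; rewrite act_al ?vw ?w_def ?n2; [do 2![rewrite big_ltn //]; rewrite big_geq // addr0|lia].
exists be; first by apply: Gen_be; lia.
by move=> u; rewrite act_be ?vw ?w_def ?n4; [do 4![rewrite big_ltn //]; rewrite big_geq // addr0 !addrA|lia].
Qed.

End Action.

(** * Families of involutions conjugated like transvections *)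

(** The order does not matter in a product of commuting factors, although the group
    is not commutative. *)
Lemma prod_perm (G : groupType) (s s' : seq G) :
  (forall a b, a \in s -> b \in s -> a * b = b * a)%g -> perm_eq s s' ->
  (\prod_(a <- s) a = \prod_(a <- s') a)%g.
Proof.
elim: s s' => [|a s IHs] s' comm ss'.
  by rewrite perm_sym in ss'; rewrite (perm_nilP ss').
have as' : a \in s' by rewrite -(perm_mem ss') mem_head.
case/splitPr: as' ss' => s1 s2 ss'.
have {}ss' : perm_eq s (s1 ++ s2).
  by move: ss'; rewrite perm_sym -[a :: s2]cat1s perm_catCA /= perm_cons perm_sym.
rewrite big_cons (IHs _ _ ss'); last first.
  by move=> b c bs cs; apply: comm; rewrite inE ?bs ?cs orbT.
rewrite !big_cat big_cons /= !mulgA; congr (_ * _)%g.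
have {ss'} : {subset s1 <= s} by move=> b bs; rewrite (perm_mem ss') mem_cat bs.
elim: s1 => [|b s1 IH] sub; first by rewrite !big_nil mulg1 mul1g.
have bs : b \in a :: s by rewrite inE (sub b (mem_head _ _)) orbT.
rewrite !big_cons mulgA (comm a b (mem_head _ _) bs).
rewrite -!mulgA; congr (_ * _)%g; apply: IH => c cs; apply: sub.
by rewrite inE cs orbT.
Qed.

Lemma in_spanP (C : cspace) (s : seq C) (v : C) : in_span s v ->
  exists2 m : bitseq, size m = size s & v = (\sum_(u <- mask m s) u)%R.
Proof.
elim: s v => [|u s IHs] v /=; first by move/eqP->; exists [::]; rewrite ?big_nil.
case/orP => /IHs[m ms e]; first by exists (false :: m); rewrite /= ?ms.
exists (true :: m); rewrite /= ?ms // big_cons -e.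
by rewrite addrC addvK.
Qed.

(** The nonzero vectors of the span of p, r and q: the points of a Fano plane. *)
Definition fano (C : cspace) (p r q : C) : seq C :=
  [:: p; r; q; p + r; p + q; r + q; p + r + q]%R.

Definition isotropic3 (C : cspace) n (p r q : C) : Prop :=
  [/\ B p r = false, B p q = false, B r q = false &
      forall v, v \in fano p r q -> isE n v].

(* Rearranges an explicit list by comparing the counts of its entries. *)
Ltac perm_list :=
  let a := fresh "a" in apply/permP => a /=;
  repeat match goal with
    |- context [nat_of_bool (a ?z)] => move: (nat_of_bool (a z)) => ?
  end; repeat match goal with H : _ |- _ => clear H end; lia.

Section Isotropic.
Variables (C : cspace) (n : nat).
Implicit Types (p r q u v y : C).
Lemma fano_swap12 p r q : perm_eq (fano p r q) (fano r p q).
Proof.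
rewrite /fano (addrC r p); perm_list.
Qed.

Lemma fano_swap23 p r q : perm_eq (fano p r q) (fano p q r).
Proof.
by rewrite /fano (addrC q r) (addrAC p q r); perm_list.
Qed.

Lemma fano_add p r q : perm_eq (fano p r q) (fano p (r + p)%R q).
Proof.
by rewrite /fano (addrC r p) addKv; perm_list.
Qed.

Lemma fano_add_last p r q : perm_eq (fano p r q) (fano p (r + q)%R q).
Proof. by rewrite /fano addvK addrA addvK; perm_list. Qed.

Lemma fano_basis p r q v : v \in fano p r q ->
  exists p' r', perm_eq (fano p r q) (fano p' r' v).
Proof.
have rot3 (a b c : C) : perm_eq (fano a b c) (fano b c a).
  exact: (perm_trans (fano_swap12 a b c) (fano_swap23 b a c)).
have add3 (a b c : C) : perm_eq (fano a b c) (fano a b (c + a)%R).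
  apply: (perm_trans (fano_swap23 a b c)).
  by apply: (perm_trans (fano_add a c b)); apply: fano_swap23.
have add3' (a b c : C) : perm_eq (fano a b c) (fano a b (c + b)%R).
  apply: (perm_trans (fano_swap12 a b c)).
  by apply: (perm_trans (add3 b a c)); apply: fano_swap12.
rewrite !inE => /or4P[| | |/or4P[]] /eqP->.
- by exists r, q; apply: rot3.
- by exists p, q; apply: fano_swap23.
- by exists p, r.
- exists p, q; rewrite addrC; apply: (perm_trans (fano_swap23 p r q)).
  exact: add3.
- by exists p, r; rewrite addrC; apply: add3.
- by exists p, r; rewrite addrC; apply: add3'.
exists p, r; rewrite addrAC addrC -(addrC q) (addrC r); apply: (perm_trans (add3 p r q)).
exact: add3'.
Qed.

Hypothesis ng : n <= rank C.

Lemma fano_orth p r q u v : isotropic3 n p r q ->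
  u \in fano p r q -> v \in fano p r q -> B u v = false.
Proof.
case=> pr pq rq E.
have pp : B p p = false by case: (E p) => //; rewrite !inE eqxx ?orbT.
have rr : B r r = false by case: (E r) => //; rewrite !inE eqxx ?orbT.
have qq : B q q = false by case: (E q) => //; rewrite !inE eqxx ?orbT.
have vanish z : B p z = false -> B r z = false -> B q z = false ->
    forall s, s \in fano p r q -> B s z = false.
  move=> pz rz qz s; rewrite !inE.
  by case/or4P=> [| | |/or4P[]] /eqP->; rewrite ?BDl ?pz ?rz ?qz.
move=> uL vL; apply: (vanish _ _ _ _ _ uL); rewrite BC;
  by apply: (vanish _ _ _ _ _ vL); rewrite ?(BC r p) ?(BC q p) ?(BC q r).
Qed.

Lemma isotropic3_perm p r q p' r' q' : isotropic3 n p r q ->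
  perm_eq (fano p r q) (fano p' r' q') -> isotropic3 n p' r' q'.
Proof.
move=> I /perm_mem LL'; have [_ _ _ E] := I.
have mem v : v \in fano p' r' q' -> v \in fano p r q by rewrite LL'.
have orth u v : u \in fano p' r' q' -> v \in fano p' r' q' -> B u v = false.
  by move=> /mem uL /mem vL; apply: fano_orth uL vL.
by split=> [||| v /mem/E//]; apply: orth; rewrite !inE eqxx ?orbT.
Qed.

Lemma fano_tau y p r q : map (tau y) (fano p r q) = fano (tau y p) (tau y r) (tau y q).
Proof. by rewrite /fano /= !tauD. Qed.

Lemma isE_tau y v : isE n y -> isE n v -> isE n (tau y v).
Proof.
move=> [Vy yy _] [Vv vv v0]; split; [exact: inV_tau|by rewrite tau_iso|].
apply: contra_neq v0 => /(congr1 (tau y)); rewrite tauK // => ->.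
by apply: tau_fix; rewrite B0l.
Qed.

Lemma isotropic3_tau y p r q : isE n y -> isotropic3 n p r q ->
  isotropic3 n (tau y p) (tau y r) (tau y q).
Proof.
move=> Ey [pr pq rq E]; have [_ yy _] := Ey.
split; rewrite ?tau_iso // => v; rewrite -fano_tau => /mapP[u uL ->].
by apply: isE_tau; last apply: E.
Qed.

(** A totally isotropic space can be moved off the crosscap i by a single
    transvection, unless the sum of all crosscaps stands in the way. *)
Lemma move_off i p r q : 1 <= i <= n -> isotropic3 n p r q ->
  ~~ in_span [:: p; r; q; core i] (w n) ->
  exists2 y, isE n y & forall v, v \in fano p r q -> B (tau y v) (core i) = false.
Proof.
move=> ni [_ _ _ E] wL.
have Vi : inV n (@core C i) by apply: inVx.
have V_L v : v \in fano p r q -> inV n v by move=> /E[].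
case: (separation ng (inVw ng) _ wL).
  by rewrite /= !andbT; apply/and4P; split; apply/asboolP => //; apply: V_L;
     rewrite !inE eqxx ?orbT.
move=> m [Vm wm /=]; rewrite !andbT => /and4P[/negbTE pm /negbTE rm /negbTE qm /negbTE im].
have mm : B m m by rewrite -(B_w ng Vm) BC.
have ii : B (@core C i) (core i) by rewrite Bx ?eqxx //; lia.
pose y := (core i + m)%R.
have yi : B y (core i) by rewrite BDl ii BC im.
exists y.
  split; [exact: inVD| |].
    by rewrite BDr yi BDl im mm.
  by apply/eqP => y0; rewrite y0 B0l in yi.
move=> u uL; rewrite B_taul yi andbT BDr.
suff -> : B u m = false by rewrite addbF addbb.
by move: uL; rewrite !inE => /or4P[| | |/or4P[]] /eqP->; rewrite ?BDl ?pm ?rm ?qm.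
Qed.

Lemma span4 p r q a v : in_span [:: p; r; q; a] v ->
  exists2 l, l \in 0%R :: fano p r q & v = l \/ v = (l + a)%R.
Proof.
case/in_spanP => [[|b1 [|b2 [|b3 [|b4 []]]]]] //= _ ->.
exists (\sum_(u <- mask [:: b1; b2; b3] [:: p; r; q]) u)%R; last first.
  case: b4; [right|left]; case: b1; case: b2; case: b3;
  by rewrite /= ?big_cons ?big_nil ?addr0 ?add0r ?addrA.
case: b1; case: b2; case: b3;
by rewrite /= ?big_cons ?big_nil ?addr0 ?addrA !inE eqxx ?orbT.
Qed.

(** For odd n the obstructions w + x_1 and w + x_2 are not orthogonal, so that
    they cannot both lie in an isotropic space. *)
Lemma move_off_odd p r q : 2 <= n -> odd n -> isotropic3 n p r q ->
  exists2 i, 1 <= i <= n & ~~ in_span [:: p; r; q; core i] (w n).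
Proof.
move=> n2 on I; have [_ _ _ E] := I.
have ww : B (w n : C) (w n) by rewrite B_ww.
have key i : 1 <= i <= n -> in_span [:: p; r; q; core i] (w n) ->
    (w n + core i)%R \in fano p r q.
  move=> ni /span4[l lL [wl|wl]].
    have: B l l = false.
      by move: lL; rewrite inE => /orP[/eqP->|/E[]//]; rewrite B0l.
    by rewrite -wl ww.
  move: lL; rewrite wl addvK inE => /orP[/eqP l0|//].
  have [j nj ji] : exists2 j, 1 <= j <= n & j != i.
    by case: (eqVneq i 1) => [->|i1]; [exists 2|exists 1]; lia.
  have: B (w n : C) (core j) by rewrite BC B_xw; lia.
  by rewrite wl l0 add0r Bx; lia.
case s1: (in_span [:: p; r; q; core 1] (w n)); last by exists 1; rewrite ?s1; lia.
exists 2; first by lia.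
apply/negP => s2; have := fano_orth I (key 1 _ s1) (key 2 _ s2).
rewrite !BDl !BDr ww (BC (w n)) !B_xw ?Bx //; lia.
Qed.

(** For even n the vector w + x_i is odd, so that it does not lie in a totally
    isotropic space. *)
Lemma move_off_even i p r q : 1 <= i <= n -> ~~ odd n -> isotropic3 n p r q ->
  w n \notin fano p r q -> ~~ in_span [:: p; r; q; core i] (w n).
Proof.
move=> ni en [_ _ _ E] wL; apply/negP => /span4[l lL wl].
have ll : B l l = false.
  by move: lL; rewrite inE => /orP[/eqP->|/E[]//]; rewrite B0l.
have Vl : inV n l.
  by move: lL; rewrite inE => /orP[/eqP->|/E[]//]; apply: inV0.
case: wl => wl.
  move: lL; rewrite -wl inE (negbTE wL) orbF => /eqP w0.
  have: B (w n : C) (core i) by rewrite BC B_xw; lia.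
  by rewrite w0 B0l.
have: B l (w n) = false by rewrite B_w.
have -> : l = (w n + core i)%R by rewrite wl addvK.
by rewrite BDl B_ww // B_xw; lia.
Qed.

End Isotropic.

Section Family.
Local Open Scope group_scope.
Variables (C : cspace) (G : groupType) (n : nat).
Implicit Types (p r q u v y : C).
Hypothesis ng : n <= rank C.
Variable t : C -> G.
Hypothesis t_inv : forall u, isE n u -> t u * t u = 1.
Hypothesis t_conj : forall u v, isE n u -> isE n v ->
  t u * t v * (t u)^-1 = t (tau u v).

Lemma tV u : isE n u -> (t u)^-1 = t u.
Proof. by move=> Eu; apply: mulg1_eq; apply: t_inv. Qed.

Lemma t_push u v : isE n u -> isE n v -> t u * t v = t (tau u v) * t u.
Proof. by move=> Eu Ev; rewrite -t_conj // mulgVK. Qed.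

Lemma t_comm u v : isE n u -> isE n v -> B u v = false -> t u * t v = t v * t u.
Proof. by move=> Eu Ev uv; rewrite t_push // tau_fix // BC. Qed.

Lemma t_braid u v : isE n u -> isE n v -> B u v -> t u * t v * t u = t (u + v)%R.
Proof.
by move=> Eu Ev uv; rewrite -{2}(tV Eu) t_conj // tau_move 1?BC // addrC.
Qed.

(** A root of D_4 commutes with the product of four orthogonal reflections, each
    of which does not commute with it: this product is -1. With f the product of
    three of them, the fourth one is y f y f y, and it commutes with f. *)
Lemma t_frame y f1 f2 f3 :
  isE n y -> isE n f1 -> isE n f2 -> isE n f3 ->
  B y f1 -> B y f2 -> B y f3 ->
  B f1 f2 = false -> B f1 f3 = false -> B f2 f3 = false ->
  t y * (t f1 * t f2 * t f3 * t (f1 + f2 + f3)%R) =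
  t f1 * t f2 * t f3 * t (f1 + f2 + f3)%R * t y.
Proof.
move=> Ey E1 E2 E3 y1 y2 y3 f12 f13 f23.
set f := t f1 * t f2 * t f3.
have [c12 c13 c23] : [/\ t f1 * t f2 = t f2 * t f1, t f1 * t f3 = t f3 * t f1
    & t f2 * t f3 = t f3 * t f2] by split; apply: t_comm.
have fr : f = t f3 * (t f2 * t f1) by rewrite /f c12 -mulgA c13 mulgA c23 mulgA.
have E4 : isE n (f1 + f2 + f3)%R.
  have [[V1 e1 _] [V2 e2 _] [V3 e3 _]] := And3 E1 E2 E3.
  split; first by apply: inVD => //; apply: inVD.
    by rewrite !(BDl, BDr) e1 e2 e3 (BC f2 f1) (BC f3 f1) (BC f3 f2) f12 f13 f23.
  by apply/eqP => e; have := B0r y; rewrite -e !BDr y1 y2 y3.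
have f4 : t (f1 + f2 + f3)%R = t y * (f * t y * f) * t y.
  have yy : B y y = false by case: Ey.
  have E3y : isE n (f3 + y)%R by apply: isED_B; rewrite // BC.
  have E23y : isE n (f2 + (f3 + y))%R.
    by apply: isED_B; rewrite // BDr f23 BC y2.
  have E123y : isE n (f1 + (f2 + (f3 + y)))%R.
    by apply: isED_B; rewrite // !BDr f12 f13 BC y1.
  have -> : f * t y * f = t (f1 + (f2 + (f3 + y)))%R.
    rewrite -t_braid // ?BDr ?BDr ?f12 ?f13 1?BC ?y1 // -t_braid //; last first.
      by rewrite BDr f23 BC y2.
    rewrite -(t_braid E3) //; last by rewrite BC.
    by rewrite {2}fr /f !mulgA.
  rewrite t_braid //; last by rewrite !BDr y1 y2 y3 yy.
  by congr t; apply: vec_ext => z; rewrite !BDl; bcase.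
have cf4 : f * t (f1 + f2 + f3)%R = t (f1 + f2 + f3)%R * f.
  have [[_ e1 _] [_ e2 _] [_ e3 _]] := And3 E1 E2 E3.
  have o1 : B f1 (f1 + f2 + f3)%R = false by rewrite !BDr e1 f12 f13.
  have o2 : B f2 (f1 + f2 + f3)%R = false by rewrite !BDr e2 (BC f2) f12 f23.
  have o3 : B f3 (f1 + f2 + f3)%R = false by rewrite !BDr e3 !(BC f3) f13 f23.
  rewrite /f -mulgA (t_comm E3 E4 o3) !mulgA -(mulgA (t f1)) (t_comm E2 E4 o2).
  by rewrite !mulgA (t_comm E1 E4 o1).
by rewrite [in RHS]cf4 f4 !mulgA.
Qed.

Definition fprod p r q : G := \prod_(v <- fano p r q) t v.

Lemma t_prod_perm (s s' : seq C) :
  (forall u, u \in s -> isE n u) -> (forall u v, u \in s -> v \in s -> B u v = false) ->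
  perm_eq s s' -> \prod_(v <- s) t v = \prod_(v <- s') t v.
Proof.
move=> Es os ss'; have := @prod_perm _ (map t s) (map t s').
rewrite !big_map; apply; last exact: perm_map.
by move=> _ _ /mapP[u us ->] /mapP[v vs ->]; apply: t_comm; auto.
Qed.

Lemma fprod_perm p r q p' r' q' : isotropic3 n p r q ->
  perm_eq (fano p r q) (fano p' r' q') -> fprod p r q = fprod p' r' q'.
Proof.
move=> I; have [_ _ _ E] := I; apply: t_prod_perm => // u v.
exact: (fano_orth I).
Qed.

Let fprod_central1 y p r q : isE n y -> isotropic3 n p r q ->
  B y p -> B y r = false -> B y q = false -> t y * fprod p r q = fprod p r q * t y.
Proof.
move=> Ey I yp yr yq; have [pr pq rq E] := I.
have Ep : isE n p by apply: E; rewrite !inE eqxx ?orbT.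
have Er : isE n r by apply: E; rewrite !inE eqxx ?orbT.
have Eq : isE n q by apply: E; rewrite !inE eqxx ?orbT.
have Epr : isE n (p + r)%R by apply: E; rewrite !inE eqxx ?orbT.
have Epq : isE n (p + q)%R by apply: E; rewrite !inE eqxx ?orbT.
have Erq : isE n (r + q)%R by apply: E; rewrite !inE eqxx ?orbT.
have [[_ pp _] [_ rr _] [_ qq _]] := And3 Ep Er Eq.
have -> : fprod p r q = t p * t (p + r)%R * t (p + q)%R * t (p + (p + r) + (p + q))%R
    * (t r * t q * t (r + q)%R).
  rewrite /fprod (@t_prod_perm _ [:: p; p + r; p + q; p + (p + r) + (p + q); r; q; r + q]%R).
  - by rewrite !big_cons big_nil mulg1 !mulgA.
  - exact: E.
  - by move=> u v; apply: (fano_orth I).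
  - by rewrite /fano (addrA p p r) addvv add0r (addrCA r p q) addrA; perm_list.
rewrite mulgA t_frame //; try by rewrite !BDr ?BDl ?yp ?yr ?yq ?pp ?pr ?pq ?rq ?(BC r p) ?pr.
have c v : isE n v -> B y v = false -> t v * t y = t y * t v.
  by move=> Ev yv; rewrite t_comm // BC.
rewrite -!mulgA; do 4![congr (_ * _)].
rewrite (c (r + q)%R) ?BDr ?yr ?yq // (mulgA (t q) (t y)) (c q) //.
by rewrite -mulgA (mulgA (t r) (t y)) (c r) // -mulgA.
Qed.

(** The product over an isotropic space commutes with the whole family: a vector
    not orthogonal to it singles out four vectors in the position of
    [t_frame]. *)
Lemma fprod_central y p r q : isE n y -> isotropic3 n p r q ->
  t y * fprod p r q = fprod p r q * t y.
Proof.
move=> Ey; have Byp p' r' q' : isotropic3 n p' r' q' -> B y p' ->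
    t y * fprod p' r' q' = fprod p' r' q' * t y.
  move=> I yp.
  wlog yr : r' I / B y r' = false => [IH|].
    case yr : (B y r'); last exact: IH.
    rewrite (fprod_perm I (fano_add _ _ _)); apply: IH.
      exact: (isotropic3_perm I (fano_add _ _ _)).
    by rewrite BDr yr yp.
  case yq : (B y q'); last exact: fprod_central1.
  have P1 := fano_swap23 p' r' q'; have I1 := isotropic3_perm I P1.
  have P2 := fano_add p' q' r'; have I2 := isotropic3_perm I1 P2.
  rewrite (fprod_perm I P1) (fprod_perm I1 P2).
  by apply: fprod_central1; rewrite // BDr yq yp.
move=> I; case yp : (B y p); first exact: Byp.
have P1 := fano_swap12 p r q; have I1 := isotropic3_perm I P1.
case yr : (B y r); first by rewrite (fprod_perm I P1); apply: Byp.
have P2 := fano_swap23 p r q; have I2 := isotropic3_perm I P2.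
have P3 := fano_swap12 p q r; have I3 := isotropic3_perm I2 P3.
case yq : (B y q); first by rewrite (fprod_perm I P2) (fprod_perm I2 P3); apply: Byp.
have [_ _ _ E] := I.
have c v : v \in fano p r q -> t y * t v = t v * t y.
  move=> vL; apply: t_comm => //; first exact: E.
  by move: vL; rewrite !inE => /or4P[| | |/or4P[]] /eqP->; rewrite ?BDr ?yp ?yr ?yq.
rewrite /fprod; elim: (fano p r q) c => [|v s IH] c; first by rewrite big_nil mulg1 mul1g.
rewrite big_cons mulgA c ?mem_head // -!mulgA IH // => u us.
by apply: c; rewrite inE us orbT.
Qed.

(** Being central, the product is unchanged when the space is moved. *)
Lemma fprod_tau y p r q : isE n y -> isotropic3 n p r q ->
  fprod (tau y p) (tau y r) (tau y q) = fprod p r q.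
Proof.
move=> Ey I; have [_ _ _ E] := I.
rewrite -[RHS](mulgK (t y)) -fprod_central // /fprod -fano_tau big_map.
elim: (fano p r q) E => [|v s IH] E; first by rewrite !big_nil mulg1 mulgV.
rewrite !big_cons IH => [|u us]; last by apply: E; rewrite inE us orbT.
rewrite -t_conj //; last by apply: E; rewrite mem_head.
by rewrite !mulgA mulgVK.
Qed.

Lemma fprod_invol p r q : isotropic3 n p r q -> fprod p r q * fprod p r q = 1.
Proof.
move=> I; have [_ _ _ E] := I.
have c u v : u \in fano p r q -> v \in fano p r q -> t u * t v = t v * t u.
  by move=> uL vL; apply: t_comm; [apply: E..|apply: (fano_orth I)].
rewrite /fprod; elim: (fano p r q) E c => [|v s IH] E c.
  by rewrite !big_nil mulg1.
rewrite !big_cons.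
have cv : t v * \prod_(u <- s) t u = \prod_(u <- s) t u * t v.
  rewrite big_seq; apply: commute_prod => u us; apply: c; rewrite ?mem_head //.
  by rewrite inE us orbT.
rewrite {2}cv !mulgA -(mulgA (t v)) IH ?mulg1; first by apply/t_inv/E/mem_head.
  by move=> u us; apply: E; rewrite inE us orbT.
by move=> u u' us us'; apply: c; rewrite inE ?us ?us' orbT.
Qed.

End Family.

(** * Stabilizers of crosscaps *)

Section Stabilizer.
Local Open Scope group_scope.
Variables (C : cspace) (G : caction C) (m : nat).
Local Notation n := m.+1.
Local Notation x := (@core C).
Implicit Types (k h : G) (p r q s u v : C).
Hypothesis ng : n <= rank C.
Variables (t : C -> G) (Z : G).
Hypothesis t_inv : forall u, isE n u -> t u * t u = 1.
Hypothesis t_conj : forall u v, isE n u -> isE n v ->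
  t u * t v * (t u)^-1 = t (tau u v).
Hypothesis t_act : forall v, isE n v -> acts_as (t v) v.
Hypothesis t_al : forall i, 1 <= i < n -> t (x i + x i.+1)%R = al i.
Hypothesis t_be : 4 <= n -> t quad = be.
Hypothesis Z_inv : Z * Z = 1.
Hypothesis Z_comm : forall k, Gen true n k -> Z * k = k * Z.
Hypothesis Z_act : forall u, act Z u = u.

(** The smaller group enlarged by the central element Z of order at most two; Z is
    1 except when n = 7. *)
Definition GenZ k := Gen true m k \/ Gen true m (Z * k).

Hypothesis t_stab : forall v, isE n v -> B v (x n) = false -> GenZ (t v).
Hypothesis t_fano : forall p r q, isotropic3 n p r q ->
  fprod t p r q = 1 \/ fprod t p r q = Z.

Let mg : m <= rank C. Proof. exact: ltnW. Qed.
Let GenS k : Gen true m k -> Gen true n k.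
Proof. by apply: GenW. Qed.

Let GenZ_comm k : GenZ k -> Z * k = k * Z.
Proof.
case=> [/GenS/Z_comm//|/GenS/Z_comm].
by rewrite mulgA Z_inv mul1g => e; rewrite {2}e -!mulgA Z_inv mulg1.
Qed.

Let GenZM k h : GenZ k -> GenZ h -> GenZ (k * h).
Proof.
move=> Hk Hh; have ck := GenZ_comm Hk; case: Hk Hh => Hk [] Hh.
- by left; apply: GenM.
- by right; rewrite mulgA ck -mulgA; apply: GenM.
- by right; rewrite mulgA; apply: GenM.
by left; have := GenM Hk Hh; rewrite ck -mulgA (mulgA Z) Z_inv mul1g.
Qed.

Let GenZ1 : GenZ 1.
Proof. by left; apply: Gen1. Qed.

Let GenZZ : GenZ Z.
Proof. by right; rewrite Z_inv; apply: Gen1. Qed.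

Let GenZ_fix k : GenZ k -> act k (x n) = x n.
Proof.
case=> Hk; have := act_fix mg Hk (i := n); first by apply; lia.
by rewrite actM Z_act; apply; lia.
Qed.

Definition moving v := isE n v /\ B v (x n).

(** The possible shapes of an element according to the image of x_n, which is x_n,
    x_n + v or x_n + u + v. *)
Inductive small_coset : G -> Prop :=
| small_coset0 h : GenZ h -> small_coset h
| small_coset1 v h : moving v -> GenZ h -> small_coset (t v * h)
| small_coset2 u v h : moving u -> moving v -> B u v = false -> GenZ h ->
    small_coset (t u * t v * h).

Let stab_sum u v : moving u -> moving v -> B u v -> GenZ (t (u + v)%R).
Proof.
move=> [Eu un] [Ev vn] uv; apply: t_stab; first exact: isED_B.
by rewrite BDl un vn.
Qed.

Let swap_braid u v : moving u -> moving v -> B u v ->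
  t u * t v = t v * t (u + v)%R.
Proof.
move=> [Eu un] [Ev vn] uv.
by rewrite addrC -(t_braid t_inv t_conj Ev Eu) 1?BC // !mulgA t_inv // mul1g.
Qed.

Let coset_pair u v h : moving u -> moving v -> GenZ h -> small_coset (t u * t v * h).
Proof.
move=> Mu Mv Hh; case uv : (B u v); last exact: small_coset2.
rewrite swap_braid // -mulgA; apply: small_coset1 => //.
by apply: GenZM => //; apply: stab_sum.
Qed.

Let moving_tau s v : isE n s -> B s (x n) = false -> moving v -> moving (tau s v).
Proof.
by move=> Es sn [Ev vn]; split; [exact: isE_tau|rewrite B_taul sn andbF addbF].
Qed.

(* Since t_s t_u = t_u t_(s+u), and s + u is orthogonal to x_n, the factor t_(s+u)
   belongs to the smaller group; it is pushed past t_v and absorbed in h. *)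
Let coset_triple s u v h : moving s -> moving u -> moving v -> B s u ->
  GenZ h -> small_coset (t s * (t u * t v * h)).
Proof.
move=> Ms Mu Mv su Hh; have Hsu := stab_sum Ms Mu su.
rewrite !mulgA swap_braid // -(mulgA (t u)).
have [[Es sn] [Eu un] [Ev vn]] := And3 Ms Mu Mv.
have Esu : isE n (s + u)%R by apply: isED_B.
rewrite (t_push t_conj Esu Ev) !mulgA -mulgA; apply: coset_pair => //.
  by apply: moving_tau => //; rewrite BDl sn un.
exact: GenZM.
Qed.

(* Three orthogonal lifts are traded for t_(s+u+v) by means of the product over
   the isotropic space that they span; the three lifts along s + u, s + v and u + v
   belong to the smaller group. *)
Let coset_orth s u v h : moving s -> moving u -> moving v ->
  B s u = false -> B s v = false -> B u v = false ->
  GenZ h -> small_coset (t s * (t u * t v * h)).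
Proof.
move=> Ms Mu Mv su sv uv Hh; have [[Es sn] [Eu un] [Ev vn]] := And3 Ms Mu Mv.
have [<-|ne_su] := eqVneq s u.
  by rewrite !mulgA t_inv // mul1g; apply: small_coset1.
have [<-|ne_sv] := eqVneq s v.
  rewrite (t_comm t_conj Eu Es) 1?BC // !mulgA t_inv // mul1g.
  exact: small_coset1.
have [<-|ne_uv] := eqVneq u v.
  by rewrite t_inv // mul1g; apply: small_coset1.
have Esu := isED Es Eu ne_su; have Esv := isED Es Ev ne_sv.
have Euv := isED Eu Ev ne_uv.
have suvn : B (s + u + v)%R (x n) by rewrite !BDl sn un vn.
have Esuv : isE n (s + u + v)%R.
  apply: isED => //; apply/eqP => e; have := vn.
  by rewrite -e BDl sn un.
have I : isotropic3 n s u v.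
  split=> // y; rewrite !inE.
  by case/or4P=> [| | |/or4P[]] /eqP->.
have -> : t s * (t u * t v * h) = t (s + u + v)%R *
    (t (s + u)%R * t (s + v)%R * t (u + v)%R * (fprod t s u v * h)).
  rewrite /fprod (@t_prod_perm _ _ _ _ t_conj _
    [:: u + v; s + v; s + u; s + u + v; s; u; v]%R); first last.
  - by rewrite /fano; perm_list.
  - by move=> y z; apply: (fano_orth I).
  - by case: I.
  rewrite !big_cons big_nil mulg1 !mulgA.
  rewrite -(mulgA _ (t (u + v)%R) (t (u + v)%R)) t_inv // mulg1.
  rewrite -(mulgA _ (t (s + v)%R) (t (s + v)%R)) t_inv // mulg1.
  rewrite -(mulgA _ (t (s + u)%R) (t (s + u)%R)) t_inv // mulg1.
  by rewrite t_inv // mul1g.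
apply: small_coset1 => //; apply: GenZM; last first.
  by apply: GenZM => //; case: (t_fano I) => ->; [exact: GenZ1|exact: GenZZ].
by apply: GenZM; [apply: GenZM|]; apply: t_stab => //; rewrite BDl ?sn ?un ?vn.
Qed.

Let coset_t s k : isE n s -> small_coset k -> small_coset (t s * k).
Proof.
move=> Es; case sn: (B s (x n)); last first.
  have Hs : GenZ (t s) by apply: t_stab.
  case=> [h Hh|v h Mv Hh|u v h Mu Mv uv Hh].
  - exact/small_coset0/GenZM.
  - have [Ev _] := Mv; rewrite mulgA (t_push t_conj Es Ev) -mulgA.
    by apply: small_coset1; [apply: moving_tau|apply: GenZM].
  have [[Eu _] [Ev _]] := conj Mu Mv.
  rewrite !mulgA (t_push t_conj Es Eu) -(mulgA _ (t s)) (t_push t_conj Es Ev).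
  rewrite !mulgA -(mulgA _ (t s)).
  by apply: coset_pair; [apply: moving_tau..|apply: GenZM].
have Ms : moving s by [].
case=> [h Hh|v h Mv Hh|u v h Mu Mv uv Hh].
- exact: small_coset1.
- by rewrite mulgA; apply: coset_pair.
case su : (B s u); first exact: coset_triple.
case sv : (B s v); last exact: coset_orth.
by rewrite (t_comm t_conj (proj1 Mu) (proj1 Mv) uv); apply: coset_triple.
Qed.

Let Gen_coset k : Gen true n k -> small_coset k.
Proof.
elim=> [|i k' ni _ IH|k' _ n4 _ IH]; first exact: small_coset0.
  by rewrite -t_al //; apply: coset_t IH; apply: isE_xx; lia.
by rewrite -t_be //; apply: coset_t IH; apply: isE_quad.
Qed.

(** In the three cases x_n is sent to x_n, x_n + v and x_n + u + v, so only the
    first one, or the third one with u = v, is possible. *)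
Lemma stabilizer k : Gen true n k -> act k (x n) = x n -> GenZ k.
Proof.
move=> /Gen_coset[//|v h [Ev vn] Hh|u v h [Eu un] [Ev vn] uv Hh].
  rewrite actM GenZ_fix // t_act // tau_move 1?BC // => e.
  by case: Ev => _ _ /eqP[]; rewrite -(addKv (x n) v) e addvv.
rewrite !actM GenZ_fix // !t_act // (@tau_move _ v) 1?BC //.
rewrite tau_move; last by rewrite BDl (BC v) uv BC un.
rewrite -addrA => e; have <- : u = v.
  by apply/eqP; rewrite -addv_eq0 addrC -(addKv (x n) (v + u)%R) e addvv.
by rewrite t_inv // mul1g.
Qed.

Lemma kernel k : trivker G m -> Gen true n k -> (forall u, act k u = u) ->
  k = 1 \/ k = Z.
Proof.
move=> Pm Hk kid; case: (stabilizer Hk (kid _)) => Hk'; first by left; apply: Pm.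
have Zk : Z * k = 1 by apply: Pm => // u; rewrite actM kid Z_act.
by right; rewrite -[k]mul1g -Z_inv -mulgA Zk mulg1.
Qed.

End Stabilizer.

(** * Transvections supported off one crosscap *)

Section Local.
Local Open Scope group_scope.
Variables (C : cspace) (G : caction C) (m : nat).
Local Notation n := m.+1.
Local Notation x := (@core C).
Local Notation w := (@w C).
Local Notation quad := (@quad C).
Local Notation al := (@al C G).
Local Notation be := (@be C G).
Implicit Types (k h s : G) (p r q u v y : C) (i j : nat).
Hypothesis ng : n <= rank C.
Hypothesis m4 : 4 <= m.
Hypothesis Pm : trivker G m.

Let mg : m <= rank C. Proof. exact: ltnW. Qed.
Let GenS b k : Gen b m k -> Gen b n k.
Proof. by apply: GenW; rewrite ?implybb. Qed.
Let GenT k : Gen false m k -> Gen true m k.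
Proof. exact: GenW. Qed.
Let Gen_rotT i : 1 <= i -> Gen true n (rot G i m).
Proof. by move=> i1; apply: Gen_rot. Qed.

(** The conjugate of the group on the first m crosscaps that leaves out the
    crosscap i instead of the last one. *)
Definition loc i k := Gen true m ((rot G i m)^-1 * k * rot G i m).

Lemma loc1 i : loc i 1.
Proof. by rewrite /loc mulg1 mulVg; apply: Gen1. Qed.

Lemma locM i k h : loc i k -> loc i h -> loc i (k * h).
Proof. by move=> Hk Hh; have := GenM Hk Hh; rewrite /loc !mulgA mulgK. Qed.

Lemma locV i k : loc i k -> loc i k^-1.
Proof. by move=> Hk; have := GenV mg Hk; rewrite /loc !invgM invgK !mulgA. Qed.

Lemma loc_prod i (s : seq G) : (forall k, k \in s -> loc i k) ->
  loc i (\prod_(k <- s) k).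
Proof.
elim: s => [|k s IH] H; first by rewrite big_nil; apply: loc1.
rewrite big_cons; apply: locM; first by apply: H; rewrite mem_head.
by apply: IH => h hs; apply: H; rewrite inE hs orbT.
Qed.

Lemma loc_last k : loc n k <-> Gen true m k.
Proof. by rewrite /loc /rot big_geq // invg1 mul1g mulg1. Qed.

Lemma loc_Gen i k : 1 <= i -> loc i k -> Gen true n k.
Proof.
move=> i1 Hk; have Hr := Gen_rotT i1.
have := GenM (GenM Hr (GenS Hk)) (GenV ng Hr).
by rewrite !mulgA mulgV mul1g mulgK.
Qed.

Lemma loc_fix i k : 1 <= i <= n -> loc i k -> act k (x i) = x i.
Proof.
move=> ni Hk; rewrite -(act_rot G ni ng).
have nn : m < n <= rank C by blia.
have := act_fix mg Hk nn; rewrite !actM => e.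
by rewrite -{2}e actKV.
Qed.

Lemma loc_eq i k h : loc i k -> loc i h -> (forall u, act k u = act h u) -> k = h.
Proof.
move=> Hk Hh kh.
have e : (rot G i m)^-1 * k * rot G i m = (rot G i m)^-1 * h * rot G i m.
  by apply: (trivker_inj mg Pm) => // u; rewrite !actM kh.
by apply: (@mulgI _ (rot G i m)^-1); apply: (@mulIg _ (rot G i m)).
Qed.

(** Up to the cycles that define the local groups, s fixes the last crosscap and
    hence belongs to the symmetric group on the others. *)
Lemma loc_conj s i j k : Gen false n s -> 1 <= i <= n -> 1 <= j <= n ->
  act s (x i) = x j -> loc i k -> loc j (s * k * s^-1).
Proof.
move=> Hs ni nj sij Hk.
pose r := (rot G j m)^-1 * s * rot G i m.
have Hr : Gen false m r.
  apply: sym_stab; first by blia.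
    have [i1 j1] : 1 <= i /\ 1 <= j by blia.
    by apply: GenM; [apply: GenM => //; apply: GenV => //|]; apply: Gen_rot.
  by rewrite !actM act_rot // sij -(act_rot G nj ng) actK.
have := GenM (GenM (GenT Hr) Hk)
  (GenT (GenV mg Hr)).
rewrite /loc /r !invgM invgK => H.
by move: H; rewrite !mulgA !mulgK.
Qed.

Lemma acts_fix k v i : v != 0%R -> acts_as k v -> act k (x i) = x i ->
  B v (x i) = false.
Proof.
move=> v0 kv; rewrite kv /tau BC; case: (B v (x i)) => // e.
by case/eqP: v0; rewrite -(addKv (x i) v) e addvv.
Qed.

Lemma loc_conj_acts s k v : Gen false n s -> acts_as k v ->
  acts_as (s * k * s^-1) (act s v).
Proof. by move=> Hs; apply: act_conj Hs. Qed.

(** The element of a local group that acts as a given transvection does not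
    depend on the crosscap left out: by the double coset decomposition of the
    symmetric group one may assume that the two crosscaps are m and m + 1, and
    then the vector already avoids both. *)
Lemma loc_uniq i j k h v : isE n v -> 1 <= i <= n -> 1 <= j <= n ->
  loc i k -> loc j h -> acts_as k v -> acts_as h v -> k = h.
Proof.
move=> [Vv vv v0] ni nj Hk Hh kv hv.
have vi := acts_fix v0 kv (loc_fix ni Hk).
have vj := acts_fix v0 hv (loc_fix nj Hh).
have [i1 j1] : 1 <= i /\ 1 <= j by blia.
have Ri := Gen_rot G false m i1; have Rj := Gen_rot G false m j1.
have Rj' := GenV ng Rj.
pose r := (rot G j m)^-1 * rot G i m.
have Hr : Gen false n r by apply: GenM.
pose k' := (rot G i m)^-1 * k * rot G i m; pose h' := (rot G j m)^-1 * h * rot G j m.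
suff e : r * k' * r^-1 = h'.
  move: e; rewrite /r /k' /h' invgM invgK !mulgA mulgK mulgK => e.
  apply: (@mulgI _ (rot G j m)^-1); exact: (@mulIg _ (rot G j m)).
have kv' : acts_as k' (act (rot G i m)^-1 v).
  have := loc_conj_acts (GenV ng Ri) kv; by rewrite invgK.
have hv' : acts_as h' (act (rot G j m)^-1 v).
  have := loc_conj_acts Rj' hv; by rewrite invgK.
have rv : act r (act (rot G i m)^-1 v) = act (rot G j m)^-1 v.
  by rewrite actM actKV.
case: (sym_double_coset _ Hr) => [|Hr'|[s1 [s2 [H1 H2 rE]]]]; first by blia.
  apply: (trivker_inj mg Pm) => //.
    have Hr2 := GenT Hr'.
    by apply: GenM; [apply: GenM|apply: GenV].
  by move=> u; rewrite (loc_conj_acts Hr kv') hv' rv.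
have [S1 S2] := conj (GenT H1) (GenT H2).
pose k2 := s2 * k' * s2^-1; pose h2 := s1^-1 * h' * s1.
have Hk2 : Gen true m k2 by apply: GenM; [apply: GenM|apply: GenV].
have Hh2 : Gen true m h2 by apply: GenM => //; apply: GenM => //; apply: GenV.
pose v1 := act s2 (act (rot G i m)^-1 v); pose v2 := act s1^-1 (act (rot G j m)^-1 v).
have kv2 : acts_as k2 v1 by apply: loc_conj_acts kv'; apply: GenS.
have hv2 : acts_as h2 v2.
  have := loc_conj_acts (GenS (GenV mg H1)) hv'; by rewrite invgK.
have av : act (al m) v1 = v2 by rewrite /v1 /v2 -rv rE !actM actK.
have Ev : isE n v by [].
have E1 : isE n v1.
  by apply: act_isE (GenS H2) _ => //; apply: act_isE (GenV ng Ri) _.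
have E2 : isE n v2.
  by apply: act_isE (GenS (GenV mg H1)) _ => //; apply: act_isE Rj' _.
have nn : m < n <= rank C by blia.
have v1n : B v1 (x n) = false.
  case: E1 => _ _ nz; apply: acts_fix kv2 _ => //; exact: act_fix Hk2 nn.
have v2n : B v2 (x n) = false.
  case: E2 => _ _ nz; apply: acts_fix hv2 _ => //; exact: act_fix Hh2 nn.
have v1m : B v1 (x m) = false.
  have Ha : Gen true n (al m) by apply: Gen_al; blia.
  rewrite -(act_iso ng v1 (x m) Ha) av act_al; last by blia.
  rewrite tau_move; last by rewrite BDr !Bx; blia.
  by rewrite addrA addvv add0r.
have v12 : v1 = v2.
  rewrite -av act_al; last by blia.
  by rewrite tau_fix // BDr v1m v1n.
have E0 : isE m.-1 v1.
  have [V1 e1 nz] := E1; split=> //.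
  by apply: inV_pred v1m; apply/inVS.
have mg1 : m.-1 <= rank C by apply: leq_trans (leq_pred m) mg.
have [z Hz zv] := realize G mg1 E0.
have Hz' : Gen true m z by apply: GenW Hz; rewrite ?leq_pred.
have kz : k2 = z by apply: (trivker_inj mg Pm) => // u; rewrite kv2 zv.
have hz : h2 = z by apply: (trivker_inj mg Pm) => // u; rewrite hv2 zv v12.
have cz : al m * z = z * al m by apply: al_Gen_comm Hz; blia.
have -> : r * k' * r^-1 = s1 * (al m * k2 * (al m)^-1) * s1^-1.
  by rewrite rE /k2 !invgM !mulgA.
by rewrite kz cz mulgK -hz /h2 !mulgA mulgV mul1g mulgK.
Qed.

Lemma loc_ex v i : isE n v -> 1 <= i <= n -> B v (x i) = false ->
  exists k, loc i k /\ acts_as k v.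
Proof.
move=> Ev ni vi; have i1 : 1 <= i by blia.
have Ri := Gen_rotT i1; have Ri' := GenV ng Ri.
have [V0 e0 nz] := act_isE ng Ri' Ev.
have E0 : isE m (act (rot G i m)^-1 v).
  split=> //; apply/inVS => //; split=> //.
  by rewrite -(act_iso ng _ _ Ri) actKV act_rot.
have [k Hk kv] := realize G mg E0.
exists (rot G i m * k * (rot G i m)^-1); split.
  by rewrite /loc !mulgA mulVg mul1g mulgVK.
by have := act_conj ng Ri kv; rewrite /acts_as actKV.
Qed.

Definition is_lift v k := exists i, [/\ 1 <= i <= n, loc i k & acts_as k v].

(** The lift of the transvection along v to the abstract group, for v supported
    off some crosscap. The only other even vector is the sum w n for even n, and
    its lift is provisionally 1; a product of commuting lifts will replace it. *)
Definition lift v : G :=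
  if pselect (exists k, is_lift v k) is left H then projT1 (cid H) else 1.

Lemma lift_loc v i : isE n v -> 1 <= i <= n -> B v (x i) = false ->
  loc i (lift v) /\ acts_as (lift v) v.
Proof.
move=> Ev ni vi; have [k [Hk kv]] := loc_ex Ev ni vi.
rewrite /lift; case: pselect => [H|[]]; last by exists k, i.
case: (cid H) => h [j [nj Hh hv]] /=.
by rewrite -(loc_uniq Ev ni nj Hk Hh kv hv).
Qed.

Lemma lift_eq v i k : isE n v -> 1 <= i <= n -> loc i k -> acts_as k v -> k = lift v.
Proof.
move=> Ev ni Hk kv; have [_ _ v0] := Ev.
have [Hl lv] := lift_loc Ev ni (acts_fix v0 kv (loc_fix ni Hk)).
exact: loc_uniq Hk Hl kv lv.
Qed.

Lemma lift_w : lift (w n) = 1.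
Proof.
rewrite /lift; case: pselect => // -[k [i [ni Hk kw]]]; exfalso.
have wi : B (w n) (x i) by rewrite BC B_xw; blia.
have w0 : w n != 0%R by apply/eqP => w0; rewrite w0 B0l in wi.
by have := acts_fix w0 kw (loc_fix ni Hk); rewrite wi.
Qed.

Lemma lift_acts v : isE n v -> v != w n -> acts_as (lift v) v.
Proof.
by move=> Ev vw; have [Vv _ _] := Ev; have [i ni vi] := ex_zero ng Vv vw; case: (lift_loc Ev ni vi).
Qed.

Lemma lift_Gen v : isE n v -> Gen true n (lift v).
Proof.
move=> Ev; have [->|vw] := eqVneq v (w n); first by rewrite lift_w; apply: Gen1.
have [Vv _ _] := Ev; have [i ni vi] := ex_zero ng Vv vw.
by apply: (@loc_Gen i); [blia|case: (lift_loc Ev ni vi)].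
Qed.

Lemma lift_inv v : isE n v -> lift v * lift v = 1.
Proof.
move=> Ev; have [->|vw] := eqVneq v (w n); first by rewrite lift_w mulg1.
have [Vv vv _] := Ev; have [i ni vi] := ex_zero ng Vv vw.
have [Hl lv] := lift_loc Ev ni vi.
apply: (@loc_eq i); [exact: locM|exact: loc1|move=> u].
by rewrite actM !lv tauK // act1.
Qed.

Lemma lift_sym s v : Gen false n s -> isE n v ->
  s * lift v * s^-1 = lift (act s v).
Proof.
move=> Hs Ev; have [->|vw] := eqVneq v (w n).
  by rewrite (act_w ng Hs) lift_w mulg1 mulgV.
have [Vv vv _] := Ev; have [i ni vi] := ex_zero ng Vv vw.
have [Hl lv] := lift_loc Ev ni vi.
have [j nj sij] := sym_perm ng Hs ni.
apply: (lift_eq _ nj); first exact: act_isE Hs Ev.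
  exact: loc_conj sij Hl.
exact: loc_conj_acts.
Qed.

(** For i < m both sides belong to the group off the last crosscap; the last
    generator a_m is conjugate to a_(m-1) by the braid relation. *)
Lemma lift_al i : 1 <= i < n -> lift (x i + x i.+1)%R = al i.
Proof.
have base j : 1 <= j < m -> lift (x j + x j.+1)%R = al j.
  move=> jm; symmetry; apply: (@lift_eq _ n); last by move=> u; rewrite act_al //; blia.
  - by apply: isE_xx; blia.
  - by blia.
  by apply/loc_last; apply: Gen_al.
move=> ni; have [e|im] := eqVneq i m; last by apply: base; blia.
subst i; have [l lm] : exists l, m = l.+1 by exists m.-1; blia.
have [A1 A2] : al l * al l = 1 :> G /\ al m * al m = 1 :> G.
  by split; apply: al2; blia.
have Hs : Gen false n (al l * al m : G) by apply: GenM; apply: Gen_al; blia.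
have -> : (x m + x n)%R = act (al l * al m : G) (x l + x l.+1)%R.
  have e1 : act (al m) (x l + x l.+1)%R = (x l + x n)%R.
    rewrite act_al; last by blia.
    rewrite -lm tau_move; first by rewrite !addrA addvK.
    by rewrite !(BDl, BDr) !Bx; blia.
  rewrite actM e1 act_al; last by blia.
  rewrite -lm tau_move; first by rewrite addrAC addrA addvv add0r.
  by rewrite !(BDl, BDr) !Bx; blia.
rewrite -lift_sym //; last by apply: isE_xx; blia.
rewrite base; last by blia.
rewrite invgM !al_inv; [|blia..].
have := @al_braid _ G l; rewrite -lm => br.
rewrite !mulgA br; [|blia..].
by rewrite -(mulgA _ (al m) (al m)) A2 mulg1 -mulgA A1 mulg1.
Qed.

Lemma loc_be i : 5 <= i <= n -> loc i be.
Proof.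
move=> ni; rewrite /loc -mulgA -rot_be; [|blia..].
by rewrite mulgA mulVg mul1g; apply: Gen_be.
Qed.

Lemma be_acts : acts_as (be : G) quad.
Proof. by move=> u; rewrite act_be //; blia. Qed.

Lemma lift_quad : lift quad = be.
Proof.
symmetry; apply: (@lift_eq _ n); last exact: be_acts.
- by apply: isE_quad; blia.
- by blia.
by apply: loc_be; blia.
Qed.

(** b permutes the lifts as it should whenever there is a crosscap off which
    both b and the vector are supported. *)
Lemma be_lift v i : isE n v -> 5 <= i <= n -> B v (x i) = false ->
  be * lift v * be^-1 = lift (tau quad v).
Proof.
move=> Ev i5 vi; have ni : 1 <= i <= n by blia.
have Hb : Gen true n (be : G) by apply: Gen_be; blia.
have [Hl lv] := lift_loc Ev ni vi.
rewrite -be_acts; apply: (lift_eq _ ni); first exact: act_isE Hb Ev.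
  by have Lb := loc_be i5; apply: locM (locM Lb Hl) (locV Lb).
exact: act_conj Hb lv.
Qed.

Lemma lift_prod i (s : seq C) : 1 <= i <= n -> (forall v, v \in s -> isE n v) ->
  (forall v, v \in s -> B v (x i) = false) ->
  (forall u, foldr (fun v => tau v) u s = u) -> \prod_(v <- s) lift v = 1.
Proof.
move=> ni Es si id_s; have L v : v \in s -> loc i (lift v) /\ acts_as (lift v) v.
  by move=> vs; apply: lift_loc; auto.
apply: (@loc_eq i); [|exact: loc1|].
  rewrite -(big_map lift predT id); apply: loc_prod => k /mapP[v vs ->].
  by case: (L v vs).
move=> u; rewrite act1 -[RHS]id_s.
elim: s L {Es si id_s} => [|v s IH] L; first by rewrite big_nil act1.
rewrite big_cons actM (proj2 (L v (mem_head _ _))) /= IH // => y ys.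
by apply: L; rewrite inE ys orbT.
Qed.

(** In a group off one crosscap, which acts faithfully, the product is that of the
    transvections. *)
Lemma fprod_off i p r q : 1 <= i <= n -> isotropic3 n p r q ->
  (forall v, v \in fano p r q -> B v (x i) = false) -> fprod lift p r q = 1.
Proof.
move=> ni I Li; have [pr pq rq E] := I.
apply: (lift_prod ni E Li) => u /=.
have [Ep Er Eq] : [/\ B p p = false, B r r = false & B q q = false].
  by split; apply: (fano_orth I); rewrite !inE eqxx ?orbT.
have [_ e _] : isE n (p + r + q)%R by apply: E; rewrite !inE eqxx ?orbT.
by rewrite tau_fano // tauK.
Qed.

End Local.

(** * The induction step when the lifts are permuted correctly *)

Section Complete.
Local Open Scope group_scope.
Variables (C : cspace) (G : caction C) (m : nat).
Local Notation n := m.+1.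
Local Notation x := (@core C).
Local Notation w := (@w C).
Local Notation quad := (@quad C).
Local Notation al := (@al C G).
Local Notation be := (@be C G).
Implicit Types (k h s : G) (p r q u v y : C) (i j : nat).
Hypothesis ng : n <= rank C.

Lemma Gen_equiv (t : C -> G) : 4 <= n ->
  (forall s v, Gen false n s -> isE n v -> s * t v * s^-1 = t (act s v)) ->
  (forall v, isE n v -> be * t v * be^-1 = t (tau quad v)) ->
  forall k v, Gen true n k -> isE n v -> k * t v * k^-1 = t (act k v).
Proof.
move=> n4 t_sym t_be k v Hk Ev; elim: Hk => [|i k' ni Hk' IH|k' _ _ Hk' IH].
- by rewrite act1 mul1g invg1 mulg1.
- rewrite invgM !mulgA -(mulgA (al i)) -(mulgA (al i)) IH actM t_sym //.
    exact: Gen_al.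
  exact: act_isE Hk' Ev.
rewrite invgM !mulgA -(mulgA be) -(mulgA be) IH actM act_be; last by blia.
by rewrite t_be //; apply: act_isE Hk' Ev.
Qed.

Hypothesis m4 : 4 <= m.
Hypothesis Pm : trivker G m.
Local Notation lift := (lift G m).
Hypothesis be_conj : forall v, isE n v -> be * lift v * be^-1 = lift (tau quad v).

Let lift_inv u : isE n u -> lift u * lift u = 1.
Proof. exact: lift_inv. Qed.

Lemma lift_conjG k v : Gen true n k -> isE n v -> k * lift v * k^-1 = lift (act k v).
Proof.
apply: Gen_equiv; first by blia.
  by move=> s y Hs Ey; apply: lift_sym.
exact: be_conj.
Qed.

Lemma lift_conj u v : isE n u -> isE n v ->
  lift u * lift v * (lift u)^-1 = lift (tau u v).
Proof.
move=> Eu Ev; rewrite lift_conjG //; last exact: lift_Gen.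
have [->|uw] := eqVneq u (w n); last by rewrite lift_acts.
have [Vv vv _] := Ev.
by rewrite lift_w // act1 tau_fix // B_w.
Qed.

(** The space is moved off a crosscap, where the product is trivial. *)
Lemma fprod_1 i p r q : 1 <= i <= n -> isotropic3 n p r q ->
  ~~ in_span [:: p; r; q; x i] (w n) -> fprod lift p r q = 1.
Proof.
move=> ni I wL; have [y Ey Ly] := move_off ng ni I wL.
rewrite -(fprod_tau lift_inv lift_conj Ey I).
apply: (fprod_off ng m4 Pm ni); first exact: isotropic3_tau.
by move=> v; rewrite -fano_tau => /mapP[u uL ->]; apply: Ly.
Qed.

Let lift_stab v : isE n v -> B v (x n) = false -> Gen true m (lift v).
Proof.
move=> Ev vn; have nn : 1 <= n <= n by blia.
have [Hl _] := lift_loc ng m4 Pm Ev nn vn.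
exact/loc_last.
Qed.

Let kernel1 (t : C -> G) :
  (forall u, isE n u -> t u * t u = 1) ->
  (forall u v, isE n u -> isE n v -> t u * t v * (t u)^-1 = t (tau u v)) ->
  (forall v, isE n v -> acts_as (t v) v) ->
  (forall v, v != w n -> t v = lift v) ->
  (forall p r q, isotropic3 n p r q -> fprod t p r q = 1) -> trivker G n.
Proof.
move=> ti tc ta tl tf k Hk kid.
have coord v i : 1 <= i <= n -> B v (x i) = false -> v != w n.
  by move=> ni; apply: contraFN => /eqP->; rewrite BC B_xw; blia.
suff [//|//] : k = 1 \/ k = 1.
apply: (@kernel C G m ng t 1 ti tc ta _ _ _ _ _ _ _ k Pm Hk kid).
- move=> i ni; rewrite tl ?lift_al //.
  have [j nj /andP[ji ji1]] : exists2 j, 1 <= j <= n & (j != i) && (j != i.+1).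
    have [i2|i2] := ltnP 2 i; [by exists 1%N; blia|by exists 4; blia].
  by apply: (coord _ j) => //; rewrite xxE; blia.
- by move=> _; rewrite tl ?lift_quad //; apply: (coord _ 5); rewrite ?quadE; blia.
- by rewrite mulg1.
- by move=> h _; rewrite mulg1 mul1g.
- exact: act1.
- move=> v Ev vn; left; rewrite tl; first exact: lift_stab.
  by apply: (coord _ n) => //; blia.
by move=> p r q I; left; apply: tf.
Qed.

Lemma trivker_odd : odd n -> trivker G n.
Proof.
move=> on; apply: (@kernel1 lift) => //; first exact: lift_conj.
  move=> v Ev; apply: lift_acts => //; apply/eqP => vw.
  by case: Ev => _; rewrite vw B_ww // on.
move=> p r q I; have [|i ni wL] := move_off_odd ng _ on I; first by blia.
exact: fprod_1 wL.
Qed.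

Section Even.
Hypothesis en : ~~ odd n.

Let Ew : isE n (w n).
Proof. by apply: isE_w. Qed.

Let wn v : isE n v -> B v (w n) = false.
Proof. by move=> [Vv vv _]; rewrite B_w. Qed.

Let n6 : 6 <= n.
Proof. by move: m4 en; blia. Qed.

(** The pairs that span a totally isotropic space together with w. *)
Let ipair p r := isotropic3 n p r (w n).

Let ipair_swap p r : ipair p r -> ipair r p.
Proof. by move=> I; apply: isotropic3_perm I (fano_swap12 _ _ _). Qed.

Let fprod_swap p r : ipair p r -> fprod lift p r (w n) = fprod lift r p (w n).
Proof. by move=> I; apply: (fprod_perm lift_conj I); apply: fano_swap12. Qed.

Let ipairP p r : isE n p -> isE n r -> B p r = false ->
  p != r -> p != w n -> r != w n -> p != (r + w n)%R -> ipair p r.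
Proof.
move=> Ep Er pr ne_pr pw rw prw; split=> //; try exact: wn.
have Epr := isED Ep Er ne_pr; have Epw := isED Ep Ew pw; have Erw := isED Er Ew rw.
have Eprw : isE n (p + r + w n)%R.
  by apply: isED => //; apply: contraNneq prw => <-; rewrite addrCA addvv addr0.
by move=> v; rewrite !inE => /or4P[| | |/or4P[]] /eqP->.
Qed.

Let ipair_ne p r : ipair p r -> [/\ isE n p, isE n r, B p r = false, p != r &
  [/\ p != w n, r != w n & p != (r + w n)%R]].
Proof.
move=> [pr _ _ E].
have Epr : isE n (p + r)%R by apply: E; rewrite !inE eqxx ?orbT.
have Epw : isE n (p + w n)%R by apply: E; rewrite !inE eqxx ?orbT.
have Erw : isE n (r + w n)%R by apply: E; rewrite !inE eqxx ?orbT.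
have Eprw : isE n (p + r + w n)%R by apply: E; rewrite !inE eqxx ?orbT.
split; [by apply: E; rewrite !inE eqxx ?orbT..|by []| |].
  by apply/eqP => e; case: Epr => _ _; rewrite e addvv eqxx.
split; apply/eqP => e.
- by case: Epw => _ _; rewrite e addvv eqxx.
- by case: Erw => _ _; rewrite e addvv eqxx.
by case: Eprw => _ _; rewrite -addrA -e addvv eqxx.
Qed.

(** All the products over isotropic spaces through w are equal: a transvection
    that moves one space to the other connects two spaces which are not
    orthogonal, and intermediate spaces connect the others. *)
Let fprod_move p p' r : ipair p r -> ipair p' r -> B p p' ->
  fprod lift p r (w n) = fprod lift p' r (w n).
Proof.
move=> I I' pp'; have [Ep Er pr _ _] := ipair_ne I.
have [Ep' _ p'r _ _] := ipair_ne I'.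
have Ey : isE n (p + p')%R by apply: isED_B.
rewrite -(fprod_tau lift_inv lift_conj Ey I).
have -> : tau (p + p')%R p = p'.
  rewrite tau_move; first by rewrite addKv.
  by rewrite BDr pp'; case: Ep => _ ->.
rewrite (@tau_fix _ _ r); last by rewrite BDr !(BC r) pr p'r.
by rewrite (@tau_fix _ _ (w n)) // BC wn.
Qed.

Let fprod_const1 p p' r : ipair p r -> ipair p' r ->
  fprod lift p r (w n) = fprod lift p' r (w n).
Proof.
move=> I I'; have [-> //|ne_pp'] := eqVneq p p'.
have [Ep Er pr p_r [pw rw prw]] := ipair_ne I.
have [Ep' _ p'r p'_r [p'w _ p'rw]] := ipair_ne I'.
have [q [Vq pq /=]] : exists q, [/\ inV n q, B p q &
    all (fun u => ~~ B u q) [:: r; w n; (p + p')%R]].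
  have [Vp _ p0] := Ep; have [Vp' _ p'0] := Ep'; have [Vr _ r0] := Er.
  apply: separation => //.
    rewrite /= andbT; apply/and3P; split; apply/asboolP => //; first exact: inVw.
    exact: inVD.
  have off z : isE n z -> z != r -> z != w n -> z != (r + w n)%R ->
      forall b1 b2, z != (\sum_(u <- mask [:: b1; b2] [:: r; w n]) u)%R.
    move=> [_ _ z0] zr zw zrw [] []; rewrite /= ?big_cons big_nil ?addr0 //.
  apply/negP => /in_spanP[[|b1 [|b2 [|b3 []]]] // _].
  have -> : mask [:: b1; b2; b3] [:: r; w n; (p + p')%R] =
      mask [:: b1; b2] [:: r; w n] ++ (if b3 then [:: (p + p')%R] else [::]).
    by case: b1; case: b2; case: b3.
  rewrite big_cat /=; case: b3; rewrite ?big_cons big_nil addr0 => e.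
    by case/eqP: (off p' Ep' p'_r p'w p'rw b1 b2); rewrite -[LHS](addKv p) {1}e addvK.
  by case/eqP: (off p Ep p_r pw prw b1 b2).
rewrite andbT BDl => /and3P[/negbTE rq /negbTE wq ppq].
have p'q : B p' q by move: ppq; rewrite pq; case: (B p' q).
have Eq : isE n q.
  split=> //; first by rewrite -(B_w ng Vq) BC.
  by apply/eqP => q0; rewrite q0 B0r in pq.
have wp : B p (w n) = false by apply: wn.
have Iq : ipair q r.
  apply: ipairP => //; first (by rewrite BC); apply/eqP => e;
    by move: pq; rewrite e ?BDr ?pr ?wp.
by rewrite (fprod_move I Iq pq) (fprod_move I' Iq p'q).
Qed.

Let fprod_const p r p' r' : ipair p r -> ipair p' r' ->
  fprod lift p r (w n) = fprod lift p' r' (w n).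
Proof.
move=> I I'; have [Ep Er pr p_r [pw rw prw]] := ipair_ne I.
have [Ep' Er' p'r' p'_r' [p'w r'w p'r'w]] := ipair_ne I'.
case rr' : (B r r').
  have Ey : isE n (r + r')%R by apply: isED_B.
  have Iy := isotropic3_tau Ey I.
  have ry : tau (r + r')%R r = r'.
    rewrite tau_move; first by rewrite addKv.
    by rewrite BDr rr'; case: Er => _ ->.
  have wy : tau (r + r')%R (w n) = w n by rewrite tau_fix // BC wn.
  rewrite -(fprod_tau lift_inv lift_conj Ey I) ry wy.
  by rewrite ry wy in Iy; apply: fprod_const1.
have [e|ne_r] := eqVneq r' r; first by subst r'; apply: fprod_const1.
have [e|ne_rw] := eqVneq r' (r + w n)%R.
  have PP := fano_add_last p' r' (w n).
  have r'E : (r' + w n)%R = r by rewrite e addvK.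
  rewrite r'E in PP; have I2 := isotropic3_perm I' PP.
  by rewrite (fprod_perm lift_conj I' PP); apply: fprod_const1.
have Irr : ipair r' r by apply: ipairP; rewrite // BC.
rewrite (fprod_const1 I Irr) fprod_swap //; apply: fprod_const1 => //.
exact: ipair_swap.
Qed.

Let p0 : C := (x 1%N + x 2)%R.
Let r0 : C := (x 3 + x 4)%R.

Let ipair0 : ipair p0 r0.
Proof.
have g4 : 4 <= rank C by blia.
have coord v i : 1 <= i <= n -> B v (x i) = false -> v != w n.
  by move=> ni; apply: contraFN => /eqP->; rewrite BC B_xw; blia.
have Bp i : 1 <= i <= n -> B p0 (x i) = (i == 1%N) (+) (i == 2).
  by move=> ni; rewrite /p0 xxE; [rewrite !(eq_sym i)|blia..].
have Br i : 1 <= i <= n -> B r0 (x i) = (i == 3) (+) (i == 4).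
  by move=> ni; rewrite /r0 xxE; [rewrite !(eq_sym i)|blia..].
apply: ipairP; [by apply: isE_xx; blia|by apply: isE_xx; blia|..].
- by rewrite /r0 BDr !Bp //; blia.
- by apply/eqP => e; have := Bp 1%N; rewrite e Br //; blia.
- by apply: (coord _ 3); rewrite ?Bp //; blia.
- by apply: (coord _ 1%N); rewrite ?Br //; blia.
apply/eqP => e; have := Bp 5; rewrite e BDl Br ?(BC (w n)) ?B_xw //; blia.
Qed.

(** The transvection along the sum of all crosscaps is central; its lift is
    found as the product of the six other members of an isotropic space. *)
Let T := fprod lift p0 r0 (w n).

Let T_acts : acts_as T (w n).
Proof.
have [Ep Er pr p_r [pw rw prw]] := ipair_ne ipair0.
have [pp rr] : B p0 p0 = false /\ B r0 r0 = false by case: Ep Er => [_ ? _] [_ ? _].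
have [_ _ _ E] := ipair0.
have L v : v \in fano p0 r0 (w n) -> v != w n -> acts_as (lift v) v.
  by move=> vL vw; apply: lift_acts => //; apply: E.
have S : perm_eq (fano p0 r0 (w n))
    [:: p0; r0; p0 + r0 + w n; p0 + r0; r0 + w n; p0 + w n; w n]%R.
  by rewrite /fano; perm_list.
move=> u; rewrite /T /fprod (t_prod_perm lift_conj E _ S); last first.
  by move=> y z; apply: (fano_orth ipair0).
have [_ _ w0] := Ew.
have ne v : v != 0%R -> (v + w n)%R != w n.
  by move=> v0; apply: contraNneq v0 => e; rewrite -[v](addvK _ (w n)) e addvv.
have pr0 : (p0 + r0)%R != 0%R by rewrite addv_eq0.
have pr_w : (p0 + r0)%R != w n.
  by apply: contraNneq prw => <-; rewrite addrCA addvv addr0.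
have [_ _ np] := Ep; have [_ _ nr] := Er.
rewrite !big_cons big_nil mulg1 lift_w // mulg1 !actM.
rewrite !L ?inE ?eqxx ?orbT ?ne //.
have tf := @tau_fano _ p0 r0 (p0 + r0 + w n)%R u.
have e1 : (p0 + (p0 + r0 + w n) = r0 + w n)%R by rewrite -(addrA p0 r0) addKv.
have e2 : (r0 + (p0 + r0 + w n) = p0 + w n)%R.
  by rewrite (addrC p0 r0) -(addrA r0 p0) addKv.
have e3 : (p0 + r0 + (p0 + r0 + w n) = w n)%R by rewrite addKv.
rewrite e1 e2 e3 in tf; apply: tf;
  by apply: (fano_orth ipair0); rewrite !inE eqxx ?orbT.
Qed.

Let T_comm v : isE n v -> lift v * T = T * lift v.
Proof. by move=> Ev; apply: (fprod_central lift_inv lift_conj Ev ipair0). Qed.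

Let T_inv : T * T = 1.
Proof. exact: (fprod_invol lift_inv lift_conj ipair0). Qed.

Let lift' v : G := if v == w n then T else lift v.

Let lift'_conj u v : isE n u -> isE n v ->
  lift' u * lift' v * (lift' u)^-1 = lift' (tau u v).
Proof.
move=> Eu Ev; rewrite /lift'; have [->|uw] := eqVneq u (w n).
  rewrite tau_fix ?wn //; have [_|vw] := eqVneq v (w n); first by rewrite mulgK.
  by rewrite -T_comm // mulgK.
have uu : B u u = false by case: Eu.
have tw : tau u (w n) = w n by rewrite tau_fix // BC wn.
have [->|vw] := eqVneq v (w n); first by rewrite tw eqxx T_comm // mulgK.
case: eqVneq => [e|_]; last exact: lift_conj.
by case/eqP: vw; rewrite -(tauK uu v) e tw.
Qed.

(** With the lift of w put equal to T, the product over every isotropic space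
    through w becomes T T = 1. *)
Lemma trivker_even : trivker G n.
Proof.
apply: (@kernel1 lift').
- move=> u Eu; rewrite /lift'; case: eqP => _; [exact: T_inv|exact: lift_inv].
- exact: lift'_conj.
- move=> v Ev; rewrite /lift'; have [->|vw] := eqVneq v (w n); first exact: T_acts.
  exact: lift_acts.
- by move=> v vw; rewrite /lift' (negbTE vw).
move=> p r q I; case wL : (w n \in fano p r q); last first.
  have <- : fprod lift p r q = 1.
    apply: (@fprod_1 1%N) => //.
    by apply: move_off_even => //; rewrite wL.
  apply: eq_big_seq => v vL; rewrite /lift'; case: eqP => // e.
  by rewrite -e vL in wL.
have [p' [r' PP]] := fano_basis wL; have I' := isotropic3_perm I PP.
rewrite (fprod_perm lift'_conj I PP).
have [_ _ _ E] := I'.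
have S : perm_eq (fano p' r' (w n))
    (w n :: [:: p'; r'; p' + r'; p' + w n; r' + w n; p' + r' + w n]%R).
  by rewrite /fano; perm_list.
have o u v : u \in fano p' r' (w n) -> v \in fano p' r' (w n) -> B u v = false.
  exact: (fano_orth I').
have := fprod_const I' ipair0; rewrite -/T /fprod.
rewrite (t_prod_perm lift_conj E o S) (t_prod_perm lift'_conj E o S).
rewrite big_cons lift_w // mul1g => TE.
rewrite big_cons {1}/lift' eqxx -[RHS]T_inv; congr (_ * _); rewrite -[RHS]TE.
apply: eq_big_seq => v vs; rewrite /lift'; case: eqP => // e.
have [Ep Er _ p_r [pw rw prw]] := ipair_ne I'.
have [[_ _ p'0] [_ _ r'0]] := conj Ep Er.
have ne u : u != 0%R -> (u + w n)%R != w n.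
  by move=> u0; apply: contraNneq u0 => ue; rewrite -[u](addvK _ (w n)) ue addvv.
have pr_w : (p' + r')%R != w n.
  by apply: contraNneq prw => <-; rewrite addrCA addvv addr0.
have pr0 : (p' + r')%R != 0%R by rewrite addv_eq0.
move: vs; rewrite e !inE !(eq_sym (w n)) (negbTE pw) (negbTE rw) (negbTE pr_w).
by rewrite !(negbTE (ne _ _)).
Qed.

End Even.

End Complete.

(** * The generator b permutes the lifts *)

Section BeConj.
Local Open Scope group_scope.
Variables (C : cspace) (G : caction C) (m : nat).
Local Notation n := m.+1.
Local Notation x := (@core C).
Local Notation w := (@w C).
Local Notation quad := (@quad C).
Local Notation al := (@al C G).
Local Notation be := (@be C G).
Implicit Types (k h s : G) (p r q u v y : C) (i j : nat).
Hypothesis ng : n <= rank C.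
Hypothesis m4 : 4 <= m.
Hypothesis Pm : trivker G m.
Local Notation lift := (lift G m).

Let g4 : 4 <= rank C. Proof. by blia. Qed.
Let Hbe : Gen true n be. Proof. by apply: Gen_be; blia. Qed.
Let be_act u : act be u = tau quad u. Proof. exact: act_be. Qed.
Let Equad : isE n quad. Proof. by apply: isE_quad; blia. Qed.

Lemma isE_wx i : odd n -> 1 <= i <= n -> isE n (w n + x i)%R.
Proof.
move=> on ni; have wi : B (w n) (x i) by rewrite BC B_xw; blia.
split; first by apply: inVD; [apply: inVw|apply: inVx; blia].
  by rewrite !BDr !BDl B_ww // (BC (x i)) wi Bx ?on ?eqxx //; blia.
rewrite addv_eq0; apply/eqP => e.
have [j nj ji] : exists2 j, 1 <= j <= n & j != i.
  by case: (eqVneq i 1%N) => [->|i1]; [exists 2|exists 1%N]; blia.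
have: B (w n) (x j) by rewrite BC B_xw; blia.
by rewrite e Bx; blia.
Qed.

(** The family t is left arbitrary because the lifts have to be corrected by a
    central element when n = 7. *)
Section BeFamily.
Variable t : C -> G.
Hypothesis t_sym : forall s v, Gen false n s -> isE n v ->
  s * t v * s^-1 = t (act s v).
Hypothesis t_off : forall v i, isE n v -> 5 <= i <= n -> B v (x i) = false ->
  be * t v * be^-1 = t (tau quad v).
Hypothesis t_w : be * t (w n) * be^-1 = t (w n).

Definition be_ok v := be * t v * be^-1 = t (tau quad v).

Lemma be_ok_sym v : be_ok v -> be_ok (tau quad v).
Proof.
have [_ qq _] := Equad.
rewrite /be_ok tauK // => <-; rewrite be_inv // !mulgA be2 // mul1g.
by rewrite -mulgA be2 // mulg1.
Qed.

Lemma sym4_be s : Gen false 4 s -> s * be = be * s.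
Proof.
elim=> [|i k i4 _ IH|//]; first by rewrite mul1g mulg1.
by rewrite -mulgA IH mulgA al_be ?mulgA //; blia.
Qed.

Lemma sym4_quad s : Gen false 4 s -> act s quad = quad.
Proof.
elim=> [|i k i4 _ IH|//]; first by rewrite act1.
rewrite actM IH act_al; last by blia.
by rewrite tau_fix // BDr !quadE; blia.
Qed.

(** The permutations of the first four crosscaps commute with b. *)
Lemma be_ok_sym4 s v : Gen false 4 s -> isE n v -> be_ok v -> be_ok (act s v).
Proof.
move=> Hs Ev okv; have Hs' : Gen false n s by apply: GenW Hs => //; blia.
rewrite /be_ok -t_sym // -{1}(sym4_quad Hs) -(act_tau ng _ _ Hs').
have Et : isE n (tau quad v) by apply: isE_tau.
rewrite -(t_sym Hs' Et) -okv.
have c := sym4_be Hs; have c' : s^-1 * be^-1 = be^-1 * s^-1 by rewrite -!invgM c.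
by rewrite !mulgA -c -!mulgA c'.
Qed.

Lemma be_ok_reduce :
  (forall v, isE n v -> v != w n -> (forall i, 5 <= i <= n -> B v (x i)) -> be_ok v) ->
  forall v, isE n v -> be_ok v.
Proof.
move=> H v Ev; have [->|vw] := eqVneq v (w n).
  by rewrite /be_ok -be_act (act_w ng Hbe).
case: (pselect (exists2 i, 5 <= i <= n & B v (x i) = false)) => [[i ni vi]|none].
  exact: t_off ni vi.
apply: H => // i ni; apply/negP => /negP/negbTE vi; apply: none; by exists i.
Qed.

Lemma wS l : w l.+1 = (w l + x l.+1)%R.
Proof. by rewrite ?w_def big_nat_recr. Qed.

Lemma w4 : w 4 = quad.
Proof. by rewrite ?w_def quad_def; do 4![rewrite big_ltn //]; rewrite big_geq // addr0 !addrA. Qed.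

Lemma B_quad_full v : isE n v -> (forall i, 5 <= i <= n -> B v (x i)) ->
  B v quad = odd n.
Proof.
move=> [Vv vv _] full; have := B_w ng Vv; rewrite vv.
have: forall l, 4 <= l <= n -> B v (w l) = B v quad (+) odd l.
  elim=> [//|l IH] ln; have [->|l3] := eqVneq l 3; first by rewrite w4 addbF.
  by rewrite wS BDr full ?IH /= ?addbN ?addbT //; blia.
by move=> ->; [case: (B v quad); case: (odd n)|blia].
Qed.

(** For odd n only the sums of all crosscaps but one remain, and those are
    permuted by the symmetric group on the first four crosscaps. *)
Lemma be_ok_odd : odd n -> be_ok (w n + x 4)%R -> forall v, isE n v -> be_ok v.
Proof.
move=> on ok4; apply: be_ok_reduce => v Ev vw full.
have [Vv vv _] := Ev.
have Ew4 : isE n (w n + x 4)%R by apply: isE_wx => //; blia.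
have ok i : 1 <= i <= 4 -> be_ok (w n + x i)%R.
  move=> i4; have Hs : Gen false 4 (rot G i 3) by apply: Gen_rot; blia.
  have Hs' : Gen false n (rot G i 3) by apply: GenW Hs => //; blia.
  have := be_ok_sym4 Hs Ew4 ok4.
  by rewrite (actD ng _ _ Hs') (act_w ng Hs') act_rot.
have := B_quad_full Ev full; rewrite on quad_def !BDr => vq.
have wE j : 1 <= j <= rank C -> B (w n) (x j) = (j <= n).
  by move=> ?; rewrite BC B_xw.
have one i : 1 <= i <= 4 -> (forall j, 1 <= j <= 4 -> B v (x j) = (j != i)) -> be_ok v.
  move=> i4 vj; have -> : v = (w n + x i)%R; last exact: ok.
  apply: B_ext => j gj; rewrite BDl wE // Bx ?(eq_sym i) //; last by blia.
  have [j4|j4] := leqP j 4; first by rewrite vj; blia.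
  by have [jn|jn] := leqP j n; [rewrite full|rewrite Vv]; blia.
have three i : 1 <= i <= 4 -> (forall j, 1 <= j <= 4 -> B v (x j) = (j == i)) -> be_ok v.
  move=> i4 vj; have -> : v = tau quad (w n + x i)%R.
    have wq : B (w n) quad = false by rewrite BC; case: Equad => Vq qq _; rewrite B_w.
    rewrite tau_move; last by rewrite BDl wq BC quadE //; blia.
    apply: B_ext => j gj; rewrite BDl quadE // BDl wE // Bx ?(eq_sym i) //; last by blia.
    have [j4|j4] := leqP j 4; first by rewrite vj; blia.
    by have [jn|jn] := leqP j n; [rewrite full|rewrite Vv]; blia.
  exact/be_ok_sym/ok.
have four (f : nat -> bool) : f 1%N = B v (x 1%N) -> f 2 = B v (x 2) ->
    f 3 = B v (x 3) -> f 4 = B v (x 4) -> forall j, 1 <= j <= 4 -> B v (x j) = f j.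
  by move=> e1 e2 e3 e4 [|[|[|[|[|j]]]]].
move: vq; case e1: (B v (x 1%N)); case e2: (B v (x 2)); case e3: (B v (x 3));
  case e4: (B v (x 4)) => //= _.
- by apply: (@one 4) => //; apply: four; rewrite ?e1 ?e2 ?e3 ?e4.
- by apply: (@one 3) => //; apply: four; rewrite ?e1 ?e2 ?e3 ?e4.
- by apply: (@one 2) => //; apply: four; rewrite ?e1 ?e2 ?e3 ?e4.
- by apply: (@three 1%N) => //; apply: four; rewrite ?e1 ?e2 ?e3 ?e4.
- by apply: (@one 1%N) => //; apply: four; rewrite ?e1 ?e2 ?e3 ?e4.
- by apply: (@three 2) => //; apply: four; rewrite ?e1 ?e2 ?e3 ?e4.
- by apply: (@three 3) => //; apply: four; rewrite ?e1 ?e2 ?e3 ?e4.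
by apply: (@three 4) => //; apply: four; rewrite ?e1 ?e2 ?e3 ?e4.
Qed.

End BeFamily.

Let lift_wfix : be * lift (w n) * be^-1 = lift (w n).
Proof. by rewrite lift_w // mulg1 mulgV. Qed.

Local Notation be_okl := (be_ok lift).

Let okl_odd : odd n -> be_okl (w n + x 4)%R -> forall v, isE n v -> be_okl v.
Proof.
apply: be_ok_odd lift_wfix; first by move=> s v; apply: lift_sym.
by move=> v i; apply: be_lift.
Qed.

Let okl_reduce : (forall v, isE n v -> v != w n ->
    (forall i, 5 <= i <= n -> B v (x i)) -> be_okl v) ->
  forall v, isE n v -> be_okl v.
Proof.
apply: be_ok_reduce lift_wfix => v i; exact: be_lift.
Qed.

Lemma lift_braid_off i u v : 1 <= i <= n -> isE n u -> isE n v ->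
  B u (x i) = false -> B v (x i) = false -> B u v ->
  lift u * lift v * lift u = lift (u + v)%R.
Proof.
move=> ni Eu Ev ui vi uv.
have [Hu au] := lift_loc ng m4 Pm Eu ni ui; have [Hv av] := lift_loc ng m4 Pm Ev ni vi.
have [_ uu _] := Eu.
apply: (@lift_eq _ _ _ ng m4 Pm _ i) => //; first exact: isED_B.
  by apply: locM => //; apply: locM.
move=> z; rewrite !actM !au av tau_conj //.
by rewrite (@tau_move _ u v) 1?BC // addrC.
Qed.

(** The number of zeros among the first four coordinates is even. *)
Lemma two_zeros v i : B v quad = false -> 1 <= i <= 4 -> B v (x i) = false ->
  exists l l', [/\ 1 <= l <= 4, 1 <= l' <= 4,
    l != l' & B v (x l) = false /\ B v (x l') = false].
Proof.
have pick a b : B v (x a) = false -> B v (x b) = false ->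
    1 <= a <= 4 -> 1 <= b <= 4 -> a != b -> exists l l', [/\ 1 <= l <= 4,
    1 <= l' <= 4, l != l' & B v (x l) = false /\ B v (x l') = false].
  by move=> *; exists a, b.
rewrite quad_def !BDr => vq.
have p12 := pick 1%N 2; have p13 := pick 1%N 3; have p14 := pick 1%N 4.
have p23 := pick 2 3; have p24 := pick 2 4; have p34 := pick 3 4.
case: i => [|[|[|[|[|i]]]]] // _ vi; rewrite vi in vq p12 p13 p14 p23 p24 p34;
move: vq p12 p13 p14 p23 p24 p34;
by do 3![case: (B v _)] => //= _ *; auto.
Qed.

(** v = a + y with a = x_5 + x_s, where s is one of at least two crosscaps among the
    first four that v misses. Then b conjugates the lifts of a and of y correctly,
    and both braid products, before and after conjugation, take place off a common
    crosscap. *)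
Lemma be_ok_even : ~~ odd n -> forall v, isE n v -> be_okl v.
Proof.
move=> en; apply: okl_reduce => v Ev vw full.
have n6 : 6 <= n by move: m4 en; blia.
have vq : B v quad = false by rewrite B_quad_full // (negbTE en).
have [Vv vv _] := Ev.
have x5 j : 1 <= j <= n -> B (x 5) (x j) = (j == 5) by move=> nj; rewrite Bx; blia.
have [s [s' [s4 s4' ss' [vs vs']]]] : exists l l', [/\ 1 <= l <= 4, 1 <= l' <= 4,
    l != l' & B v (x l) = false /\ B v (x l') = false].
  have [i ni vi] := ex_zero ng Vv vw; apply: (two_zeros vq _ vi).
  apply: contraT => i4; have := full i; rewrite vi; blia.
pose a := (x 5 + x s)%R; pose y := (v + a)%R.
have aE j : 1 <= j <= n -> B a (x j) = (j == 5) (+) (j == s).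
  by move=> nj; rewrite BDl x5 // Bx ?(eq_sym s) //; blia.
have yE j : 1 <= j <= n -> B y (x j) = B v (x j) (+) ((j == 5) (+) (j == s)).
  by move=> nj; rewrite BDl aE.
have Ea : isE n a by apply: isE_xx; blia.
have va : B v a by rewrite BDr full ?vs //; blia.
have Ey : isE n y by apply: isED_B.
have ay : B a y by rewrite BDr (BC a v) va; case: Ea => _ ->.
have v6 : B v (x 6) by apply: full; blia.
have v5 : B v (x 5) by apply: full; blia.
have vE : v = (a + y)%R by rewrite addrC addvK.
have ns' : 1 <= s' <= n by blia.
have [ds ds'] : (s' == 5) = false /\ (s == 5) = false by split; blia.
have as' : B a (x s') = false by rewrite aE // ds eq_sym (negbTE ss').
have ys' : B y (x s') = false by rewrite BDl vs' as'.
have lv := lift_braid_off ns' Ea Ey as' ys' ay.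
have ns : 1 <= s <= n by blia.
have aq : B a quad by rewrite BC BDr !quadE; blia.
have yq : B y quad by rewrite BDl vq aq.
have oka : be_okl a by apply: (@be_lift _ _ _ ng m4 Pm _ 6) => //; rewrite aE; blia.
have oky : be_okl y by apply: (@be_lift _ _ _ ng m4 Pm _ 5) => //; rewrite ?yE ?v5 /= ?(eq_sym 5) ?ds'; blia.
rewrite /be_ok (tau_fix vq) {1}vE -lv.
have -> : be * (lift a * lift y * lift a) * be^-1 =
    (be * lift a * be^-1) * (be * lift y * be^-1) * (be * lift a * be^-1).
  by rewrite !mulgA !mulgVK.
rewrite oka oky (lift_braid_off ns) //.
- by congr (lift _); rewrite -tauD -vE tau_fix.
- exact: isE_tau.
- exact: isE_tau.
- by rewrite B_taul aq aE // quadE //; blia.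
- by rewrite B_taul yq yE // vs quadE //; blia.
by case: Equad => _ qq _; rewrite tau_iso.
Qed.

(** The only vector to be checked is the image of x_4 + x_5 under b, and there the
    claim is the braid relation between a_4 and b. *)
Lemma be_ok5 : m = 4 -> forall v, isE n v -> be_okl v.
Proof.
move=> m_4; apply: okl_odd; first by rewrite m_4.
have E45 : isE n (x 4 + x 5)%R by apply: isE_xx; blia.
have q45 : B quad (x 4 + x 5)%R by rewrite BDr !quadE; blia.
have e : (w n + x 4)%R = tau quad (x 4 + x 5)%R.
  rewrite tau_move 1?BC // m_4 wS w4.
  by rewrite addrC (addrC quad) addrA.
have a4 : al 4 * al 4 = 1 by apply: al2; blia.
rewrite e; apply: be_ok_sym; rewrite /be_ok.
have la : lift (x 4 + x 5)%R = al 4 by apply: lift_al => //; blia.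
have Ha : Gen false n (al 4) by apply: Gen_al; blia.
rewrite la be_inv // be_braid; last by blia.
rewrite -{1}(lift_quad ng m4 Pm) -[X in _ * X](al_inv G (i := 4)); last by blia.
rewrite lift_sym //; congr (lift _); rewrite act_al; last by blia.
by rewrite (tau_move q45) tau_move 1?BC // addrC.
Qed.

Lemma lift_fano i p r q : 1 <= i <= n -> isotropic3 n p r q ->
  (forall v, v \in fano p r q -> B v (x i) = false) ->
  lift (p + r + q)%R =
    \prod_(v <- [:: p; r; q; p + r; p + q; r + q]%R) lift v.
Proof.
move=> ni I Li; have [_ _ _ E] := I.
have := fprod_off ng m4 Pm ni I Li.
rewrite /fprod /fano -[[:: p; _; _; _; _; _; _]]/([:: p; r; q; p + r; p + q; r + q]%R ++ [:: p + r + q]%R).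
rewrite big_cat /= big_seq1 => e; apply: (@mulIg _ (lift (p + r + q)%R)).
by rewrite e; apply: lift_inv => //; apply: E; rewrite !inE eqxx ?orbT.
Qed.

(** The lift of the sum of all crosscaps but the fourth one is a product of six
    lifts on which the action of b is known. *)
Lemma be_ok_odd9 : 9 <= n -> odd n -> forall v, isE n v -> be_okl v.
Proof.
move=> n9 on; apply: okl_odd => //.
have [v vdef] : exists v, v = (w n + x 4)%R by eexists.
rewrite -vdef.
have [p pdef] : exists p, p = (x 1%N + x 2 + (x 5 + x 6))%R by eexists.
have [r rdef] : exists r, r = (x 7 + x 8)%R by eexists.
have [q qdef] : exists q, q = (v + p + r)%R by eexists.
have wE j : 1 <= j <= n -> B (w n) (x j) by move=> ?; rewrite BC B_xw; blia.
have xE i j : 1 <= i <= n -> 1 <= j <= n -> B (x i) (x j) = (i == j).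
  by move=> *; apply: Bx; blia.
have vE j : 1 <= j <= n -> B v (x j) = (j != 4).
  by move=> nj; rewrite vdef BDl wE // xE ?(eq_sym 4) //; blia.
have pE j : 1 <= j <= 9 -> B p (x j) = [|| j == 1%N, j == 2, j == 5 | j == 6].
  move=> j9; rewrite pdef !BDl !xE; [|blia..].
  by case: j j9 => [|[|[|[|[|[|[|[|[|[|j]]]]]]]]]].
have rE j : 1 <= j <= 9 -> B r (x j) = (j == 7) || (j == 8).
  move=> j9; rewrite rdef !BDl !xE; [|blia..].
  by case: j j9 => [|[|[|[|[|[|[|[|[|[|j]]]]]]]]]].
have n4 : n >= 4 by blia.
have E12 : isE n (x 1%N + x 2)%R by apply: isE_xx; blia.
have E56 : isE n (x 5 + x 6)%R by apply: isE_xx; blia.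
have Er : isE n r by rewrite rdef; apply: isE_xx; blia.
have o1 : B (x 1%N + x 2)%R (x 5 + x 6)%R = false.
  by rewrite BDr !BDl !xE //; blia.
have d1 : (x 1%N + x 2)%R != (x 5 + x 6)%R.
  have: B (x 1%N + x 2)%R (x 1%N) != B (x 5 + x 6)%R (x 1%N).
    by rewrite !BDl !xE //; blia.
  by apply: contra_neq => ->.
have Ep : isE n p by rewrite pdef; apply: isED.
have Ev : isE n v by rewrite vdef; apply: isE_wx; blia.
have [[Vp pp _] [Vr rr _] [Vv vv _]] := And3 Ep Er Ev.
have p4 : B p (x 4) = false by rewrite pE.
have r4 : B r (x 4) = false by rewrite rE.
have pv : B p v = false by rewrite vdef BDr p4 B_w // pp.
have rv : B r v = false by rewrite vdef BDr r4 B_w // rr.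
have pr : B p r = false by rewrite rdef BDr !pE.
have qE j : 1 <= j <= 9 -> B q (x j) = (j != 4) (+) B p (x j) (+) B r (x j).
  by move=> j9; rewrite qdef !BDl vE //; blia.
have pq : B p q = false by rewrite qdef !BDr pv pp pr.
have rq : B r q = false by rewrite qdef !BDr rv (BC r p) pr rr.
have ne u u' j : B u (x j) -> B u' (x j) = false -> u != u'.
  by move=> uj; apply: contraFN => /eqP <-.
have qE' j : 1 <= j <= 9 -> B q (x j) = (j == 3) || (j == 9).
  by move=> j9; rewrite qE // pE // rE //; case: j j9 => [|[|[|[|[|[|[|[|[|[|j]]]]]]]]]].
have prE j : 1 <= j <= 9 -> B (p + r)%R (x j) = B p (x j) || B r (x j).
  move=> j9; rewrite BDl pE // rE //.
  by case: j j9 => [|[|[|[|[|[|[|[|[|[|j]]]]]]]]]].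
have Epr : isE n (p + r)%R.
  by apply: isED => //; apply: (@ne _ _ 1%N); rewrite ?pE ?rE.
have vpq : (p + r + q)%R = v by rewrite qdef -(addrA v p r) (addrC v) addKv.
have Eq : isE n q.
  have -> : q = (v + (p + r))%R by rewrite qdef addrA.
  by apply: isED => //; apply: (@ne _ _ 3); rewrite ?vE ?prE ?pE ?rE; blia.
have Epq : isE n (p + q)%R.
  by apply: isED => //; apply: (@ne _ _ 1%N); rewrite ?pE ?qE'.
have Erq : isE n (r + q)%R.
  by apply: isED => //; apply: (@ne _ _ 7); rewrite ?rE ?qE'.
have I : isotropic3 n p r q.
  by split=> // u; rewrite !inE vpq => /or4P[| | |/or4P[]] /eqP->.
have q9 j : 5 <= j <= n -> B quad (x j) = false by move=> ?; rewrite quadE; blia.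
have pq' : B p quad = false by rewrite pdef BC !BDr !quadE //; blia.
have rq' : B r quad = false by rewrite rdef BC BDr !quadE //; blia.
have vq' : B v quad.
  by rewrite vdef BDl !(BC _ quad) B_w ?quad_even ?quadE //; case: Equad.
have qq' : B q quad by rewrite qdef !BDl pq' rq' vq'.
have L4 u : u \in fano p r q -> B u (x 4) = false.
  rewrite !inE vpq => /or4P[| | |/or4P[]] /eqP->;
  by rewrite ?BDl ?pE ?rE ?qE' ?vE //; blia.
have I3 := isotropic3_tau Equad I.
have L3 u : u \in fano (tau quad p) (tau quad r) (tau quad q) -> B u (x 3) = false.
  rewrite -fano_tau => /mapP[u' u'L ->]; rewrite B_taul quadE //; last by blia.
  move: u'L; rewrite !inE vpq => /or4P[| | |/or4P[]] /eqP->;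
  by rewrite ?BDl ?pq' ?rq' ?qq' ?vq' ?pE ?rE ?qE' ?vE //; blia.
rewrite /be_ok -vpq !tauD.
have n3 : 1 <= 3 <= n by blia.
have n44 : 1 <= 4 <= n by blia.
rewrite (lift_fano n44 I L4) (lift_fano n3 I3 L3).
rewrite -!tauD -[X in _ = \prod_(v <- X) _]/(map (tau quad) [:: p; r; q; p + r; p + q; r + q]%R).
rewrite big_map.
have okL u : u \in [:: p; r; q; p + r; p + q; r + q]%R -> be_okl u.
  have okj j u' : 5 <= j <= n -> isE n u' -> B u' (x j) = false -> be_okl u'.
    by move=> nj Eu' u'j; apply: be_lift nj u'j.
  rewrite !inE => /or3P[| |/or4P[]] /eqP->.
  - by apply: (@okj 7); rewrite ?pE //; blia.
  - by apply: (@okj 5); rewrite ?rE //; blia.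
  - by apply: (@okj 5); rewrite ?qE' //; blia.
  - by apply: (@okj 9); rewrite ?prE ?pE ?rE //; blia.
  - by apply: (@okj 7); rewrite ?BDl ?pE ?qE' //; blia.
  by apply: (@okj 5); rewrite ?BDl ?rE ?qE' //; blia.
elim: [:: p; r; q; p + r; p + q; r + q]%R okL => [|u s IH] okL.
  by rewrite !big_nil mulg1 mulgV.
rewrite !big_cons -IH => [|y ys]; last by apply: okL; rewrite inE ys orbT.
by rewrite -(okL u (mem_head _ _)) !mulgA mulgVK.
Qed.

End BeConj.

(** * Seven crosscaps *)

Section Seven.
Local Open Scope group_scope.
Variables (C : cspace) (G : caction C).
Local Notation x := (@core C).
Local Notation w := (@w C).
Local Notation quad := (@quad C).
Local Notation al := (@al C G).
Local Notation be := (@be C G).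
Implicit Types (k h s : G) (p r q u v y z : C) (i j : nat).
Hypothesis ng : 7 <= rank C.
Hypothesis P6 : trivker G 6.
Local Notation lift := (lift G 6).

Let m4 : 4 <= 6. Proof. by []. Qed.
Let g4 : 4 <= rank C. Proof. exact: leq_trans ng. Qed.
Let mg : 6 <= rank C. Proof. exact: leq_trans ng. Qed.

Let xE i j : 1 <= i <= 7 -> 1 <= j <= 7 -> B (x i) (x j) = (i == j).
Proof. by move=> i7 j7; rewrite Bx; blia. Qed.

Let Q a b c d : C := (x a + x b + x c + x d)%R.
Let X a b : C := (x a + x b)%R.

Let QE a b c d j : 1 <= a <= 7 -> 1 <= b <= 7 -> 1 <= c <= 7 -> 1 <= d <= 7 ->
  1 <= j <= 7 ->
  B (Q a b c d) (x j) = (a == j) (+) (b == j) (+) (c == j) (+) (d == j).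
Proof. by move=> *; rewrite !BDl !xE. Qed.

Let XE a b j : 1 <= a <= 7 -> 1 <= b <= 7 -> 1 <= j <= 7 ->
  B (X a b) (x j) = (a == j) (+) (b == j).
Proof. by move=> *; rewrite !BDl !xE. Qed.

Let EX a b : 1 <= a <= 7 -> 1 <= b <= 7 -> a != b -> isE 7 (X a b).
Proof. by move=> *; apply: isE_xx. Qed.

Let EQ a b c d : 1 <= a <= 7 -> 1 <= b <= 7 -> 1 <= c <= 7 -> 1 <= d <= 7 ->
  uniq [:: a; b; c; d] -> isE 7 (Q a b c d).
Proof.
move=> a7 b7 c7 d7; rewrite /= !inE !negb_or.
move=> /and4P[/and3P[ab ac ad] /andP[bc bd] cd _].
rewrite /Q -(addrA (x a + x b)%R); apply: isED; [exact: EX..|].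
apply/eqP => e; have := XE a7 b7 a7; rewrite [X a b]e -/(X c d) XE //.
by rewrite eqxx (eq_sym b) (negbTE ab) !(eq_sym _ a) (negbTE ac) (negbTE ad).
Qed.

(** The group off the crosscap i acts faithfully, hence identities between
    transvections hold for the lifts that it contains. *)
Let off_conj i u v : 1 <= i <= 7 -> isE 7 u -> isE 7 v ->
  B u (x i) = false -> B v (x i) = false ->
  lift u * lift v * lift u = lift (tau u v).
Proof.
move=> i7 Eu Ev ui vi.
have [Hu au] := lift_loc ng m4 P6 Eu i7 ui; have [Hv av] := lift_loc ng m4 P6 Ev i7 vi.
apply: (@lift_eq _ _ _ ng m4 P6 _ i) => //; first exact: isE_tau.
  by apply: locM => //; apply: locM.
by move=> y; rewrite !actM !au av tau_conj //; case: Eu.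
Qed.

Let off_comm i u v : 1 <= i <= 7 -> isE 7 u -> isE 7 v ->
  B u (x i) = false -> B v (x i) = false -> B u v = false ->
  lift u * lift v = lift v * lift u.
Proof.
move=> i7 Eu Ev ui vi uv; have e := off_conj i7 Eu Ev ui vi.
rewrite tau_fix 1?BC // in e; rewrite -{2}e -(mulgA _ (lift u) (lift u)).
by rewrite (@lift_inv _ _ _ ng m4 P6 u) // mulg1.
Qed.

Let lift2 u : isE 7 u -> lift u * lift u = 1.
Proof. by move=> Eu; apply: lift_inv. Qed.

Definition braid u v := lift u * lift v * lift u.

(** Two lifts whose supports cover all crosscaps still satisfy the braid
    relation, and their braid product is insensitive to exchanging two crosscaps
    between them. *)
Let braid_swap i j l p q z :
  1 <= i <= 7 -> 1 <= j <= 7 -> 1 <= l <= 7 ->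
  isE 7 p -> isE 7 q -> isE 7 z ->
  B p z -> B q z -> B p q -> 
  B q (x i) = false -> B z (x i) = false ->
  B p (x j) = false -> B q (x j) = B z (x j) ->
  B p (x l) = false -> B z (x l) = false ->
  braid p q = braid (q + z)%R (p + z)%R /\ braid q p = braid (q + z)%R (p + z)%R.
Proof.
move=> i7 j7 l7 Ep Eq Ez pz qz pq qi zi pj qj pl zl.
have Eqz : isE 7 (q + z)%R by apply: isED_B.
have Epz : isE 7 (p + z)%R by apply: isED_B.
have [[_ pp _] [_ qq _] [_ zz _]] := And3 Ep Eq Ez.
have e1 : lift (q + z)%R * lift z * lift (q + z)%R = lift q.
  rewrite (off_conj i7) // ?BDl ?qi ?zi //; congr lift.
  by rewrite tau_move ?BDr ?(BC z) ?qz ?zz // addrC addvK.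
have e2 : lift p * lift (q + z)%R = lift (q + z)%R * lift p.
  by apply: (off_comm j7); rewrite // ?BDl ?BDr ?qj ?pz ?pq ?addbb.
have e3 : lift p * lift z * lift p = lift (p + z)%R.
  by rewrite (off_conj l7) // tau_move 1?BC // addrC.
have e4 : lift z * lift p * lift z = lift (p + z)%R.
  by rewrite (off_conj l7) // tau_move.
rewrite /braid -e1; set Y := lift (q + z)%R in e2 *.
have Y2 : Y * Y = 1 by apply: lift2.
split.
  by rewrite -e3 !mulgA e2 -!mulgA -e2 !mulgA.
rewrite -e4 !mulgA -(mulgA _ Y (lift p)) -e2.
by rewrite !mulgA -(mulgA _ Y Y) Y2 mulg1.
Qed.

Let sw i j := if j == i then i.+1 else if j == i.+1 then i else j.

Let al_x i j : 1 <= i < 7 -> 1 <= j <= 7 -> act (al i) (x j) = x (sw i j).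
Proof.
move=> i7 j7; rewrite act_al /sw; last by blia.
have [->|ji] := eqVneq j i.
  by rewrite tau_move ?BDr ?xE ?addKv //; blia.
have [->|ji1] := eqVneq j i.+1.
  by rewrite tau_move ?BDr ?xE ?addrA ?(addrC _ (x i)) ?addvK //; blia.
by apply: tau_fix; rewrite BDr !xE; blia.
Qed.

Let Gal i : 1 <= i < 7 -> Gen false 7 (al i).
Proof. exact: Gen_al. Qed.

Let al_Q i a b c d : 1 <= i < 7 ->
  1 <= a <= 7 -> 1 <= b <= 7 -> 1 <= c <= 7 -> 1 <= d <= 7 ->
  act (al i) (Q a b c d) = Q (sw i a) (sw i b) (sw i c) (sw i d).
Proof. by move=> i7 *; rewrite /Q !(actD ng _ _ (Gal i7)) !al_x. Qed.

Let braid_conj s u v : Gen false 7 s -> isE 7 u -> isE 7 v ->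
  s * braid u v * s^-1 = braid (act s u) (act s v).
Proof.
move=> Hs Eu Ev; rewrite /braid -!(lift_sym ng m4 P6 Hs) //.
by rewrite !mulgA !mulgVK.
Qed.

(** In the Weyl group of type E_7 this is the reflection in the highest root. That
    root is orthogonal to the subsystem D_6 of a_1, ..., a_5 and b, whose element -1
    will be called W. *)
Let T : G := locked (braid (Q 1 2 3 7) (Q 4 5 6 7)).
Let TE : T = braid (Q 1 2 3 7) (Q 4 5 6 7). Proof. by rewrite /T -lock. Qed.

Let EP : isE 7 (Q 1 2 3 7). Proof. exact: EQ. Qed.
Let ER : isE 7 (Q 4 5 6 7). Proof. exact: EQ. Qed.

Ltac vsum := apply: vec_ext => ?; rewrite !BDl; bcase.
Ltac num := rewrite ?QE ?XE //.

Let BXQ u a b : B u (X a b) = B u (x a) (+) B u (x b).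
Proof. exact: BDr. Qed.
Let BQQ u a b c d : B u (Q a b c d) = B u (x a) (+) B u (x b) (+) B u (x c) (+) B u (x d).
Proof. by rewrite !BDr. Qed.

Let comm_of k h : k * h * k^-1 = h -> k * h = h * k.
Proof. by move=> e; rewrite -{2}e mulgVK. Qed.

Let T_al i : 1 <= i < 6 -> al i * T = T * al i.
Proof.
move=> i6; apply: comm_of; rewrite TE braid_conj //; last by apply: Gal; blia.
have [/eqP i3|i3] := boolP (i == 3).
  subst i; rewrite !al_Q //=.
  have e1 : (Q 1 2 3 7 + X 3 4)%R = Q (sw 3 1) (sw 3 2) (sw 3 3) (sw 3 7).
    by vsum.
  have e2 : (Q 4 5 6 7 + X 3 4)%R = Q (sw 3 4) (sw 3 5) (sw 3 6) (sw 3 7).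
    by vsum.
  have E1 : isE 7 (Q (sw 3 1) (sw 3 2) (sw 3 3) (sw 3 7)) by apply: EQ.
  have E2 : isE 7 (Q (sw 3 4) (sw 3 5) (sw 3 6) (sw 3 7)) by apply: EQ.
  have E34 : isE 7 (X 3 4) by apply: EX.
  case: (@braid_swap 5 4 1 _ _ _ isT isT isT E2 E1 E34) => [||||||||| _ ->];
    try by rewrite ?BXQ ?BQQ; num.
  by rewrite -e1 -e2 !addvK.
have -> : act (al i) (Q 1 2 3 7) = Q 1 2 3 7.
  rewrite al_Q //; last by blia.
  have : [|| i == 1%N, i == 2, i == 4 | i == 5] by blia.
  by case/or4P=> /eqP-> /=; vsum.
have -> // : act (al i) (Q 4 5 6 7) = Q 4 5 6 7.
rewrite al_Q //; last by blia.
have : [|| i == 1%N, i == 2, i == 4 | i == 5] by blia.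
by case/or4P=> /eqP-> /=; vsum.
Qed.

Let T_sym s : Gen false 6 s -> s * T * s^-1 = T.
Proof.
elim=> [|i k i6 _ IH|//]; first by rewrite mul1g invg1 mulg1.
by rewrite invgM !mulgA -(mulgA (al i)) -(mulgA (al i)) IH T_al // mulgK.
Qed.

(* The transposition of the crosscaps 3 and 5. *)
Let T_1257 : T = braid (Q 1 2 5 7) (Q 3 4 6 7).
Proof.
have H3 : Gen false 7 (al 3) by apply: Gal.
have H4 : Gen false 7 (al 4) by apply: Gal.
have H : Gen false 7 (al 3 * al 4 * al 3) by do 2!apply: GenM => //.
rewrite -[LHS](@T_sym (al 3 * al 4 * al 3)); last first.
  by apply: GenM; [apply: GenM|]; apply: Gen_al.
rewrite TE braid_conj // !actM !al_Q //= /sw /=.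
by congr braid; vsum.
Qed.

(* The transposition of the crosscaps 3 and 6. *)
Let T_1267 : T = braid (Q 3 4 5 7) (Q 1 2 6 7).
Proof.
pose s : G := al 5 * (al 4 * (al 3 * (al 4 * al 5))).
have Hs6 : Gen false 6 s by do 4![apply: GenM; first exact: Gen_al]; apply: Gen_al.
have Hs : Gen false 7 s by apply: GenW Hs6.
rewrite -[LHS](T_sym Hs6) TE braid_conj // /s !actM !al_Q //= /sw /=.
have E1 : isE 7 (Q 3 4 5 7) by apply: EQ.
have E2 : isE 7 (Q 1 2 6 7) by apply: EQ.
have E56 : isE 7 (X 5 6) by apply: EX.
case: (@braid_swap 3 6 1 _ _ _ isT isT isT E1 E2 E56) => [|||||||||-> <-];
  try by rewrite ?BXQ ?BQQ; num.
by congr braid; vsum.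
Qed.

Let quadQ : quad = Q 1 2 3 4. Proof. by []. Qed.
Let Equad : isE 7 quad. Proof. exact: EQ. Qed.

Let off_be i v : 5 <= i <= 7 -> isE 7 v -> B v (x i) = false ->
  be * lift v * be^-1 = lift (tau quad v).
Proof. by move=> i7 Ev vi; apply: (@be_lift _ _ _ ng m4 P6 _ i). Qed.

Let T_be : be * T = T * be.
Proof.
apply: comm_of; rewrite T_1257.
have E1 : isE 7 (Q 1 2 5 7) by apply: EQ.
have E2 : isE 7 (Q 3 4 6 7) by apply: EQ.
have -> : be * braid (Q 1 2 5 7) (Q 3 4 6 7) * be^-1 =
    be * lift (Q 1 2 5 7) * be^-1 * (be * lift (Q 3 4 6 7) * be^-1) *
    (be * lift (Q 1 2 5 7) * be^-1).
  by rewrite /braid !mulgA !mulgVK.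
rewrite (@off_be 6) //; last by num.
rewrite (@off_be 5) //; last by num.
rewrite !tau_fix //; by rewrite quadQ BQQ; num.
Qed.

Let T_comm k : Gen true 6 k -> k * T = T * k.
Proof.
elim=> [|i k' i6 _ IH|k' _ _ _ IH]; first by rewrite mul1g mulg1.
  by rewrite -mulgA IH mulgA T_al // mulgA.
by rewrite -mulgA IH mulgA T_be mulgA.
Qed.

Let w7 : w 7 = (w 6 + x 7)%R. Proof. exact: wS. Qed.
Let Ew6 : isE 7 (w 6).
Proof. by have [V6 e nz] := @isE_w C 6 mg isT isT; split=> //; apply: inVW V6. Qed.
Let w6x7 : B (w 6) (x 7) = false.
Proof. by rewrite BC B_xw; blia. Qed.

Let w6E : w 6 = (quad + X 5 6)%R.
Proof. by rewrite 2!wS w4 -addrA. Qed.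

Let lift_acts7 v : isE 7 v -> acts_as (lift v) v.
Proof.
move=> Ev; apply: lift_acts => //; apply/eqP => vw.
by case: Ev => _; rewrite vw B_ww.
Qed.

Let T_acts : acts_as T (w 6).
Proof.
move=> u; rewrite TE /braid !actM !lift_acts7 // tau_conj; last by case: EP.
have -> // : tau (Q 1 2 3 7) (Q 4 5 6 7) = w 6.
rewrite tau_move; last by rewrite BQQ; num.
by rewrite w6E quadQ; apply: vec_ext => y; rewrite !BDl; bcase.
Qed.

Let T2 : T * T = 1.
Proof.
rewrite TE /braid !mulgA -(mulgA _ (lift (Q 1 2 3 7)) (lift (Q 1 2 3 7))).
rewrite lift2 // mulg1 -(mulgA _ (lift (Q 4 5 6 7)) (lift (Q 4 5 6 7))).
by rewrite lift2 // mulg1 lift2.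
Qed.

Let W : G := lift (w 6).
Let HW : Gen true 6 W.
Proof. by have [] := lift_loc ng m4 P6 Ew6 (i := 7) isT w6x7; rewrite loc_last. Qed.

Let W_comm k : Gen true 6 k -> k * W = W * k.
Proof.
move=> Hk; apply: comm_of.
apply: (trivker_inj mg P6) => //; first by apply: GenM; [apply: GenM|apply: GenV].
have Hk7 : Gen true 7 k by apply: GenW Hk.
move=> u; rewrite (act_conj ng Hk7 (lift_acts7 Ew6)) lift_acts7 //.
by rewrite (act_w mg Hk).
Qed.

(** The quotient of two lifts of the same transvection: it will be the central
    element -1 of the Weyl group of type E_7. *)
Let Z : G := locked (T * W).
Let ZE : Z = T * W. Proof. by rewrite /Z -lock. Qed.

Let Z_act u : act Z u = u.
Proof. by rewrite ZE actM T_acts lift_acts7 // tauK //; case: Ew6. Qed.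

Let Z2 : Z * Z = 1.
Proof.
rewrite ZE !mulgA -(mulgA T) (T_comm HW) mulgA T2 mul1g.
exact: lift2.
Qed.

Let T_ZW : T = Z * W.
Proof. by rewrite ZE -mulgA lift2 // mulg1. Qed.

Let Z_comm6 k : Gen true 6 k -> k * Z = Z * k.
Proof. by move=> Hk; rewrite ZE mulgA T_comm // -!mulgA W_comm. Qed.

(* Conjugating by f moves a_6 to the braid product that r also conjugates T to;
   this makes r commute with f T. *)
Let f : G := locked (lift (Q 3 4 5 6) * lift (Q 1 2 5 6) * lift (X 5 6)).
Let fE : f = lift (Q 3 4 5 6) * lift (Q 1 2 5 6) * lift (X 5 6).
Proof. by rewrite /f -lock. Qed.

Let c6 u v : isE 7 u -> isE 7 v -> B u (x 7) = false -> B v (x 7) = false ->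
  B u v = false -> lift u * lift v = lift v * lift u.
Proof. exact: (@off_comm 7). Qed.

Let frev : f = lift (X 5 6) * lift (Q 1 2 5 6) * lift (Q 3 4 5 6).
Proof.
have E1 : isE 7 (Q 3 4 5 6) by apply: EQ.
have E2 : isE 7 (Q 1 2 5 6) by apply: EQ.
have E3 : isE 7 (X 5 6) by apply: EX.
have c12 := c6 E1 E2; have c13 := c6 E1 E3; have c23 := c6 E2 E3.
rewrite fE c12; [|num|num|by rewrite BQQ; num].
rewrite -mulgA c13; [|num|num|by rewrite BXQ; num].
by rewrite mulgA c23; [|num|num|by rewrite BXQ; num].
Qed.

Let f2 : f * f = 1.
Proof.
rewrite {1}frev fE !mulgA.
rewrite -(mulgA _ (lift (Q 3 4 5 6)) (lift (Q 3 4 5 6))) lift2; last exact: EQ.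
rewrite mulg1 -(mulgA _ (lift (Q 1 2 5 6)) (lift (Q 1 2 5 6))) lift2; last exact: EQ.
by rewrite mulg1 lift2 //; apply: EX.
Qed.

Let Hlift6 v : isE 7 v -> B v (x 7) = false -> Gen true 6 (lift v).
Proof. by move=> Ev v7; have [] := lift_loc ng m4 P6 Ev (i := 7) isT v7; rewrite loc_last. Qed.

Let Hf : Gen true 6 f.
Proof.
by rewrite fE; apply: GenM; [apply: GenM|]; apply: Hlift6; num; try exact: EQ; exact: EX.
Qed.

Let r : G := al 6.
Let rE : r = lift (X 6 7). Proof. by rewrite /r -(lift_al ng m4 P6). Qed.
Let r2 : r * r = 1. Proof. by apply: al2; blia. Qed.

Let frf : f * r * f = r * T * r.
Proof.
have E67 : isE 7 (X 6 7) by apply: EX.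
have E57 : isE 7 (X 5 7) by apply: EX.
have E56 : isE 7 (X 5 6) by apply: EX.
have E1256 : isE 7 (Q 1 2 5 6) by apply: EQ.
have E1267 : isE 7 (Q 1 2 6 7) by apply: EQ.
have E3457 : isE 7 (Q 3 4 5 7) by apply: EQ.
have s1 : lift (X 5 6) * r * lift (X 5 6) = lift (X 5 7).
  rewrite rE (@off_conj 1%N) //; [|by num..].
  rewrite tau_move; last by rewrite BXQ; num.
  by congr lift; vsum.
have s2 : lift (Q 1 2 5 6) * lift (X 5 7) * lift (Q 1 2 5 6) = lift (Q 1 2 6 7).
  rewrite (@off_conj 3) //; [|by num..].
  rewrite tau_move; last by rewrite BC BXQ; num.
  by congr lift; vsum.
have -> : f * r * f = braid (Q 3 4 5 6) (Q 1 2 6 7).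
  by rewrite {2}frev fE /braid -s2 -s1 !mulgA.
have Hr : Gen false 7 r by apply: Gal.
have rV : r^-1 = r by apply: al_inv; blia.
rewrite T_1267 -{2}rV braid_conj // !al_Q //= /sw /=.
by congr braid; vsum.
Qed.

Let r_comm : r * (f * T) = f * T * r.
Proof.
have TE' : T = r * f * r * f * r.
  have -> : r * f * r * f * r = r * (f * r * f) * r by rewrite !mulgA.
  by rewrite frf !mulgA r2 mul1g -mulgA r2 mulg1.
have cT := T_comm Hf.
by rewrite [in RHS]cT {1 2}TE' !mulgA.
Qed.

Let W_split : W = lift (X 1 2) * lift (X 3 4) * be * f.
Proof.
have E1 : isE 7 (Q 3 4 5 6) by apply: EQ.
have E2 : isE 7 (Q 1 2 5 6) by apply: EQ.
have E56 : isE 7 (X 5 6) by apply: EX.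
have E12 : isE 7 (X 1 2) by apply: EX.
have E34 : isE 7 (X 3 4) by apply: EX.
have e1 : (X 1 2 + X 3 4)%R = quad by rewrite /X addrA.
have e2 : (X 1 2 + X 5 6)%R = Q 1 2 5 6 by rewrite /X addrA.
have e3 : (X 3 4 + X 5 6)%R = Q 3 4 5 6 by rewrite /X addrA.
have e4 : (X 1 2 + X 3 4 + X 5 6)%R = w 6 by rewrite e1 w6E.
have I : isotropic3 7 (X 1 2) (X 3 4) (X 5 6).
  split; try by rewrite BXQ; num.
  move=> v; rewrite !inE e1 e2 e3 => /or4P[| | |/or4P[]] /eqP-> //.
  by rewrite -w6E.
rewrite /W -e4 (lift_fano ng m4 P6 (i := 7) isT I); last first.
  move=> v; rewrite !inE e1 e2 e3 -w6E => /or4P[| | |/or4P[]] /eqP-> //;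
    by rewrite ?quadQ; num.
rewrite !big_cons big_nil mulg1 e1 e2 e3 (lift_quad ng m4 P6) frev.
have c := c6 E56 Equad.
rewrite (lift_quad ng m4 P6) in c.
by rewrite !mulgA -(mulgA _ (lift (X 5 6)) be) c ?mulgA //; [num|rewrite quadE|rewrite quadQ BQQ; num].
Qed.

(* W is f times factors that commute with r = a_6, so that Z commutes with r
   because f T does. *)
Let Z_r : r * Z = Z * r.
Proof.
have E67 : isE 7 (X 6 7) by apply: EX.
have c12 : r * lift (X 1 2) = lift (X 1 2) * r.
  by rewrite rE; apply: (@off_comm 3); try exact: EX; try (by num); rewrite BXQ; num.
have c34 : r * lift (X 3 4) = lift (X 3 4) * r.
  by rewrite rE; apply: (@off_comm 1%N); try exact: EX; try (by num); rewrite BXQ; num.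
have cb : r * be = be * r by apply: al_be; blia.
rewrite ZE -(T_comm HW) W_split -!mulgA.
rewrite (mulgA r) c12 -!mulgA (mulgA r) c34 -!mulgA (mulgA r) cb.
by rewrite -!mulgA r_comm -!mulgA.
Qed.

Let Z_comm k : Gen true 7 k -> k * Z = Z * k.
Proof.
elim=> [|i k' i7 _ IH|k' _ _ _ IH]; first by rewrite mul1g mulg1.
  rewrite -mulgA IH !mulgA; congr (_ * _).
  have [->|i6] := eqVneq i 6; first exact: Z_r.
  by apply: Z_comm6; apply: Gen_al; blia.
by rewrite -mulgA IH !mulgA Z_comm6 //; apply: Gen_be.
Qed.

(** The lifts corrected by the central element along the sums of six crosscaps;
    these are the reflections of the Weyl group of type E_7. *)
Let six v := has (fun i => v == (w 7 + x i)%R) (iota 1 7).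
Let refl v : G := if six v then Z * lift v else lift v.

Let sixP v : six v -> exists2 i, 1 <= i <= 7 & v = (w 7 + x i)%R.
Proof. by move=> /hasP[i]; rewrite mem_iota => i7 /eqP; exists i. Qed.

Let six_wx i : 1 <= i <= 7 -> six (w 7 + x i)%R.
Proof. by move=> i7; apply/hasP; exists i; rewrite ?mem_iota. Qed.

Let wxE i j : 1 <= i <= 7 -> 1 <= j <= 7 -> B (w 7 + x i)%R (x j) = (i != j).
Proof. by move=> i7 j7; rewrite BDl xE // BC B_xw //; blia. Qed.

Let six_coord v a b : six v -> 1 <= a <= 7 -> 1 <= b <= 7 -> a != b ->
  B v (x a) = false -> B v (x b) = false -> False.
Proof.
by move=> /sixP[i i7 ->] a7 b7 ab; rewrite !wxE // => /negbFE/eqP e1 /negbFE/eqP e2; move: ab; rewrite -e1 -e2 eqxx.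
Qed.

Let six_act s v : Gen false 7 s -> six v -> six (act s v).
Proof.
move=> Hs /sixP[i i7 ->]; rewrite (actD ng _ _ Hs) (act_w ng Hs).
by have [j j7 ->] := sym_perm ng Hs i7; apply: six_wx.
Qed.

Let refl_sym s v : Gen false 7 s -> isE 7 v -> s * refl v * s^-1 = refl (act s v).
Proof.
move=> Hs Ev; rewrite /refl.
have -> : six (act s v) = six v.
  apply/idP/idP; last exact: six_act.
  by move=> /(six_act (GenV ng Hs)); rewrite actK.
have Hs' : Gen true 7 s by apply: GenW Hs.
by case: (six v); rewrite -(lift_sym ng m4 P6 Hs Ev) // !mulgA Z_comm.
Qed.

Let six_quad v i : six v -> 5 <= i <= 7 -> B v (x i) = false -> B v quad = false.
Proof.
move=> /sixP[j j7 ->] i7; rewrite wxE //; last by blia.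
move=> /negbFE/eqP ji; subst j; rewrite quadQ BQQ !wxE //; blia.
Qed.

Let refl_off v i : isE 7 v -> 5 <= i <= 7 -> B v (x i) = false ->
  be * refl v * be^-1 = refl (tau quad v).
Proof.
move=> Ev i7 vi.
have -> : refl (tau quad v) = (if six v then Z * lift (tau quad v) else lift (tau quad v)).
  rewrite /refl; case vq : (B v quad); last by rewrite tau_fix.
  case sv : (six v); first by rewrite (six_quad sv i7 vi) in vq.
  case st : (six (tau quad v)) => //.
  have ti : B (tau quad v) (x i) = false by rewrite B_taul vi quadE ?andbF //; blia.
  by have := six_quad st i7 ti; rewrite B_taul vq quad_even.
rewrite /refl; case: (six v); rewrite -(off_be i7 Ev vi) //.
by rewrite !mulgA (Z_comm (k := be)) //; apply: Gen_be.
Qed.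

Let refl_w : be * refl (w 7) * be^-1 = refl (w 7).
Proof.
rewrite /refl lift_w //; case: (six _); last by rewrite mulg1 mulgV.
by rewrite mulg1 Z_comm ?mulgK //; apply: Gen_be.
Qed.

(* The correction by Z along the sums of six crosscaps comes from here: b carries
   the lift of x_4 + x_5 + x_6 + x_7 to a conjugate of T rather than of W. *)
Let be_4567 : be * lift (Q 4 5 6 7) * be = Z * lift (w 7 + x 4)%R.
Proof.
have [s sE] : exists s : G, s = al 4 * (al 5 * al 6) by eexists.
have Hs : Gen false 7 s by rewrite sE; apply: GenM; [|apply: GenM]; apply: Gal.
have e1 : s * T * s^-1 = be * lift (Q 4 5 6 7) * be.
  rewrite TE braid_conj // sE !actM !al_Q //= /sw /= -quadQ /braid.
  by rewrite (lift_quad ng m4 P6); congr (_ * lift _ * _); vsum.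
have e2 : s * W * s^-1 = lift (w 7 + x 4)%R.
  rewrite /W (lift_sym ng m4 P6 Hs) //; congr lift.
  have -> : w 6 = (w 7 + x 7)%R by rewrite w7 addvK.
  by rewrite (actD ng _ _ Hs) (act_w ng Hs) sE !actM !al_x.
have Hs' : Gen true 7 s by apply: GenW Hs.
by rewrite -e1 -e2 T_ZW !mulgA (Z_comm Hs').
Qed.

Let refl_be v : isE 7 v -> be * refl v * be^-1 = refl (tau quad v).
Proof.
apply: (@be_ok_odd C G 6 ng m4 refl refl_sym refl_off refl_w isT).
have quad47 : tau quad (w 7 + x 4)%R = Q 4 5 6 7.
  rewrite tau_move; last by rewrite quadQ BQQ !wxE.
  by rewrite w7 w6E quadQ; vsum.
rewrite /be_ok quad47 /refl six_wx //.
have -> : six (Q 4 5 6 7) = false.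
  by apply/negP => /six_coord s4; apply: (s4 1%N 2); num.
have b2 : be * be = 1 :> G by apply: be2.
by rewrite -be_4567 be_inv // !mulgA b2 mul1g -mulgA b2 mulg1.
Qed.

Let refl_lift v : refl v = lift v \/ refl v = Z * lift v.
Proof. by rewrite /refl; case: (six v); [right|left]. Qed.

Let refl_conj u v : isE 7 u -> isE 7 v ->
  refl u * refl v * (refl u)^-1 = refl (tau u v).
Proof.
move=> Eu Ev.
have Hu : Gen true 7 (lift u) by apply: lift_Gen.
have HZ : Gen true 7 Z.
  rewrite ZE; apply: GenM; last by apply: GenW HW.
  by rewrite TE; apply: GenM; [apply: GenM|]; apply: lift_Gen.
rewrite (Gen_equiv ng _ refl_sym refl_be) //.
  by case: (refl_lift u) => ->; rewrite ?actM ?Z_act lift_acts7.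
by case: (refl_lift u) => -> //; apply: GenM.
Qed.

Let refl_inv u : isE 7 u -> refl u * refl u = 1.
Proof.
move=> Eu; have Hu : Gen true 7 (lift u) by apply: lift_Gen.
case: (refl_lift u) => ->; first exact: lift2.
by rewrite mulgA -(mulgA Z) Z_comm // mulgA Z2 mul1g lift2.
Qed.

Let refl_fprod p q r' : isotropic3 7 p q r' -> fprod refl p q r' = 1 \/ fprod refl p q r' = Z.
Proof.
move=> I; have [i i7 wL] := move_off_odd ng isT isT I.
have [y Ey Ly] := move_off ng i7 I wL.
rewrite -(fprod_tau refl_inv refl_conj Ey I).
have Iy := isotropic3_tau Ey I.
have := fprod_off ng m4 P6 i7 Iy; rewrite -fano_tau => e.
have {}e : fprod lift (tau y p) (tau y q) (tau y r') = 1.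
  by apply: e => v /mapP[u uL ->]; apply: Ly.
have [_ _ _ E] := Iy.
suff : fprod refl (tau y p) (tau y q) (tau y r') =
    fprod lift (tau y p) (tau y q) (tau y r') \/
  fprod refl (tau y p) (tau y q) (tau y r') =
    Z * fprod lift (tau y p) (tau y q) (tau y r').
  by rewrite e mulg1.
rewrite /fprod; elim: (fano _ _ _) E => [|v L IH] E; first by rewrite !big_nil; left.
have Hv : Gen true 7 (lift v) by apply: lift_Gen => //; apply/E/mem_head.
rewrite !big_cons; case: IH => [u uL|->|->]; first by apply: E; rewrite inE uL orbT.
  by case: (refl_lift v) => ->; [left|right; rewrite mulgA].
case: (refl_lift v) => ->; first by right; rewrite mulgA Z_comm // -mulgA.
by left; rewrite mulgA -(mulgA Z) Z_comm // mulgA Z2 mul1g.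
Qed.

(** The Coxeter relations alone leave a central ambiguity of order at most two:
    they present the Weyl group of type E_7 and not its quotient by -1. *)
Lemma kernel7 : exists Z0 : G, forall k, Gen true 7 k -> (forall u, act k u = u) ->
  k = 1 \/ k = Z0.
Proof.
exists Z => k Hk kid.
apply: (@kernel C G 6 ng refl Z refl_inv refl_conj _ _ _ Z2 _ Z_act _ refl_fprod k P6 Hk kid).
- move=> v Ev; case: (refl_lift v) => -> u; rewrite ?actM ?Z_act; exact: lift_acts7.
- move=> i i7; rewrite /refl.
  suff -> : six (x i + x i.+1)%R = false by apply: lift_al.
  apply/negP => /six_coord s2.
  have [a [b [a7 b7 ab /andP[ai bi]]]] : exists a b, [/\ 1 <= a <= 7, 1 <= b <= 7, a != b &
      [&& a != i, a != i.+1, b != i & b != i.+1]].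
    case: (ltnP i 3) => i3; first by exists 4, 5; split; blia.
    by exists 1%N, 2; split; blia.
  by apply: (s2 a b) => //; rewrite (@XE i i.+1) //; blia.
- move=> _; rewrite /refl (lift_quad ng m4 P6).
  suff -> : six quad = false by [].
  by apply/negP => /six_coord s2; apply: (s2 5 6); rewrite // quadQ; num.
- by move=> k' Hk'; rewrite Z_comm.
move=> v Ev v7; have Hv := Hlift6 Ev v7.
by case: (refl_lift v) => ->; [left|right; rewrite mulgA Z2 mul1g].
Qed.

End Seven.

(** * Computation in an orthonormal frame *)

Section Frame.
Local Open Scope ring_scope.
Variable C : cspace.
Implicit Types (u v y z : C) (ys : seq C) (s m : bitseq).

Fixpoint orthonormal ys : bool :=
  if ys is y :: ys' then [&& B y y, all (fun z => ~~ B y z) ys' & orthonormal ys']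
  else true.

(** The vector whose coordinates in the frame ys are the bits of s. *)
Definition emb ys s : C := \sum_(u <- mask s ys) u.

Fixpoint dotb s m : bool :=
  match s, m with a :: s', b :: m' => (a && b) (+) dotb s' m' | _, _ => false end.

Fixpoint addl s m : bitseq :=
  match s, m with a :: s', b :: m' => (a (+) b) :: addl s' m' | _, _ => [::] end.

(** The transvection along the coordinate vector m, in coordinates. *)
Definition taub m s : bitseq := if dotb s m then addl s m else s.

Lemma size_addl s m : size s = size m -> size (addl s m) = size s.
Proof. by elim: s m => [|a s IH] [|b m] //= [/IH->]. Qed.

Lemma size_taub s m : size s = size m -> size (taub m s) = size s.
Proof. by rewrite /taub; case: ifP => // _; apply: size_addl. Qed.

Lemma emb_cons y ys a s : emb (y :: ys) (a :: s) = (if a then y else 0) + emb ys s.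
Proof. by rewrite /emb; case: a; rewrite ?big_cons ?add0r. Qed.

Lemma emb_add ys s m : size s = size ys -> size m = size ys ->
  emb ys (addl s m) = emb ys s + emb ys m.
Proof.
elim: ys s m => [|y ys IH] [|a s] [|b m] //=; first by rewrite /emb !big_nil addr0.
move=> [ss] [sm]; rewrite !emb_cons IH // addrACA; congr (_ + _).
by case: a; case: b; rewrite /= ?addvv ?addr0 ?add0r.
Qed.

Lemma B_emb0 u ys s : all (fun y => ~~ B u y) ys -> B u (emb ys s) = false.
Proof.
elim: ys s => [|y ys IH] [|a s]; rewrite ?/emb ?big_nil ?B0r //=.
move=> /andP[/negbTE uy uys]; rewrite -/(emb (y :: ys) (a :: s)) emb_cons BDr IH //.
by case: a; rewrite ?B0r ?uy.
Qed.

Lemma B_emb ys s m : orthonormal ys -> size s = size ys -> size m = size ys ->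
  B (emb ys s) (emb ys m) = dotb s m.
Proof.
elim: ys s m => [|y ys IH] [|a s] [|b m] //=; first by rewrite /emb !big_nil B0l.
move=> /and3P[yy yys oys] [ss] [sm]; rewrite !emb_cons !BDl !BDr IH //.
have e s' c : B (if c then y else 0) (emb ys s') = false.
  by case: c; rewrite ?B0l // B_emb0.
have e' s' c : B (emb ys s') (if c then y else 0) = false by rewrite BC e.
rewrite e e' /= addbF; congr (_ (+) _).
by case: a; case: b; rewrite ?B0l ?B0r ?yy.
Qed.

(** f acts on the frame as F does on coordinates, and fixes its orthogonal. *)
Definition simulates ys (f : C -> C) (F : bitseq -> bitseq) :=
  forall u s, all (fun y => ~~ B u y) ys -> size s = size ys ->
    size (F s) = size ys /\ f (u + emb ys s) = u + emb ys (F s).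

Lemma sim_tau ys m f v : orthonormal ys -> size m = size ys -> v = emb ys m ->
  (forall u, f u = tau v u) -> simulates ys f (taub m).
Proof.
move=> oys sm -> fE u s uys ss; split; first by rewrite size_taub ?ss ?sm.
rewrite fE /tau /taub BDl B_emb0 //= B_emb //.
by case: (dotb s m); rewrite // emb_add // addrA.
Qed.

Lemma sim_comp ys f F h H : simulates ys f F -> simulates ys h H ->
  simulates ys (fun u => f (h u)) (fun s => F (H s)).
Proof.
move=> sf sh u s uys ss; have [sH ->] := sh u s uys ss.
exact: sf.
Qed.

Lemma sim_iter ys f F n : simulates ys f F -> simulates ys (iter n f) (iter n F).
Proof. by move=> sf; elim: n => [//|n IH]; apply: (sim_comp sf IH). Qed.

Lemma sim_eq ys f F h H : orthonormal ys ->
  simulates ys f F -> simulates ys h H ->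
  (forall s, size s = size ys -> F s = H s) -> forall u, f u = h u.
Proof.
move=> oys sf sh FH u.
pose s := [seq B u y | y <- ys].
have ss : size s = size ys by rewrite size_map.
have uys : all (fun y => ~~ B (u + emb ys s) y) ys.
  suff: forall y, y \in ys -> B (emb ys s) y = B u y.
    by move=> e; apply/allP => y ys_y; rewrite BDl e // addbb.
  rewrite /s; elim: ys oys {sf sh FH s ss} => [//|z ys IH] /= /and3P[zz zys oys] y.
  rewrite emb_cons BDl inE.
  have e : B (if B u z then z else 0) y = B u z && B z y by case: (B u z); rewrite ?B0l.
  rewrite e; have [-> _|yz /= ys_y] := eqVneq y z.
    by rewrite zz andbT (BC (emb _ _) z) B_emb0 // addbF.
  by rewrite IH // (negbTE (allP zys y ys_y)) andbF.
rewrite -[u](addvK _ (emb ys s)).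
by have [_ ->] := sf _ s uys ss; have [_ ->] := sh _ s uys ss; rewrite FH.
Qed.

Fixpoint bitseqs n : seq bitseq :=
  if n is n'.+1 then map (cons false) (bitseqs n') ++ map (cons true) (bitseqs n')
  else [:: [::]].

Lemma mem_bitseqs s : s \in bitseqs (size s).
Proof.
elim: s => [//|a s IH] /=; rewrite mem_cat; apply/orP.
by case: a; [right|left]; apply: map_f.
Qed.

(** Identities between words in transvections are decided on coordinates. *)
Lemma sim_check ys f F h H : orthonormal ys ->
  simulates ys f F -> simulates ys h H ->
  all (fun s => F s == H s) (bitseqs (size ys)) -> forall u, f u = h u.
Proof.
move=> oys sf sh /allP FH; apply: (sim_eq oys sf sh) => s ss.
by apply/eqP/FH; rewrite -ss mem_bitseqs.
Qed.

Lemma sim_id ys : simulates ys id id.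
Proof. by []. Qed.

Lemma orthonormal_core a n : (1 <= a)%N -> (a + n <= (rank C).+1)%N ->
  orthonormal [seq core i | i <- iota a n].
Proof.
elim: n a => [//|n IH] a a1 an /=; apply/and3P; split.
- by rewrite Bx; lia.
- by apply/allP => z /mapP[i]; rewrite mem_iota => ai ->; rewrite Bx; lia.
by apply: IH; lia.
Qed.

End Frame.

(** Coxeter elements of the subgroups of type E_6 and E_7. Their orders modulo the
    centre are 12 and 9. *)
Section CoxeterWords.
Local Open Scope group_scope.
Variables (C : cspace) (G : caction C).

Definition cox6 : G := al 2 * al 3 * al 4 * al 5 * al 6 * be.
Definition cox7 : G := al 1%N * al 2 * al 3 * al 4 * al 5 * al 6 * be.

Lemma act_exp (k : G) n u : act (k ^+ n) u = iter n (act k) u.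
Proof. by elim: n => [|n IH]; rewrite ?act1 // expgS actM IH. Qed.

Lemma cox_act : 7 <= rank C ->
  (forall u, act (cox6 ^+ 12) u = u) /\ (forall u, act (cox7 ^+ 9) u = u).
Proof.
move=> g7; pose ys : seq C := [seq core i | i <- iota 1 7].
have oys : orthonormal ys by apply: orthonormal_core; lia.
pose e i : bitseq := nseq i.-1 false ++ [:: true; true] ++ nseq (6 - i) false.
have sa i : 1 <= i <= 6 -> simulates ys (act (al i : G)) (taub (e i)).
  move=> i6; apply: (@sim_tau _ _ _ _ (core i + core i.+1)%R) => //.
  - by rewrite /e !size_cat !size_nseq /=; lia.
  - rewrite /ys; case: i i6 => [|[|[|[|[|[|[|]]]]]]] // _;
    by rewrite /emb /= !big_cons big_nil addr0.
  by move=> u; rewrite act_al //; lia.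
have sb : simulates ys (act (be : G)) (taub [:: true; true; true; true; false; false; false]).
  apply: (@sim_tau _ _ _ _ quad) => //.
    by rewrite /emb /= !big_cons big_nil addr0 /quad !addrA.
  by move=> u; rewrite act_be //; lia.
have sM k F h H : simulates ys (act (k : G)) F -> simulates ys (act (h : G)) H ->
    simulates ys (act (k * h)) (fun s => F (H s)).
  move=> sk sh u s us ss; rewrite actM; exact: (sim_comp sk sh).
have sX k F n : simulates ys (act (k : G)) F -> simulates ys (act (k ^+ n)) (iter n F).
  by move=> sk u s us ss; rewrite act_exp; apply: (@sim_iter _ _ _ _ n sk u s us ss).
have s6 := sM _ _ _ _ (sM _ _ _ _ (sM _ _ _ _ (sM _ _ _ _ (sM _ _ _ _
  (sa 2 isT) (sa 3 isT)) (sa 4 isT)) (sa 5 isT)) (sa 6 isT)) sb.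
have s7 := sM _ _ _ _ (sM _ _ _ _ (sM _ _ _ _ (sM _ _ _ _ (sM _ _ _ _ (sM _ _ _ _
  (sa 1%N isT) (sa 2 isT)) (sa 3 isT)) (sa 4 isT)) (sa 5 isT)) (sa 6 isT)) sb.
split.
  by apply: (sim_check oys (sX _ _ 12 s6) (@sim_id _ ys)); vm_compute.
by apply: (sim_check oys (sX _ _ 9 s7) (@sim_id _ ys)); vm_compute.
Qed.

End CoxeterWords.

(** * Faithfulness *)

Section Faithful.
Local Open Scope group_scope.
Variable C : cspace.

Lemma trivker_small (G : caction C) n : n <= 6 -> n <= rank C -> trivker G n.
Proof.
move=> n6 ng; have [n4|n5] := leqP n 4; first exact: trivker4.
have t4 : trivker G 4 by apply: trivker4; lia.
have g5 : 5 <= rank C by lia.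
have t5 : trivker G 5.
  by apply: trivker_odd => //; move=> v Ev; apply: be_ok5.
have [->//|n6'] : n = 5 \/ n = 6 by lia.
subst n; apply: trivker_even => //; move=> v Ev; exact: be_ok_even.
Qed.

Variable G : caction C.

(* Recording the parity of the length of a word in an additional factor of order
   two leads to another group with the same Coxeter relations. *)
Let sgroup : groupType := (G * 'I_2)%type.
Let sgn : 'I_2 := Ordinal (isT : 1 < 2).
Let sact (k : sgroup) (u : C) : C := act k.1 u.

Let sgn2 : sgn * sgn = 1. Proof. exact/eqP. Qed.

Let spair (a b : G) (e e' : 'I_2) : a = b -> e = e' -> (a, e) = (b, e') :> sgroup.
Proof. by move=> -> ->. Qed.

Definition signed : caction C.
Proof.
apply: (@CAction C sgroup sact (fun i => (al i, sgn)) (be, sgn)).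
- by move=> k h u; rewrite /sact actM.
- by move=> u; rewrite /sact act1.
- by move=> i u; apply: act_al.
- by move=> u; apply: act_be.
- by move=> i ig; apply: spair; [apply: al2|].
- by move=> g4; apply: spair; [apply: be2|].
- by move=> i j i1 ij; apply: spair; [apply: al_comm|].
- by move=> i i1 ig; apply: spair; [apply: al_braid|].
- by move=> i g4 ig i4; apply: spair; [apply: al_be|].
by move=> g5; apply: spair; [apply: be_braid|].
Defined.

Let signed_Gen n k : Gen true n k -> exists e : 'I_2, Gen true n ((k, e) : signed).
Proof.
elim=> [|i k' ni _ [e IH]|k' _ n4 _ [e IH]].
- by exists 1; apply: Gen1.
- by exists (sgn * e); apply: (@Gen_alM C signed true n i (k', e)).
by exists (sgn * e); apply: (@Gen_beM C signed true n (k', e)).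
Qed.

Let sexp (k : G) (e : 'I_2) n : ((k, e) : signed) ^+ n = (k ^+ n, e ^+ n) :> signed.
Proof. by elim: n => [//|n IH]; rewrite !expgS IH. Qed.

(** Both sides of the relation act trivially, so that in the group with signs they
    belong to {1, Z0}. The side of odd length is not 1, hence it is Z0; then the
    side of even length is not Z0, hence it is 1. Since both sides agree in G, the
    image of Z0 in G is 1. *)
Lemma trivker7 : 7 <= rank C -> cox6 G ^+ 12 = cox7 G ^+ 9 -> trivker G 7.
Proof.
move=> g7 rel; have mg : 6 <= rank C by apply: leq_trans g7.
have [Z0 ker] := @kernel7 C signed g7 (@trivker_small signed 6 isT mg).
have [a6 a7] := cox_act signed g7.
have HX n (k : signed) : Gen true 7 k -> Gen true 7 (k ^+ n).
  by move=> Hk; elim: n => [|n IH]; rewrite ?expgS; [apply: Gen1|apply: GenM].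
have H6 : Gen true 7 (cox6 signed).
  by do 5![apply: GenM; last (by apply: Gen_al) || (by apply: Gen_be)]; apply: Gen_al.
have H7 : Gen true 7 (cox7 signed).
  by do 6![apply: GenM; last (by apply: Gen_al) || (by apply: Gen_be)]; apply: Gen_al.
have e6 : cox6 signed = (cox6 G, 1) by apply: spair => //; apply/eqP.
have e7 : cox7 signed = (cox7 G, sgn) by apply: spair => //; apply/eqP.
have s9 : sgn ^+ 9 = sgn by apply/eqP.
have c7Z : cox7 signed ^+ 9 = Z0.
  by case: (ker _ (HX 9 _ H7) a7).
have c6 : cox6 signed ^+ 12 = 1.
  case: (ker _ (HX 12 _ H6) a6) => // e; have := congr1 snd e.
  by rewrite -c7Z e6 e7 !sexp /= s9 expg1n => /eqP.
have c7 : cox7 G ^+ 9 = 1 by rewrite -rel; move: c6; rewrite e6 sexp => /(congr1 fst).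
move=> k Hk kid; have [e He] := signed_Gen Hk.
case: (ker _ He kid) => [/(congr1 fst)//|]; rewrite -c7Z e7 sexp => /(congr1 fst) /= ->.
exact: c7.
Qed.

(** Seven crosscaps are the only case in which the Coxeter relations do not
    suffice. *)
Theorem faithful : (7 <= rank C -> cox6 G ^+ 12 = cox7 G ^+ 9) ->
  forall n, n <= rank C -> trivker G n.
Proof.
move=> rel; elim=> [|m IH] mg; first exact: trivker_small.
have [m6|m7] := ltnP m 6; first exact: trivker_small.
have [m_6|m_6] := eqVneq m 6.
  by subst m; apply: trivker7 (rel mg).
have Pm := IH (ltnW mg); have m4 : 4 <= m by lia.
have [on|en] := boolP (odd m.+1).
  by apply: trivker_odd => // v Ev; apply: be_ok_odd9 => //; lia.
by apply: trivker_even => // v Ev; apply: be_ok_even.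
Qed.

End Faithful.

(** * The isometry group of the crosscap basis *)

Lemma F2_cases (a : 'F_2) : a = 0%R \/ a = 1%R.
Proof. by case: a => -[|[|//]] i; [left|right]; apply: val_inj. Qed.

Section FormSpace.
Local Open Scope ring_scope.
Variables (g : nat) (V : vectType 'F_2) (dot : {biscalar V}) (x : nat -> V).
Hypothesis hx : is_crosscap_basis dot g x.

Definition pair (u v : V) : bool := dot u v == 1.

Lemma dotE u v : dot u v = (pair u v)%:R.
Proof. by rewrite /pair; case: (F2_cases (dot u v)) => ->. Qed.

Let pairDl u v z : pair (u + v) z = pair u z (+) pair v z.
Proof.
rewrite /pair linearDl.
by case: (F2_cases (dot u z)) => ->; case: (F2_cases (dot v z)) => ->.
Qed.

Let expand u : exists c : nat -> 'F_2, u = \sum_(1 <= i < g.+1) c i *: x i.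
Proof.
have [bx _] := hx; set s := [seq x i | i <- iota 1 g] in bx.
have ss : size s = g by rewrite size_map size_iota.
pose c i := if insub i.-1 is Some j then coord (in_tuple s) (j : 'I_(size s)) u else 0.
exists c; transitivity (\sum_(1 <= i < (size s).+1) c i *: x i); last by rewrite ss.
rewrite big_add1 /= big_mkord [LHS](coord_basis (X := in_tuple s) bx (memvf u)).
apply: eq_bigr => i _; rewrite /c /= valK; congr (_ *: _).
by rewrite (nth_map 0%N) ?size_iota ?nth_iota ?add1n //; rewrite -ss.
Qed.

Let dot_expand c j : (1 <= j <= g)%N ->
  dot (\sum_(1 <= i < g.+1) c i *: x i) (x j) = c j.
Proof.
move=> gj; have [_ dx] := hx.
rewrite linear_sumlz (bigD1_seq j) ?iota_uniq ?mem_index_iota //=.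
rewrite big_seq_cond big1 => [|i /andP[]].
  by rewrite addr0 linearZl_LR dx // eqxx /= mulr1.
rewrite mem_index_iota => gi ij; rewrite linearZl_LR dx ?(negbTE ij) /= ?mulr0 //.
Qed.

Let dot_expandr c j : (1 <= j <= g)%N ->
  dot (x j) (\sum_(1 <= i < g.+1) c i *: x i) = c j.
Proof.
move=> gj; have [_ dx] := hx.
rewrite linear_sumr (bigD1_seq j) ?iota_uniq ?mem_index_iota //=.
rewrite big_seq_cond big1 => [|i /andP[]].
  by rewrite addr0 linearZr_LR dx // eqxx /= mulr1.
rewrite mem_index_iota => gi ij; rewrite linearZr_LR dx 1?eq_sym ?(negbTE ij) /= ?mulr0 //.
Qed.

Let pairC u v : pair u v = pair v u.
Proof.
rewrite /pair; congr (_ == _).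
have [c ->] := expand u; have [d ->] := expand v.
rewrite linear_sumlz linear_sumr; apply: eq_big_nat => i gi.
by rewrite linearZl_LR linearZr_LR dot_expandr // dot_expand.
Qed.

Let pair_x i j : (1 <= i <= g)%N -> (1 <= j <= g)%N -> pair (x i) (x j) = (i == j).
Proof. by move=> gi gj; rewrite /pair (proj2 hx) //; case: (i == j). Qed.

Let pair_ext u v : (forall i, (1 <= i <= g)%N -> pair u (x i) = pair v (x i)) -> u = v.
Proof.
have [c ->] := expand u; have [d ->] := expand v => cd.
apply: eq_big_nat => i gi; congr (_ *: _).
by have := dotE (\sum_(1 <= i < g.+1) c i *: x i) (x i); rewrite cd // -dotE !dot_expand.
Qed.

Definition form_space : cspace :=
  @CSpace V pair g x pairC pairDl pair_x pair_ext.

Local Notation C := form_space.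

Definition tauf (v : V) : V -> V := @tau C v.

Let tauf_linear v : linear (tauf v).
Proof.
move=> a u u'; rewrite /tauf (@tauD C); congr (_ + _).
case: (F2_cases a) => ->; last by rewrite !scale1r.
by rewrite !scale0r (@tau_fix C) // (@B0l C).
Qed.

HB.instance Definition _ v :=
  GRing.isLinear.Build 'F_2 V V _ (tauf v) (tauf_linear v).

Lemma tauf_form_aut v : pair v v = false -> is_form_aut dot (linfun (tauf v)).
Proof.
move=> vv; apply/asboolP; split.
  by exists (tauf v) => u; rewrite lfunE; apply: (@tauK C).
move=> u u'; rewrite !lfunE !dotE.
exact: (congr1 (fun b : bool => b%:R) (@tau_iso C v vv u u')).
Qed.

(** Along an odd vector this map is not an isometry, and the value is 1 by
    default. *)
Definition transvection (v : V) : form_aut dot :=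
  insubd (1%g : form_aut dot) (linfun (tauf v)).

Lemma transvectionE v u : pair v v = false -> transvection v u = @tau C v u.
Proof.
by move=> vv; rewrite /transvection insubdK ?lfunE //; apply: tauf_form_aut.
Qed.

Lemma form_autP (f h : form_aut dot) : (forall u, f u = h u) -> f = h.
Proof. by move=> fh; apply/val_inj/lfunP. Qed.

Lemma form_autM (f h : form_aut dot) u : (f * h)%g u = f (h u).
Proof. by rewrite /= lfunE. Qed.

Lemma form_aut1 u : (1%g : form_aut dot) u = u.
Proof. by rewrite /= lfunE. Qed.

Lemma form_aut_iso (f : form_aut dot) u v : pair (f u) (f v) = pair u v.
Proof. by rewrite /pair; case: f => f /= /asboolP[_ ->]. Qed.

End FormSpace.

Section Isometries.
Variables (g : nat) (V : vectType 'F_2) (dot : {biscalar V}%R) (x : nat -> V).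
Hypothesis hx : is_crosscap_basis dot g x.
Local Notation C := (form_space hx).
Local Notation tv := (@transvection g V dot x hx).
Local Notation isom := (form_aut dot).
Local Open Scope group_scope.

Lemma tv_act v : @B C v v = false -> forall u, tv v u = @tau C v u.
Proof. by move=> vv u; apply: transvectionE. Qed.

Lemma tv_sq v : @B C v v = false -> tv v * tv v = 1.
Proof.
move=> vv; apply: form_autP => u.
by rewrite form_autM form_aut1 !tv_act // tauK.
Qed.

Lemma tv_comm u v : @B C u u = false -> @B C v v = false -> @B C u v = false ->
  tv u * tv v = tv v * tv u.
Proof.
move=> uu vv uv; apply: form_autP => z; rewrite !form_autM !tv_act //.
apply: (@vec_ext C) => y; rewrite !(@B_taul C) (@BC C v u) uv !andbF !addbF.
by move: (@B C z u) (@B C z v) (@B C u y) (@B C v y) (@B C z y); do 5!case.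
Qed.

Lemma tv_braid u v : @B C u u = false -> @B C v v = false -> @B C u v ->
  tv u * tv v * tv u = tv (u + v)%R.
Proof.
move=> uu vv uv; apply: form_autP => z; rewrite !form_autM !tv_act //; last first.
  by rewrite (@BDl C) !(@BDr C) uu vv uv (@BC C v u) uv.
rewrite (@tau_conj C) // (@tau_move C u v) 1?(@BC C v) //.
by rewrite addrC.
Qed.

Let gg : g = rank C. Proof. by []. Qed.
Let xx_ev i j : 1 <= i <= g -> 1 <= j <= g -> @B C (x i + x j)%R (x i + x j)%R = false.
Proof. exact: (@xx_even C). Qed.
Let quad_ev : 4 <= g -> @B C (@quad C) (@quad C) = false.
Proof. exact: (@quad_even C). Qed.

Definition isom_a i : isom := tv (x i + x i.+1)%R.
Definition isom_b : isom := tv (@quad C).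

(** Since the isometry group satisfies the same axioms as the presented group, the
    results on transvections and on the two Coxeter elements apply to it. *)
Definition isom_action : caction C.
Proof.
apply: (@CAction C isom (fun f u => f u) isom_a isom_b).
- exact: form_autM.
- exact: form_aut1.
- by move=> i u gi; apply: tv_act; apply: xx_ev; blia.
- by move=> u g4; apply/tv_act/quad_ev.
- by move=> i gi; apply: tv_sq; apply: xx_ev; blia.
- by move=> g4; apply/tv_sq/quad_ev.
- move=> i j i1 ij; apply: tv_comm; try by apply: xx_ev; blia.
  by rewrite (@BDl C) !(@BDr C) !(@Bx C); blia.
- move=> i i1 gi.
  have [e1 e2] : @B C (x i + x i.+1)%R (x i + x i.+1)%R = false /\
      @B C (x i.+1 + x i.+2)%R (x i.+1 + x i.+2)%R = false.
    by split; apply: xx_ev; blia.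
  have e : @B C (x i + x i.+1)%R (x i.+1 + x i.+2)%R.
    by rewrite (@BDl C) !(@BDr C) !(@Bx C); blia.
  by rewrite /isom_a !tv_braid // 1?(@BC C) // addrC.
- move=> i g4 gi i4; apply: tv_comm; [by apply: xx_ev; blia|exact: quad_ev|].
  by rewrite (@BC C) (@BDr C) !(@quadE C) //; blia.
move=> g5; have g4 : 4 <= g by apply: ltnW.
have e : @B C (@quad C) (x 4 + x 5)%R by rewrite (@BDr C) !(@quadE C) //; blia.
have e1 := quad_ev g4; have e2 : @B C (x 4 + x 5)%R (x 4 + x 5)%R = false.
  by apply: xx_ev; blia.
by rewrite /isom_a /isom_b !tv_braid // 1?(@BC C) // addrC.
Defined.

Local Notation I := isom_action.

Lemma isom_iso (f : isom) u v : @B C (f u) (f v) = @B C u v.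
Proof. exact: form_aut_iso. Qed.

(** Let y be the image of x_(m+1). The transvection along y + x_(m+1) does it when y
    is orthogonal to x_(m+1). Otherwise one goes through y + z with z even,
    not orthogonal to x_(m+1) and orthogonal to y + x_(m+1). Such a z exists
    unless y or x_(m+1) is the sum of all crosscaps, which forces m = 0 and
    y = x_(m+1). *)
Lemma transport m (f : isom) : m < g ->
  (forall i, m.+1 < i <= g -> f (x i) = x i) ->
  exists2 k : I, Gen true m.+1 k & k (x m.+1) = f (x m.+1).
Proof.
move=> mg ff; set n := m.+1; set y := f (x n).
have ng : n <= rank C by [].
have n1 : 1 <= n <= rank C by [].
have Vf u : @inV C n u -> @inV C n (f u).
  by move=> Vu i ni; rewrite -[X in @B C _ X](ff i ni) isom_iso Vu.
have Vx : @inV C n (x n) by apply: (@inVx C); rewrite ?leqnn.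
have Vy : @inV C n y by apply: Vf.
have xx : @B C (x n) (x n) by rewrite (@Bx C) ?eqxx.
have yy : @B C y y by rewrite isom_iso.
have [->|ne_yx] := eqVneq y (x n); first by exists 1%g; [apply: Gen1|apply: form_aut1].
have Vsum := inVD Vy Vx.
have s0 : (y + x n)%R != 0%R :> V by rewrite (@addv_eq0 C).
have sx : @B C (y + x n)%R (y + x n)%R = false.
  by rewrite (@BDl C) !(@BDr C) xx yy (@BC C y); case: (@B C (x n) y).
case yx : (@B C y (x n)); last first.
  have Es : @isE C n (y + x n)%R by split.
  have [k Hk ak] := realize I ng Es; exists k => //.
  rewrite [LHS]ak (@tau_move C); first by rewrite (addrC y) (@addKv C).
  by rewrite (@BDr C) xx (@BC C (x n)) yx.
have ex : @B C (y + x n)%R (x n) = false by rewrite (@BDl C) xx yx.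
pose ww : C := w n.
have not_span : ~~ @in_span C [:: (y + x n)%R; ww] (x n).
  have xw : @B C (x n) ww by rewrite (@B_w C).
  have x0 : (x n : V) != 0%R by apply/eqP => x0; move: xx; rewrite x0 (@B0l C).
  apply/negP; rewrite /= (negbTE x0) !(@addv_eq0 C).
  have yw : y != ww.
    apply/eqP => yw; have [m0|m0] := posnP m.
      case/eqP: ne_yx; rewrite yw /ww /n m0 /w big_ltn // big_geq // addr0 //.
    have g1 : 1 <= 1 <= rank C by rewrite -gg; blia.
    have V1 : @inV C n (f (x 1%N)) by apply: Vf; apply: (@inVx C).
    have w1 : @B C (f (x 1%N)) ww by rewrite (@B_w C n _ ng V1) isom_iso (@Bx C).
    have: @B C (f (x 1%N)) y = false by rewrite isom_iso (@Bx C) /n; blia.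
    by rewrite yw w1.
  case/orP=> [/eqP xww|].
    have m0 : m = 0.
      apply/eqP; rewrite -leqn0 leqNgt; apply/negP => m0.
      have: @B C (x n) (x 1%N) by rewrite xww (@BC C) (@B_xw C); blia.
      by rewrite (@Bx C) /n; blia.
    case/eqP: ne_yx; apply: (@B_ext C) => j gj.
    have [jn|jn] := leqP j n; last by rewrite Vy ?Vx //; blia.
    have -> : j = n by blia.
    by rewrite yx xx.
  case/orP=> /eqP e.
    by move: ex; rewrite -e xx.
  have: y = ww by rewrite -e addrCA (@addvv C) addr0.
  by move/eqP; rewrite (negbTE yw).
have [|z [Vz xz /=]] := separation ng Vx _ not_span.
  rewrite /= andbT; apply/andP; split; apply/asboolP => //; exact: (@inVw C).
rewrite andbT => /andP[/negbTE sz0 /negbTE wz0].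
have [sz wz] : @B C (y + x n)%R z = false /\ @B C ww z = false by [].
have zz : @B C z z = false by rewrite -(@B_w C n z) // (@BC C).
have Ez : @isE C n z.
  by split=> //; apply/eqP => z0; move: xz; rewrite z0 (@B0r C).
have zs : @B C z (y + x n)%R = false by rewrite (@BC C).
have Es : @isE C n (y + x n)%R by split.
have Ezs : @isE C n (z + (y + x n))%R.
  by apply: isED => //; apply/eqP => e; move: xz; rewrite e (@BC C) ex.
have [k1 H1 a1] := realize I ng Ez; have [k2 H2 a2] := realize I ng Ezs.
exists (k1 * k2); first exact: GenM.
rewrite form_autM [k2 _]a2 [k1 _]a1 (@tau_move C _ (x n)); last first.
  by rewrite (@BDr C) xz (@BC C (x n)) ex.
rewrite (@tau_move C); last first.
  by rewrite (@BDl C) xz (@BDl C) zz sz.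
apply: (@vec_ext C) => u; rewrite !(@BDl C).
by move: (@B C (x n) u) (@B C z u) (@B C y u); do 3!case.
Qed.

(** Composing with the inverse of the element given by [transport] makes f fix one
    more crosscap. *)
Lemma isom_Gen m (f : isom) : m <= g -> (forall i, m < i <= g -> f (x i) = x i) ->
  Gen true m (f : I).
Proof.
elim: m f => [|m IH] f mg ff.
  suff -> : f = 1 by apply: Gen1.
  apply: form_autP => u; rewrite form_aut1; apply: (@B_ext C) => i gi.
  by rewrite -[X in @B C _ X](ff i gi) isom_iso.
have [k Hk kx] := transport mg ff.
have Hk' : Gen true m (k^-1 * f : I).
  apply: IH => [|i mi]; first exact: ltnW.
  rewrite form_autM; have [->|im] := eqVneq i m.+1.
    by rewrite -kx -form_autM mulVg form_aut1.
  rewrite ff; last by blia.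
  have nn : m.+1 <= rank C by [].
  have mi' : m.+1 < i <= rank C by rewrite -gg; blia.
  by have := act_fix nn (GenV nn Hk) mi'.
rewrite -[f](mulVKg k); apply: GenM => //.
by apply: GenW Hk'.
Qed.

Lemma isom_Gen_all (f : isom) : Gen true g (f : I).
Proof. by apply: isom_Gen => // i; blia. Qed.

Lemma is_a_isom i : 1 <= i <= g - 1 -> is_a g x i (isom_a i).
Proof.
move=> gi; have ig : 1 <= i < rank C by rewrite -gg; blia.
have E u : isom_a i u = @tau C (x i + x i.+1)%R u by apply: (@act_al C I).
split; rewrite ?E.
- rewrite (@tau_move C); first by rewrite (@addKv C).
  by rewrite (@BDr C) !(@Bx C) -?gg; blia.
- rewrite (@tau_move C); first by rewrite addrCA (@addvv C) addr0.
  by rewrite (@BDr C) !(@Bx C) -?gg; blia.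
move=> k gk ki ki1; rewrite E (@tau_fix C) //.
by rewrite (@BDr C) !(@Bx C) -?gg; blia.
Qed.

Lemma is_b_isom : 4 <= g -> is_b g x isom_b.
Proof.
move=> g4; have E u : isom_b u = @tau C (@quad C) u by apply: (@act_be C I).
have q i : 1 <= i <= g -> @B C (x i) (@quad C) = (i <= 4).
  by move=> gi; rewrite (@BC C) (@quadE C).
split; rewrite ?E; try (rewrite (@tau_move C); last by rewrite q //; blia).
- by rewrite /quad !(addrA (x 1%N)) (@addvv C) add0r.
- by apply: (@vec_ext C) => u; rewrite !(@BDl C); bcase.
- by apply: (@vec_ext C) => u; rewrite !(@BDl C); bcase.
- by apply: (@vec_ext C) => u; rewrite !(@BDl C); bcase.
by move=> k gk; rewrite E (@tau_fix C) // q; blia.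
Qed.

End Isometries.

(** * The group presented by generators and relations *)

(** The quotient is taken of the words themselves rather than of the free group: free
    reduction is part of the normal closure. *)
Section WordGroup.
Variables (T : Type) (R : word T -> word T -> Prop).
Local Open Scope word_scope.
Implicit Types u v z : word T.
Local Notation N := (normal_closure R).

Lemma winvK u : (u^-1)^-1 = u.
Proof.
rewrite /winv map_rev revK -map_comp -[RHS]map_id; apply: eq_map => -[y e] /=.
by rewrite negbK.
Qed.

Lemma winvM u v : (u * v)^-1 = v^-1 * u^-1.
Proof. by rewrite /winv /wmul map_cat rev_cat. Qed.

Lemma wmulA u v z : u * (v * z) = u * v * z.
Proof. by rewrite /wmul catA. Qed.

Lemma free_eq_cat a b u v : free_eq u v -> free_eq (a * u * b) (a * v * b).
Proof.
elim=> [z|z z' _ IH|z1 z2 z3 _ IH1 _ IH2|z1 z2 y e].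
- exact: free_eq_refl.
- exact: free_eq_sym.
- exact: free_eq_trans IH1 IH2.
rewrite /wmul -!catA /= (catA a) (catA a z1 (z2 ++ b)).
exact: free_eq_cancel.
Qed.

Lemma free_eq_mulV a u b : free_eq (a * u * u^-1 * b) (a * b).
Proof.
elim: u a b => [|[y e] u IH] a b.
  by rewrite /wmul /winv /= !cats0; apply: free_eq_refl.
have -> : a * ((y, e) :: u) * ((y, e) :: u)^-1 * b =
    (a * [:: (y, e)]) * u * u^-1 * ([:: (y, ~~ e)] * b).
  by rewrite /wmul /winv /= rev_cons -cats1 -!catA.
apply: free_eq_trans (IH _ _) _.
by rewrite /wmul -!catA /=; apply: free_eq_cancel.
Qed.

Lemma free_eq_mulV1 u v : free_eq (u * v * v^-1) u.
Proof.
by have := free_eq_mulV u v [::]; rewrite /wmul !cats0.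
Qed.

Definition weq u v : bool := `[< N (u * v^-1) >].

Lemma weqP u v : reflect (N (u * v^-1)) (weq u v).
Proof. exact: asboolP. Qed.

Lemma weq_refl : reflexive (weq : rel {classic word T}).
Proof.
move=> u; apply/weqP; apply: nclosure_free (@nclosure1 T R).
by apply: free_eq_sym; apply: (free_eq_mulV1 [::]).
Qed.

Lemma weq_sym : symmetric (weq : rel {classic word T}).
Proof.
suff s u v : weq u v -> weq v u by move=> u v; apply/idP/idP; apply: s.
by move=> /weqP/nclosureV; rewrite winvM winvK => ?; apply/weqP.
Qed.

Lemma weq_trans : transitive (weq : rel {classic word T}).
Proof.
move=> v u z /weqP uv /weqP vz; apply/weqP.
apply: nclosure_free (nclosureM uv vz).
rewrite !wmulA -[X in _ * X * _](winvK v); exact: free_eq_mulV (z^-1).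
Qed.

Let weqc : rel {classic word T} := weq.
Definition weq_equiv : equiv_rel {classic word T} :=
  EquivRel weqc weq_refl weq_sym weq_trans.
Definition wgroup := {eq_quot weq_equiv}%qT.

HB.instance Definition _ := Choice.on wgroup.
HB.instance Definition _ := EqQuotient.on wgroup.

Definition cls (u : word T) : wgroup := (\pi_wgroup (u : {classic word T}))%qT.

Lemma clsP u v : cls u = cls v <-> N (u * v^-1).
Proof.
split=> [/eqmodP/= /weqP//|uv].
by apply/eqmodP/weqP.
Qed.

Lemma cls_repr (y : wgroup) : cls (repr y) = y.
Proof. exact: reprK. Qed.

Lemma cls_free u v : free_eq u v -> cls u = cls v.
Proof.
move=> uv; apply/clsP; apply: nclosure_free (@nclosure1 T R); apply: free_eq_sym.
have := free_eq_cat [::] v^-1 uv => /free_eq_trans; apply.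
exact: (free_eq_mulV1 [::]).
Qed.

Lemma cls_mul u u' v v' : cls u = cls u' -> cls v = cls v' -> cls (u * v) = cls (u' * v').
Proof.
move=> /clsP uu' /clsP vv'; apply/clsP.
apply: nclosure_free (nclosureM (nclosureJ u vv') uu').
rewrite winvM !wmulA.
have := free_eq_mulV (u * v * v'^-1) u^-1 u'^-1.
by rewrite winvK.
Qed.

Lemma cls_inv u v : cls u = cls v -> cls u^-1 = cls v^-1.
Proof.
move=> uv; have e : cls (u^-1 * u) = cls (u^-1 * v) by apply: cls_mul.
have e1 : cls (u^-1 * u * v^-1) = cls (u^-1 * v * v^-1) by apply: cls_mul.
have e2 : cls (u^-1 * v * v^-1) = cls u^-1 by apply/cls_free/free_eq_mulV1.
rewrite -e2 -e1; apply: cls_free.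
by have := free_eq_mulV [::] u^-1 v^-1; rewrite winvK.
Qed.

Definition gmul (a b : wgroup) : wgroup := cls (repr a * repr b).
Definition ginv (a : wgroup) : wgroup := cls (repr a)^-1.

Lemma gmulE u v : gmul (cls u) (cls v) = cls (u * v).
Proof. by apply: cls_mul; apply: cls_repr. Qed.

Lemma ginvE u : ginv (cls u) = cls u^-1.
Proof. by apply: cls_inv; apply: cls_repr. Qed.

Lemma gmulA : associative gmul.
Proof.
by move=> a b c; rewrite -(cls_repr a) -(cls_repr b) -(cls_repr c) !gmulE wmulA.
Qed.
Lemma gmul1 : left_id (cls 1) gmul.
Proof. by move=> a; rewrite -(cls_repr a) gmulE. Qed.
Lemma gmulr1 : right_id (cls 1) gmul.
Proof. by move=> a; rewrite -(cls_repr a) gmulE /wmul cats0. Qed.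
Lemma gmulrV : right_inverse (cls 1) ginv gmul.
Proof.
move=> a; rewrite -(cls_repr a) ginvE gmulE; apply: cls_free.
exact: (free_eq_mulV1 [::]).
Qed.
Lemma gmulV : left_inverse (cls 1) ginv gmul.
Proof.
move=> a; rewrite -(cls_repr a) ginvE gmulE; apply: cls_free.
by have := free_eq_mulV1 [::] (repr a)^-1; rewrite winvK.
Qed.

HB.instance Definition _ := isGroup.Build wgroup gmulA gmul1 gmulr1 gmulV gmulrV.

Lemma clsM u v : cls (u * v) = (cls u * cls v)%g.
Proof. by rewrite -gmulE. Qed.

Lemma cls_relation u v : R u v -> cls u = cls v.
Proof. by move=> uv; apply/clsP; apply: nclosure_rel. Qed.

Lemma cls_eval u : cls u = eval_word (fun y => cls (letter y)) u.
Proof.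
elim: u => [|[y e] u IH]; rewrite /eval_word ?big_nil //.
rewrite big_cons -[(y, e) :: u]/([:: (y, e)] * u)%W clsM IH; congr (_ * _)%g.
by rewrite /eval_letter; case: e => //=; apply: (esym (ginvE (letter y))).
Qed.

End WordGroup.

Section Eval.
Variables (T : Type) (H : groupType) (gen : T -> H).
Local Notation ev := (eval_word gen).
Implicit Types u v : word T.

Lemma evM u v : ev (u * v)%W = (ev u * ev v)%g.
Proof. by rewrite /eval_word /wmul big_cat. Qed.

Lemma ev1 : ev 1%W = 1%g.
Proof. by rewrite /eval_word big_nil. Qed.

Lemma ev_letter y : ev (letter y) = gen y.
Proof. by rewrite /eval_word /letter big_cons big_nil mulg1. Qed.

Lemma evV u : ev u^-1%W = (ev u)^-1%g.
Proof.
elim: u => [|[y e] u IH]; first by rewrite ev1 invg1.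
rewrite /winv /= rev_cons -cats1 -/(winv u) -[_ ++ _]/(winv u * [:: (y, ~~ e)])%W evM IH.
rewrite /eval_word !big_cons big_nil mulg1 invgM; congr (_ * _)%g.
by rewrite /eval_letter /=; case: e; rewrite ?invgK.
Qed.

Lemma evX u n : ev (u ^+ n)%W = (ev u ^+ n)%g.
Proof. by elim: n => [|n IH]; rewrite ?ev1 // expgS -IH -evM. Qed.

Lemma ev_free u v : free_eq u v -> ev u = ev v.
Proof.
elim=> [//|_ _ _ <- //|_ _ _ _ -> _ -> //|a b y e].
rewrite /eval_word !big_cat !big_cons /=; congr (_ * _)%g.
by rewrite mulgA /eval_letter /=; case: e; rewrite ?mulVg ?mulgV mul1g.
Qed.

Lemma ev_normal_closure (R : word T -> word T -> Prop) u :
  (forall a b, R a b -> ev a = ev b) -> normal_closure R u -> ev u = 1%g.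
Proof.
move=> RE; elim=> [a b /RE ab||a b _ ea _ eb|a _ ea|a b _ ea|a b /ev_free ab _ ea].
- by rewrite evM evV ab mulgV.
- exact: ev1.
- by rewrite evM ea eb mulg1.
- by rewrite evV ea invg1.
- by rewrite !evM evV ea mulg1 mulgV.
by rewrite -ab.
Qed.

End Eval.

(** * Presentations of the isometry group *)

Lemma eval_forget (H : groupType) (c : name -> H) (P : pred name)
    (u : word {s | P s}) :
  eval_word (fun s => c (sval s)) u = eval_word c (forget_word u).
Proof. by rewrite /eval_word /forget_word big_map. Qed.

Section Letters.
Local Open Scope word_scope.
Variables (T : Type) (P : pred T).
Implicit Types u v : word T.

Definition lettersin u := all (fun l => P l.1) u.

Lemma lettersin_mul u v : lettersin (u * v) = lettersin u && lettersin v.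
Proof. exact: all_cat. Qed.

Lemma lettersin_exp u n : lettersin u -> lettersin (u ^+ n).
Proof. by move=> Pu; elim: n => [//|n IH]; rewrite [_ ^+ _]/(u * u ^+ n) lettersin_mul Pu. Qed.

Lemma lettersin_inv u : lettersin u^-1 = lettersin u.
Proof. by rewrite /lettersin /winv all_rev all_map. Qed.

Lemma lettersin_letter y : lettersin (letter y) = P y.
Proof. by rewrite /lettersin /= andbT. Qed.

End Letters.

(** The relations are stated on all names and the presentation on the names of
    actual generators; this lemma passes from the former to the latter. *)
Lemma forget_lift (P : pred name) (u : word name) : lettersin P u ->
  exists u' : word {s | P s}, forget_word u' = u.
Proof.
elim: u => [|[y e] u IH]; first by exists [::].
by move=> /= /andP[Py /IH[u' <-]]; exists ((exist _ y Py, e) :: u').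
Qed.

Section GroupLemmas.
Local Open Scope group_scope.
Variable H : groupType.
Implicit Types y z : H.

Lemma sqr_comm y z : y * y = 1 -> z * z = 1 -> (y * z) ^+ 2 = 1 <-> y * z = z * y.
Proof.
move=> yy zz; split=> [|yz].
  rewrite expg2 => e; rewrite -[LHS]invgK (mulg1_eq e) invgM.
  by rewrite (mulg1_eq yy) (mulg1_eq zz).
by rewrite expg2 {2}yz -mulgA (mulgA z) zz mul1g.
Qed.

Lemma cube_braid y z : y * y = 1 -> z * z = 1 ->
  (y * z) ^+ 3 = 1 <-> y * z * y = z * y * z.
Proof.
move=> yy zz; have -> : (y * z) ^+ 3 = (y * z * y) * (z * y * z).
  by rewrite !expgS expg0 mulg1 !mulgA.
split=> [e|->].
  by rewrite -[LHS]invgK (mulg1_eq e) !invgM (mulg1_eq yy) (mulg1_eq zz) mulgA.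
by rewrite !mulgA -(mulgA _ z z) zz mulg1 -(mulgA _ y y) yy mulg1.
Qed.

End GroupLemmas.

Section CoxeterRelations.
Local Open Scope word_scope.
Variables (g : nat) (R : word name -> word name -> Prop).

(** What faithfulness requires of the relations. The generators that do not exist
    for small g are excluded by the bounds, so that this covers all the
    presentations of the theorem at once. *)
Record coxeter_relations : Prop := CoxeterRelations {
  cr_aa : forall i, 1 <= i < g -> R (a_ i ^+ 2) 1;
  cr_bb : 4 <= g -> R (b_ ^+ 2) 1;
  cr_comm : forall i j, 1 <= i -> i.+1 < j < g -> R ((a_ i * a_ j) ^+ 2) 1;
  cr_braid : forall i, 1 <= i -> i.+1 < g -> R ((a_ i * a_ i.+1) ^+ 3) 1;
  cr_ab : forall i, 4 <= g -> 1 <= i < g -> i != 4 -> R ((a_ i * b_) ^+ 2) 1;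
  cr_abraid : 5 <= g -> R ((a_ 4 * b_) ^+ 3) 1;
  cr_cox : 7 <= g -> R ((a_ 2 * a_ 3 * a_ 4 * a_ 5 * a_ 6 * b_) ^+ 12)
                      ((a_ 1 * a_ 2 * a_ 3 * a_ 4 * a_ 5 * a_ 6 * b_) ^+ 9)
}.

End CoxeterRelations.

Section Presentation.
Variables (g : nat) (V : vectType 'F_2) (dot : {biscalar V}%R) (x : nat -> V).
Hypothesis hx : is_crosscap_basis dot g x.
Local Notation C := (form_space hx).
Local Notation isom := (form_aut dot).
Local Notation isom_a := (isom_a hx).
Local Notation isom_b := (isom_b hx).
Variables (P : pred name) (R : word name -> word name -> Prop).
Variable bi : nat -> isom.
Hypothesis Pa : forall i, 1 <= i < g -> P (Na i).
Hypothesis Pa_inv : forall i, P (Na i) -> 1 <= i < g.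
Hypothesis Pb : 4 <= g -> P Nb.
Hypothesis Pb_inv : P Nb -> 4 <= g.
Local Notation gen := (gen_of isom_a isom_b bi).
Hypothesis R_sound : forall u v, R u v -> eval_word gen u = eval_word gen v.
Hypothesis R_cox : coxeter_relations g R.
(* The relations alone put the generators b_i into every subgroup that contains the
   a_i and b. *)
Hypothesis R_bi : forall (H : groupType) (c : name -> H) (K : H -> Prop),
  (forall y z, K y -> K z -> K (y * z)%g) -> (forall y, K y -> K y^-1%g) ->
  (forall i, 1 <= i < g -> K (c (Na i))) -> (4 <= g -> K (c Nb)) ->
  (forall u v, R u v -> lettersin P u -> lettersin P v ->
     eval_word c u = eval_word c v) ->
  forall i, P (Nbi i) -> K (c (Nbi i)).

Local Notation T := {s | P s}.
Let R' (u v : word T) := R (forget_word u) (forget_word v).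
Let Q : groupType := wgroup R'.
Let evT (u : word T) : isom := eval_word (fun s => gen (sval s)) u.

Let evT_sound u v : R' u v -> evT u = evT v.
Proof. by move=> uv; rewrite /evT !eval_forget; apply: R_sound. Qed.

Let evT_closure u : normal_closure R' u -> evT u = 1%g.
Proof. exact: ev_normal_closure evT_sound. Qed.

(* Evaluation on a representative; it does not depend on the choice by [evQ_cls]. *)
Let evQ (q : Q) : isom := evT (repr q).

Let evQ_cls u : evQ (cls R' u) = evT u.
Proof.
have /clsP/evT_closure : cls R' (repr (cls R' u)) = cls R' u by apply: cls_repr.
by rewrite /evT evM evV => /divg1_eq.
Qed.

Let evQ_M (p q : Q) : evQ (p * q)%g = (evQ p * evQ q)%g.
Proof.
by rewrite -(cls_repr p) -(cls_repr q) -clsM !evQ_cls /evT evM.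
Qed.

Let evQ_1 : evQ 1%g = 1%g.
Proof. by rewrite -[LHS]/(evQ (cls R' 1%W)) evQ_cls /evT ev1. Qed.

Let cl (s : name) : Q := if insub s is Some t then cls R' (letter (t : T)) else 1%g.

Let cl_val (t : T) : cl (sval t) = cls R' (letter t).
Proof. by rewrite /cl (valK t). Qed.

Let cls_cl (u : word T) : cls R' u = eval_word cl (forget_word u).
Proof.
rewrite cls_eval -eval_forget /eval_word; apply: eq_bigr => -[t e] _.
by rewrite /eval_letter /= cl_val.
Qed.

Let cl_rel u v : R u v -> lettersin P u -> lettersin P v ->
  eval_word cl u = eval_word cl v.
Proof.
move=> uv /forget_lift[u' eu] /forget_lift[v' ev].
by rewrite -eu -ev -!cls_cl; apply: cls_relation; rewrite /R' eu ev.
Qed.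

Let evQ_cl s : P s -> evQ (cl s) = gen s.
Proof.
by move=> Ps; rewrite -[s]/(sval (exist _ s Ps : T)) cl_val evQ_cls /evT ev_letter.
Qed.

Let ql := (evX, evM, ev1, ev_letter).

Let qa2 i : 1 <= i < g -> (cl (Na i) * cl (Na i) = 1)%g.
Proof.
move=> gi; have := cl_rel (cr_aa R_cox gi); rewrite !ql expg2; apply=> //.
by apply: lettersin_exp; rewrite lettersin_letter Pa.
Qed.

Let qb2 : 4 <= g -> (cl Nb * cl Nb = 1)%g.
Proof.
move=> g4; have := cl_rel (cr_bb R_cox g4); rewrite !ql expg2; apply=> //.
by apply: lettersin_exp; rewrite lettersin_letter Pb.
Qed.

(** The presented group acts by evaluation, and the axioms of an action hold by the
    relations; this is where [faithful] is applied. *)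
Definition word_action : caction C.
Proof.
apply: (@CAction C Q (fun q u => evQ q u) (fun i => cl (Na i)) (cl Nb)).
- by move=> p q u; rewrite evQ_M form_autM.
- by move=> u; rewrite evQ_1 form_aut1.
- move=> i u gi; rewrite evQ_cl; last exact: Pa.
  exact: (@act_al C (isom_action hx)).
- move=> u g4; rewrite evQ_cl; last exact: Pb.
  exact: (@act_be C (isom_action hx)).
- exact: qa2.
- exact: qb2.
- move=> i j i1 ij; have gi : 1 <= i < g by rewrite -/(rank C) in ij; move: ij => /=; lia.
  have gj : 1 <= j < g by move: ij => /=; lia.
  apply/sqr_comm; rewrite ?qa2 //.
  have := cl_rel (cr_comm R_cox i1 ij); rewrite !ql; apply=> //.
  by apply: lettersin_exp; rewrite lettersin_mul !lettersin_letter !Pa.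
- move=> i i1 gi; have gi1 : 1 <= i < g by move: gi => /=; lia.
  have gi2 : 1 <= i.+1 < g by move: gi => /=; lia.
  apply/cube_braid; rewrite ?qa2 //.
  have := cl_rel (cr_braid R_cox i1 gi); rewrite !ql; apply=> //.
  by apply: lettersin_exp; rewrite lettersin_mul !lettersin_letter !Pa.
- move=> i g4 gi i4; apply/sqr_comm; rewrite ?qa2 ?qb2 //.
  have := cl_rel (cr_ab R_cox g4 gi i4); rewrite !ql; apply=> //.
  by apply: lettersin_exp; rewrite lettersin_mul !lettersin_letter Pa // Pb.
move=> g5; have g4 : 4 <= g by apply: ltnW.
have g44 : 1 <= 4 < g by [].
symmetry; apply/cube_braid; rewrite ?qa2 ?qb2 //.
have := cl_rel (cr_abraid R_cox g5); rewrite !ql; apply=> //.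
by apply: lettersin_exp; rewrite lettersin_mul !lettersin_letter Pa // Pb.
Defined.

Let A := word_action.

Let cl_Gen s : P s -> Gen true g (cl s : A).
Proof.
have ng : g <= rank C by [].
have Ga i : 1 <= i < g -> Gen true g (cl (Na i) : A) by move=> gi; apply: (@Gen_al C A).
have Gb : 4 <= g -> Gen true g (cl Nb : A) by move=> g4; apply: (@Gen_be C A).
case: s => [i /Pa_inv/Ga//|/Pb_inv/Gb//|i Pi].
apply: (R_bi (K := fun q => Gen true g (q : A)) _ _ Ga Gb cl_rel Pi).
- by move=> y z; apply: GenM.
by move=> y; apply: GenV.
Qed.

Let cls_Gen (u : word T) : Gen true g (cls R' u : A).
Proof.
rewrite cls_cl; elim: u => [|[t e] u IH]; first by rewrite /eval_word big_nil; apply: Gen1.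
rewrite /eval_word /= big_cons; apply: GenM; last exact: IH.
rewrite /eval_letter /=; have Ht := cl_Gen (svalP t).
by case: e => //; apply: GenV Ht.
Qed.

(** Surjectivity of evaluation is the generation of the isometry group by
    transvections, and a word with trivial value acts trivially, hence is trivial
    in the presented group. *)
Theorem presentation : present P R isom_a isom_b bi.
Proof.
split=> [f|u].
  have: Gen true g (f : isom_action hx) by apply: isom_Gen_all.
  elim=> [|i k gi _ [w <-]|k _ g4 _ [w <-]].
  - by exists [::]; rewrite /eval_word big_nil.
  - by exists (letter (exist _ (Na i) (Pa gi)) * w)%W; rewrite evM ev_letter.
  by exists (letter (exist _ Nb (Pb g4)) * w)%W; rewrite evM ev_letter.
split=> [eu|]; last exact: evT_closure.
have rel6 : 7 <= rank C -> (cox6 A ^+ 12 = cox7 A ^+ 9)%g.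
  move=> g7; have := cl_rel (cr_cox R_cox g7); rewrite !ql; apply;
    apply: lettersin_exp; rewrite !lettersin_mul !lettersin_letter !Pa ?Pb //;
    by move: g7 => /=; lia.
have u1 : (cls R' u : A) = 1%g.
  apply: (faithful rel6 (leqnn _)) (cls_Gen u) _ => z.
  by rewrite [LHS]/(evQ (cls R' u) z) evQ_cls [evT u]eu; apply: form_aut1.
have /clsP : cls R' u = cls R' 1%W by [].
by rewrite /wmul /winv cats0.
Qed.

End Presentation.

(** * The relations of the theorem *)

Section Relators.
Local Open Scope word_scope.
Variable g : nat.

Lemma coxeter_relations_ab : 4 <= g -> coxeter_relations g (rel_ab g).
Proof.
move=> g4; split.
- by move=> i gi; apply: rel_aa; lia.
- by move=> _; apply: rel_bb.
- by move=> i j i1 ij; apply: rel_aa_comm => //; lia.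
- by move=> i i1 ig; apply: rel_aa_braid; lia.
- by move=> i _ gi i4; apply: rel_ab_comm => //; lia.
- by move=> g5; apply: rel_ab_braid.
by move=> g7; apply: rel_E6_E7.
Qed.

Lemma coxeter_relations_even : 4 <= g -> coxeter_relations g (rel_even g).
Proof.
by move=> /coxeter_relations_ab[*]; split=> *; apply: rel_even_ab; auto.
Qed.

Lemma coxeter_relations_N2 : coxeter_relations 2 rel_N2.
Proof.
split=> //; try lia.
by move=> i gi; have -> : i = 1%N by lia; apply: rel_N2_1.
Qed.

Lemma coxeter_relations_N3 : coxeter_relations 3 rel_N3.
Proof.
split=> //; try lia.
- move=> i gi; have [->|->] : i = 1%N \/ i = 2 by lia.
    exact: rel_N3_1.
  exact: rel_N3_2.
by move=> i i1 gi; have -> : i = 1%N; [lia|apply: rel_N3_3].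
Qed.

(** Each b_i is expressed through the a_j, b and the two preceding b_j. *)
Lemma bi_redundant (H : groupType) (c : name -> H) (K : H -> Prop) :
  8 <= g -> ~~ odd g ->
  (forall y z, K y -> K z -> K (y * z)%g) -> (forall y, K y -> K y^-1%g) ->
  (forall i, 1 <= i < g -> K (c (Na i))) -> (4 <= g -> K (c Nb)) ->
  (forall u v, rel_even g u v -> lettersin (gens_even g) u ->
     lettersin (gens_even g) v -> eval_word c u = eval_word c v) ->
  forall i, gens_even g (Nbi i) -> K (c (Nbi i)).
Proof.
move=> g8 ge KM KV Ka Kb sound.
have KX y n : K y -> K (y ^+ n.+1)%g.
  by move=> Ky; elim: n => [//|n IH]; rewrite expgS; apply: KM.
have ql := (@evX _ H c, @evM _ H c, @evV _ H c, @ev_letter _ H c).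
have Kb4 : K (c Nb) by apply: Kb; lia.
elim/ltn_ind => -[|[|[|i]]] IH; rewrite /gens_even => gi.
- have := sound _ _ (rel_b0 g); rewrite !ql => -> //=; last by lia.
  by apply: Ka; lia.
- by have := sound _ _ (rel_b1 g); rewrite !ql => -> //=; lia.
- have := sound _ _ (rel_b2 g); rewrite !ql => ->; first last.
  + by rewrite lettersin_exp //=; lia.
  + by rewrite /=; lia.
  by apply: KX; do !apply: (KM _ _ _ _) => //; apply: (Ka _ _); lia.
have ri : 2 <= i.+2 <= (g - 4) %/ 2 by lia.
have := sound _ _ (rel_bS ri); rewrite !ql => ->; first last.
- by rewrite lettersin_mul lettersin_exp ?lettersin_inv ?lettersin_exp //=; lia.
- by rewrite /=; lia.
have [K1 K2] : K (c (Nbi i.+1)) /\ K (c (Nbi i.+2)) by split; apply: IH; rewrite /gens_even; lia.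
by apply: (KM _ _ _ _); [|apply: KV]; apply: (KX _ _ _); do !apply: (KM _ _ _ _) => //; apply: (Ka _ _); lia.
Qed.

End Relators.

Section Soundness.
Local Open Scope group_scope.
Variables (g : nat) (V : vectType 'F_2) (dot : {biscalar V}%R) (x : nat -> V).
Hypothesis hx : is_crosscap_basis dot g x.
Local Notation C := (form_space hx).
Local Notation tv := (@transvection g V dot x hx).
Local Notation isom := (form_aut dot).
Local Notation isom_a := (isom_a hx).
Local Notation isom_b := (isom_b hx).
Local Notation I := (isom_action hx).

(** The five transvections along y_i + y_(i+1) permute the frame, and their product
    k is a cycle of length six. Together with the sixth transvection they form a Coxeter
    diagram of type D_6, and the fifth power of the Coxeter element is the central
    element -1 of this Weyl group. *)
Lemma tv_frame (y1 y2 y3 y4 y5 y6 : V) :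
  @orthonormal C [:: y1; y2; y3; y4; y5; y6] ->
  let k := tv (y1 + y2)%R * tv (y2 + y3)%R * tv (y3 + y4)%R * tv (y4 + y5)%R
             * tv (y5 + y6)%R in
  (k * tv (y1 + y2 + y3 + y4)%R) ^+ 5 = tv (y1 + y2 + y3 + y4 + y5 + y6)%R
  /\ k ^+ 6 = 1.
Proof.
set ys := [:: _; _; _; _; _; _] => oys k.
have st m (v : V) : size m = 6 -> v = @emb C ys m -> dotb m m = false ->
    @simulates C ys (fun u => tv v u) (taub m).
  move=> sm ve mm; apply: (@sim_tau C _ m _ v) => // u; apply: tv_act.
  by rewrite ve B_emb.
have sM (k1 k2 : isom) F H : @simulates C ys (fun u => k1 u) F ->
    @simulates C ys (fun u => k2 u) H ->
    @simulates C ys (fun u => (k1 * k2) u) (fun s => F (H s)).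
  by move=> s1 s2 u s us ss; rewrite form_autM; apply: (@sim_comp C _ _ _ _ _ s1 s2).
have sX (k1 : isom) F n : @simulates C ys (fun u => k1 u) F ->
    @simulates C ys (fun u => (k1 ^+ n) u) (iter n F).
  move=> s1 u s us ss.
  have [sF <-] := @sim_iter C ys (fun u => k1 u) F n s1 u s us ss; split=> //.
  exact: (@act_exp C I).
have st1 : @simulates C ys (fun u => tv (y1 + y2)%R u) (taub [:: true; true; false; false; false; false]).
  by apply: st => //; rewrite /emb /= !big_cons big_nil addr0.
have st2 : @simulates C ys (fun u => tv (y2 + y3)%R u) (taub [:: false; true; true; false; false; false]).
  by apply: st => //; rewrite /emb /= !big_cons big_nil addr0.
have st3 : @simulates C ys (fun u => tv (y3 + y4)%R u) (taub [:: false; false; true; true; false; false]).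
  by apply: st => //; rewrite /emb /= !big_cons big_nil addr0.
have st4 : @simulates C ys (fun u => tv (y4 + y5)%R u) (taub [:: false; false; false; true; true; false]).
  by apply: st => //; rewrite /emb /= !big_cons big_nil addr0.
have st5 : @simulates C ys (fun u => tv (y5 + y6)%R u) (taub [:: false; false; false; false; true; true]).
  by apply: st => //; rewrite /emb /= !big_cons big_nil addr0.
have stq : @simulates C ys (fun u => tv (y1 + y2 + y3 + y4)%R u) (taub [:: true; true; true; true; false; false]).
  by apply: st => //; rewrite /emb /= !big_cons big_nil addr0 !addrA.
have stw : @simulates C ys (fun u => tv (y1 + y2 + y3 + y4 + y5 + y6)%R u) (taub (nseq 6 true)).
  by apply: st => //; rewrite /emb /= !big_cons big_nil addr0 !addrA.
have sk := sM _ _ _ _ (sM _ _ _ _ (sM _ _ _ _ (sM _ _ _ _ st1 st2) st3) st4) st5.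
split; apply: form_autP => u.
  by move: u; apply: (sim_check oys (sX _ _ 5 (sM _ _ _ _ sk stq)) stw); vm_compute.
rewrite form_aut1; move: u.
by apply: (sim_check oys (sX _ _ 6 sk) (@sim_id C ys)); vm_compute.
Qed.

Definition isom_bi i : isom := tv (@w C (2 * i + 2)).

Let gg : g = rank C. Proof. by []. Qed.

Lemma isom_b0 : isom_bi 0 = isom_a 1%N.
Proof. by rewrite /isom_bi /w big_ltn // big_nat1. Qed.

Lemma isom_b1 : isom_bi 1%N = isom_b.
Proof. by rewrite /isom_bi w4. Qed.

Lemma isom_b2 : 6 <= g ->
  isom_bi 2 = (isom_a 1%N * isom_a 2 * isom_a 3 * isom_a 4 * isom_a 5 * isom_b) ^+ 5.
Proof.
move=> g6; have [] := @tv_frame (x 1%N) (x 2) (x 3) (x 4) (x 5) (x 6).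
  by apply: (@orthonormal_core C 1%N 6) => //; rewrite -gg; lia.
by move=> /= e _; rewrite [RHS]e /isom_bi -[2 * 2 + 2]/6 (@wS C 5) (@wS C 4) w4.
Qed.

(** In the frame w_(2i-1), x_(2i), ..., x_(2i+4), where w_j = x_1 + ... + x_j, the
    transvections b_(i-1), b_i and b_(i+1) are along the sums of the first two,
    four and six vectors; the factor k^-6 is trivial. *)
Lemma isom_bS i : 2 <= i -> 2 * i + 4 <= g ->
  let k := isom_bi i.-1 * isom_a (2 * i) * isom_a (2 * i + 1) * isom_a (2 * i + 2)
             * isom_a (2 * i + 3) in
  isom_bi i.+1 = (k * isom_bi i) ^+ 5 * k ^- 6.
Proof.
case: i => [|i] //= i1 ig; set n := (2 * i).+1.
have [] := @tv_frame (@w C n) (x n.+1) (x n.+2) (x n.+3) (x n.+4) (x n.+4.+1).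
  apply/andP; split; first by rewrite B_ww -?gg /n; [lia|blia].
  apply/andP; split; last first.
    by apply: (@orthonormal_core C n.+1 5); rewrite -?gg /n; blia.
  have wx j : n < j <= g -> ~~ @B C (@w C n) (x j).
    by move=> nj; rewrite (@BC C) (@B_xw C) -?gg /n; blia.
  by rewrite /= !wx //; rewrite /n; blia.
have e1 : (2 * i + 2 = n.+1)%N by rewrite /n; lia.
have e2 : (2 * i.+1 = n.+1)%N by rewrite /n; lia.
rewrite /isom_bi /isom_a !e2 e1 (_ : (2 * i.+2 + 2 = n.+4.+1)%N) 1?{1}/n; last by lia.
rewrite !addn1 !addn2 !addn3 !(@wS C) => /= e6 e1'.
by rewrite e6 e1' invg1 mulg1.
Qed.

(** b_((g-2)/2) is the transvection along w, to which every even vector is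
    orthogonal. *)
Lemma isom_b_last : 8 <= g -> ~~ odd g ->
  isom_a (g - 5) * isom_bi ((g - 2) %/ 2) = isom_bi ((g - 2) %/ 2) * isom_a (g - 5).
Proof.
move=> g8 ge; rewrite /isom_bi (_ : (2 * _ + 2 = g)%N); last by lia.
have aa : @B C (x (g - 5) + x (g - 5).+1)%R (x (g - 5) + x (g - 5).+1)%R = false.
  by apply: (@xx_even C); rewrite -gg; lia.
apply: tv_comm => //; first by rewrite B_ww // -?gg (negbTE ge).
rewrite B_w // => j; rewrite -gg; lia.
Qed.

Lemma rel_ab_sound bi u v : 4 <= g -> rel_ab g u v ->
  eval_word (gen_of isom_a isom_b bi) u = eval_word (gen_of isom_a isom_b bi) v.
Proof.
move=> g4; pose gen := gen_of isom_a isom_b bi; rewrite -/gen.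
have ql := (@evX _ _ gen, @evM _ _ gen, @ev1 _ _ gen, @ev_letter _ _ gen).
have a2 i : 1 <= i < g -> isom_a i * isom_a i = 1 by apply: (@al2 C I).
have b2 : isom_b * isom_b = 1 by apply: (@be2 C I).
case=> [i gi||i j _ gi gj ij|i _ gi|i _ gi i4|g5|g7]; rewrite !ql.
- by rewrite expg2; apply: a2; lia.
- by rewrite expg2.
- apply/sqr_comm; [by apply: a2; lia|by apply: a2; lia|].
  by apply: (@al_commP C I); rewrite -?gg; lia.
- apply/cube_braid; [by apply: a2; lia|by apply: a2; lia|].
  by apply: (@al_braid C I); rewrite -?gg; lia.
- apply/sqr_comm; [by apply: a2; lia|by []|].
  by apply: (@al_be C I) => //; rewrite -?gg; lia.
- apply/cube_braid; [by apply: a2; lia|by []|].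
  by symmetry; apply: (@be_braid C I).
have [c6 c7] := @cox_act C I g7.
by apply: form_autP => z; rewrite [LHS]c6 [RHS]c7.
Qed.

Lemma rel_even_sound u v : 8 <= g -> ~~ odd g -> rel_even g u v ->
  eval_word (gen_of isom_a isom_b isom_bi) u =
  eval_word (gen_of isom_a isom_b isom_bi) v.
Proof.
move=> g8 ge; pose gen := gen_of isom_a isom_b isom_bi; rewrite -/gen.
have ql := (@evX _ _ gen, @evM _ _ gen, @evV _ _ gen, @ev1 _ _ gen, @ev_letter _ _ gen).
case=> [u' v' uv||||i gi k|y z]; rewrite ?ql.
- by apply: rel_ab_sound => //; lia.
- exact: isom_b0.
- exact: isom_b1.
- by apply: isom_b2; lia.
- by apply: isom_bS; lia.
by rewrite [X in X * _ * _]isom_b_last // mulgK mulgV.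
Qed.

Lemma rel_N2_sound bi u v : g = 2 -> rel_N2 u v ->
  eval_word (gen_of isom_a isom_b bi) u = eval_word (gen_of isom_a isom_b bi) v.
Proof.
by move=> g2 []; rewrite evX ev1 ev_letter expg2; apply: (@al2 C I); rewrite -gg g2.
Qed.

Lemma rel_N3_sound bi u v : g = 3 -> rel_N3 u v ->
  eval_word (gen_of isom_a isom_b bi) u = eval_word (gen_of isom_a isom_b bi) v.
Proof.
move=> g3; have a2 i : 1 <= i < 3 -> isom_a i * isom_a i = 1.
  by move=> i3; apply: (@al2 C I); rewrite -gg g3.
case; rewrite !(evX, evM, ev1, ev_letter).
- by rewrite expg2; apply: a2.
- by rewrite expg2; apply: a2.
apply/cube_braid; [exact: a2|exact: a2|].
by apply: (@al_braid C I); rewrite -?gg ?g3.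
Qed.

End Soundness.

(** ** Genus one and two *)

Section SmallGenus.
Local Open Scope group_scope.
Variables (g : nat) (V : vectType 'F_2) (dot : {biscalar V}%R) (x : nat -> V).
Hypothesis hx : is_crosscap_basis dot g x.
Local Notation isom := (form_aut dot).
Local Notation isom_a := (isom_a hx).

Lemma isom_trivial (f : isom) : g = 1%N -> f = 1.
Proof.
by move=> g1; elim: (isom_Gen_all hx f) => [//|i k|k]; lia.
Qed.

Lemma isom_rank2 (f : isom) : g = 2 -> f = 1 \/ f = isom_a 1%N.
Proof.
move=> g2; have a2 : isom_a 1%N * isom_a 1%N = 1.
  by apply: (@al2 _ (isom_action hx)); rewrite /= g2.
elim: (isom_Gen_all hx f) => [|i k i2 _ IH|k]; [by left| |by lia].
have -> : i = 1%N by lia.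
by case: IH => ->; [right; rewrite mulg1|left].
Qed.

Lemma isom_rank2_Z2 : g = 2 -> exists phi : isom -> 'Z_2,
  bijective phi /\ {morph phi : f h / f * h >-> (f + h)%R}.
Proof.
move=> g2; set t := isom_a 1%N.
have a2 : t * t = 1 by apply: (@al2 _ (isom_action hx)); rewrite /= g2.
have t1 : t != 1.
  apply/eqP => t1; have [| e _ _] := @is_a_isom _ _ _ _ hx 1%N; first by rewrite g2.
  have := proj2 hx 1%N 1%N; have := proj2 hx 2 1%N; rewrite g2 -e.
  by rewrite -/t t1 form_aut1 => -> // /(_ isT isT).
have two := isom_rank2 ^~ g2.
pose phi (f : isom) : 'Z_2 := if f == 1 then 0%R else 1%R.
exists phi; split.
  exists (fun z : 'Z_2 => if z == 0%R then 1 else t) => [f|z].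
    by rewrite /phi; case: (two f) => ->; rewrite ?eqxx // (negbTE t1).
  rewrite /phi; case: (F2_cases (z : 'F_2)) => -> /=; first by rewrite eqxx.
  by rewrite (negbTE t1).
move=> f h; rewrite /phi; case: (two f) => ->; case: (two h) => ->;
  rewrite ?mul1g ?mulg1 ?a2 ?eqxx ?(negbTE t1) ?add0r ?addr0 //.
by apply: val_inj.
Qed.

End SmallGenus.

Local Open Scope ring_scope.

Theorem theorem1p1 (g : nat) (hg : (1 <= g)%N)
  (V : vectType 'F_2) (dot : {biscalar V}) (x : nat -> V)
  (hx : is_crosscap_basis dot g x) :
  exists (a : nat -> form_aut dot) (b : form_aut dot),
    (forall i, (1 <= i <= g - 1)%N -> is_a g x i (a i)) /\
    ((4 <= g)%N -> is_b g x b) /\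
    (g = 1%N -> forall f : form_aut dot, f = 1%g) /\
    (g = 2%N ->
       present (gens_a g) rel_N2 a b (fun=> 1%g) /\
       exists phi : form_aut dot -> 'Z_2,
         bijective phi /\ {morph phi : f h / (f * h)%g >-> f + h}) /\
    (g = 3%N -> present (gens_a g) rel_N3 a b (fun=> 1%g)) /\
    ((4 <= g)%N && (odd g || (g == 4%N) || (g == 6%N)) ->
       present (gens_ab g) (rel_ab g) a b (fun=> 1%g)) /\
    ((8 <= g)%N && ~~ odd g ->
       exists bi : nat -> form_aut dot,
         present (gens_even g) (rel_even g) a b bi).
Proof.
have aP i : (1 <= i < g)%N = (1 <= i <= g.-1)%N by lia.
exists (isom_a hx), (isom_b hx); split; first by move=> i; apply: is_a_isom.
split; first exact: is_b_isom.
split; first by move=> g1 f; exact: (isom_trivial hx).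
split.
  move=> g2; split; last exact: isom_rank2_Z2 hx g2.
  apply: presentation => //=; try by [lia|move=> i; rewrite aP].
    by move=> u v; apply: rel_N2_sound.
  by rewrite g2; apply: coxeter_relations_N2.
split.
  move=> g3; apply: presentation => //=; try by [lia|move=> i; rewrite aP].
    by move=> u v; apply: rel_N3_sound.
  by rewrite g3; apply: coxeter_relations_N3.
split.
  move=> /andP[g4 _]; apply: presentation => //=; try by [lia|move=> i; rewrite aP].
    by move=> u v; apply: rel_ab_sound.
  exact: coxeter_relations_ab.
move=> /andP[g8 ge]; have g4 : (4 <= g)%N by apply: leq_trans g8.
exists (isom_bi hx); apply: presentation => //=; try by [move=> i; rewrite aP].
- by move=> u v; apply: rel_even_sound.
- exact: coxeter_relations_even.
by move=> H c K; apply: bi_redundant.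
Qed.
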